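(* Let $\Gamma$ be a nontrivial finite subgroup of $SU_2$, let $\pi$ be the character of its natural two-dimensional representation, and let $\xi=2\gamma_0-\pi$. Let $\mathfrak g$ be the simple Lie algebra of ADE type whose affine Cartan matrix is $A=(a_{ij})_{0\le i,j\le r}$, $a_{ij}=\langle\gamma_i,\gamma_j\rangle_\xi$, and let $\widehat{\widehat{\mathfrak g}}$ be the associated toroidal Lie algebra. Then a vertex representation of $\widehat{\widehat{\mathfrak g}}$ is defined on the space $\mathcal F_\Gamma$ by letting $$x_n(\alpha_i)\mapsto X_n(\gamma_i),\qquad x_n(-\alpha_i)\mapsto X_n(-\gamma_i),\qquad h_i(n)\mapsto a_n(\gamma_i),\qquad C\mapsto1,$$ where $n\in\mathbb Z$, $0\le i\le r$.
   Context: $\Gamma^*=\{\gamma_0,\dots,\gamma_r\}$ are the complex irreducible characters of $\Gamma$ ($\gamma_0$ trivial); $\Gamma_*$ its conjugacy classes; $R(\Gamma)=\bigoplus_i\mathbb C\gamma_i$, $R_{\mathbb Z}(\Gamma)=\bigoplus_i\mathbb Z\gamma_i$. For a finite group $G$, $\langle f,g\rangle_G=\frac1{|G|}\sum_{x\in G}f(x)g(x^{-1})$; $*$ is pointwise multiplication; $\langle f,g\rangle_\xi=\langle\xi*f,g\rangle_\Gamma$ on $R(\Gamma)$. It is a known fact (McKay) that $A=(\langle\gamma_i,\gamma_j\rangle_\xi)$ is an affine Cartan matrix of ADE type. Toroidal Lie algebra $\widehat{\widehat{\mathfrak g}}$: the complex Lie algebra with generators $C$, $h_i(n)$, $x_n(\pm\alpha_i)$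 ($n\in\mathbb Z$, $i=0,\dots,r$) and relations: $C$ is central, and for all $n,m\in\mathbb Z$, $0\le i,j\le r$, $[h_i(n),h_j(m)]=n\,a_{ij}\delta_{n,-m}C$; $[h_i(n),x_m(\pm\alpha_j)]=\pm a_{ij}x_{n+m}(\pm\alpha_j)$; $[x_n(\alpha_i),x_m(-\alpha_j)]=\delta_{ij}\,\epsilon(\alpha_i,-\alpha_i)\{h_i(n+m)+n\delta_{n,-m}C\}$; $[x_n(\pm\alpha_i),x_m(\pm\alpha_i)]=0$; $(\mathrm{ad}\,x_0(\pm\alpha_i))^{1-a_{ij}}x_m(\pm\alpha_j)=0$ for $i\ne j$. Here the affine root lattice $\bigoplus\mathbb Z\alpha_i$ is identified with $R_{\mathbb Z}(\Gamma)$ via $\alpha_i\leftrightarrow\gamma_i$, and $\epsilon$ is a fixed 2-cocycle $R_{\mathbb Z}(\Gamma)\times R_{\mathbb Z}(\Gamma)\to\mathbb C^\times$: $\epsilon(\gamma,0)=\epsilon(0,\gamma)=1$, $\epsilon(\alpha,\beta)\epsilon(\alpha+\beta,\gamma)=\epsilon(\alpha,\beta+\gamma)\epsilon(\beta,\gamma)$, with $\epsilon(\alpha,\beta)\epsilon(\beta,\alpha)^{-1}=(-1)^{\langle\alpha,\beta\rangle_\xi+\langle\alpha,\alpha\rangle_\xi\langle\beta,\beta\rangle_\xi}$ (it exists and is unique up to equivalence). Wreath products: $\Gamma_n=\Gamma^n\rtimes S_n$ with $(g,\sigma)(h,\tau)=(g\,\sigma(h),\sigma\tau)$, $\sigma(g_1,\dots,g_n)=(g_{\sigma^{-1}(1)},\dots,g_{\sigma^{-1}(n)})$;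 $R(\Gamma_n)$ is the space of complex class functions, $R_\Gamma=\bigoplus_{n\ge0}R(\Gamma_n)$. For a representation $V$ of $\Gamma$ with character $\gamma$, $\eta_n(\gamma)$ is the character of the $\Gamma_n$-module $V^{\otimes n}$, and $\varepsilon_n(\gamma)$ the character of $V^{\otimes n}$ tensored with the sign representation of $S_n$. The map $\eta_n$ is extended to virtual characters by $\eta_n(\beta-\gamma)=\sum_{m=0}^n(-1)^m\mathrm{Ind}_{\Gamma_{n-m}\times\Gamma_m}^{\Gamma_n}[\eta_{n-m}(\beta)\otimes\varepsilon_m(\gamma)]$; $\varepsilon_n(\gamma)$ for virtual $\gamma$ is $\eta_n(\gamma)$ times the sign character. The weighted form on $R(\Gamma_n)$ is $\langle f,g\rangle_\xi=\langle\eta_n(\xi)*f,g\rangle_{\Gamma_n}$. Operators on $R_\Gamma$ ($n\ge0$): $H_{-n}(\gamma)$ sends $f\in R(\Gamma_m)$ to $\mathrm{Ind}_{\Gamma_n\times\Gamma_m}^{\Gamma_{n+m}}(\eta_n(\gamma)\otimes f)$; $E_n(\gamma)$ sends $f\in R(\Gamma_m)$ to the element of $R(\Gamma_{m-n})$ obtained by restricting $f$ to $\Gamma_n\times\Gamma_{m-n}$ and applying $\langle\varepsilon_n(\gamma),\cdot\rangle_\xi$ to the first factor (zero if $n>m$); $H_0=E_0=\mathrm{id}$. Put $H_+(\gamma,z)=\sum_{n\ge0}H_{-n}(\gamma)z^n$, $E_-(\gamma,z)=\sum_{n\ge0}E_n(\gamma)(-z)^{-n}$. $\mathbb C[R_{\mathbb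 Z}(\Gamma)]$ has basis $e^\beta$; $e^\alpha$ acts by $e^\alpha.e^\beta=\epsilon(\alpha,\beta)e^{\alpha+\beta}$, $\partial_\gamma e^\beta=\langle\gamma,\beta\rangle_\xi e^\beta$, $z^{\partial_\gamma}e^\beta=z^{\langle\gamma,\beta\rangle_\xi}e^\beta$. $\mathcal F_\Gamma=R_\Gamma\otimes\mathbb C[R_{\mathbb Z}(\Gamma)]$, each operator acting on its own factor. For $\gamma\in R_{\mathbb Z}(\Gamma)$, $$X(\gamma,z)=H_+(\gamma,z)E_-(\gamma,z)e^\gamma z^{\partial_\gamma}=\sum_{n\in\mathbb Z+\langle\gamma,\gamma\rangle_\xi/2}X_n(\gamma)z^{-n-\langle\gamma,\gamma\rangle_\xi/2}.$$ Heisenberg operators on $\mathcal F_\Gamma$: for $n>0$ let $\sigma_n(\gamma)$ be the class function on $\Gamma_n$ with value $n\gamma(c)$ on elements $(g,s)$ with $s$ an $n$-cycle $(i_1\cdots i_n)$ and $g_{i_n}\cdots g_{i_1}\in c$ (for each $c\in\Gamma_*$), and $0$ elsewhere. On $R_\Gamma$, $a_{-n}(\gamma)$ sends $f\in R(\Gamma_m)$ to $\mathrm{Ind}(\sigma_n(\gamma)\otimes f)\in R(\Gamma_{n+m})$, and $a_n(\gamma)$ sends $f\in R(\Gamma_m)$ to the element of $R(\Gamma_{m-n})$ obtained by restricting to $\Gamma_n\times\Gamma_{m-n}$ and applying $\langle\sigma_n(\gamma),\cdot\rangle_\xi$ to the first factor; these act trivially on $\mathbb C[R_{\mathbb Z}(\Gamma)]$.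 On $\mathcal F_\Gamma$, $a_0(\gamma)$ acts as $\partial_\gamma$. *)

(* Defs.v *)
From HB Require Import structures.
From mathcomp Require Import all_boot all_order all_algebra all_fingroup.
From mathcomp Require Import generic_quotient mxrepresentation spectral.
From mathcomp Require Import boolp classical_sets functions cardinality fsbigop.
From mathcomp Require Import reals complex.

Set Implicit Arguments.
Unset Strict Implicit.
Unset Printing Implicit Defensive.

Import Order.TTheory GRing.Theory Num.Theory GroupScope.
Local Open Scope ring_scope.

Section ClassFunctions.

Variables (C : numClosedFieldType) (T : finGroupType).

Definition is_classfun (f : {ffun T -> C}) : bool :=
  [forall x, forall y, f (x ^ y)%g == f x].

Record classFun := ClassFun { cfval :> {ffun T -> C}; _ : is_classfun cfval }.

HB.instance Definition _ := [isSub for cfval].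
HB.instance Definition _ := [Choice of classFun by <:].

Lemma is_classfunP (f : {ffun T -> C}) :
  reflect (forall x y, f (x ^ y)%g = f x) (is_classfun f).
Proof.
apply: (iffP forallP) => [h x y|h x]; first by have /forallP/(_ y)/eqP := h x.
by apply/forallP => y; rewrite h.
Qed.

Lemma classfunJ (f : classFun) x y : f (x ^ y)%g = f x.
Proof. by case: f => f /= /is_classfunP. Qed.

Lemma classfunP (f g : classFun) : (forall x, f x = g x) -> f = g.
Proof. by move=> h; apply: val_inj; apply/ffunP. Qed.

Lemma cf_subproof (F : T -> C) :
  (forall x y, F (x ^ y)%g = F x) -> is_classfun [ffun x => F x].
Proof. by move=> h; apply/is_classfunP => x y; rewrite !ffunE. Qed.

Definition mkcf (F : T -> C) (h : forall x y, F (x ^ y)%g = F x) : classFun :=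
  ClassFun (cf_subproof h).

Lemma mkcfE F h x : @mkcf F h x = F x.
Proof. by rewrite ffunE. Qed.

Lemma cf_zeroJ (x y : T) : 0 = 0 :> C. Proof. by []. Qed.
Lemma cf_oneJ (x y : T) : 1 = 1 :> C. Proof. by []. Qed.
Lemma cf_oppJ (f : classFun) x y : - f (x ^ y)%g = - f x.
Proof. by rewrite classfunJ. Qed.
Lemma cf_addJ (f g : classFun) x y :
  f (x ^ y)%g + g (x ^ y)%g = f x + g x.
Proof. by rewrite !classfunJ. Qed.
Lemma cf_mulJ (f g : classFun) x y :
  f (x ^ y)%g * g (x ^ y)%g = f x * g x.
Proof. by rewrite !classfunJ. Qed.
Lemma cf_scaleJ a (f : classFun) x y : a * f (x ^ y)%g = a * f x.
Proof. by rewrite classfunJ. Qed.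

Definition cf_zero := mkcf cf_zeroJ.
Definition cf_one := mkcf cf_oneJ.
Definition cf_opp f := mkcf (cf_oppJ f).
Definition cf_add f g := mkcf (cf_addJ f g).
Definition cf_mul f g := mkcf (cf_mulJ f g).
Definition cf_scale a f := mkcf (cf_scaleJ a f).

Fact cf_addA : associative cf_add.
Proof. by move=> f g h; apply: classfunP => x; rewrite !mkcfE addrA. Qed.
Fact cf_addC : commutative cf_add.
Proof. by move=> f g; apply: classfunP => x; rewrite !mkcfE addrC. Qed.
Fact cf_add0 : left_id cf_zero cf_add.
Proof. by move=> f; apply: classfunP => x; rewrite !mkcfE add0r. Qed.
Fact cf_addN : left_inverse cf_zero cf_opp cf_add.
Proof. by move=> f; apply: classfunP => x; rewrite !mkcfE addNr. Qed.

HB.instance Definition _ :=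
  GRing.isZmodule.Build classFun cf_addA cf_addC cf_add0 cf_addN.

Fact cf_scaleA a b f : cf_scale a (cf_scale b f) = cf_scale (a * b) f.
Proof. by apply: classfunP => x; rewrite !mkcfE mulrA. Qed.
Fact cf_scale1 : left_id 1 cf_scale.
Proof. by move=> f; apply: classfunP => x; rewrite !mkcfE mul1r. Qed.
Fact cf_scaleDr : right_distributive cf_scale +%R.
Proof. by move=> a f g; apply: classfunP => x; rewrite !mkcfE mulrDr. Qed.
Fact cf_scaleDl f : {morph cf_scale^~ f : a b / a + b}.
Proof. by move=> a b; apply: classfunP => x; rewrite !mkcfE mulrDl. Qed.

HB.instance Definition _ := GRing.Zmodule_isLmodule.Build C classFun
  cf_scaleA cf_scale1 cf_scaleDr cf_scaleDl.

Lemma cf0E x : (0 : classFun) x = 0. Proof. exact: mkcfE. Qed.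
Lemma cfDE (f g : classFun) x : (f + g) x = f x + g x. Proof. exact: mkcfE. Qed.
Lemma cfZE a (f : classFun) x : (a *: f) x = a * f x. Proof. exact: mkcfE. Qed.

Definition cform (f g : T -> C) : C :=
  (#|T|%:R)^-1 * \sum_x f x * g (x^-1)%g.

Section Afforded.
Variables (d : nat) (V : mx_representation C [set: T] d).

Lemma rchar_subproof x y : \tr (V (x ^ y)%g) = \tr (V x).
Proof.
rewrite /conjg !repr_mxM ?inE ?groupM ?groupV ?inE // mxtrace_mulC.
by rewrite -mulmxA -repr_mxM ?inE ?groupV ?inE // mulgV repr_mx1 mulmx1.
Qed.

Definition rchar : classFun := mkcf rchar_subproof.
End Afforded.

Definition irr_char (f : classFun) : Prop :=
  exists d (V : mx_representation C [set: T] d), mx_irreducible V /\ f = rchar V.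

End ClassFunctions.

(* Induction along an injective morphism i : H -> K; the inner sum has at most *)
(* one term, the value of f at the preimage of x ^ y if x ^ y lies in i(H).    *)
Section Induction.
Variables (C : numClosedFieldType) (H K : finGroupType) (i : H -> K).
Variable f : H -> C.

Definition indfun (x : K) : C :=
  (#|H|%:R)^-1 * \sum_(y : K) \sum_(h : H | i h == (x ^ y)%g) f h.

Lemma indfunJ x z : indfun (x ^ z)%g = indfun x.
Proof.
rewrite /indfun; congr (_ * _); rewrite [RHS](reindex_inj (mulgI z)) /=.
by apply: eq_bigr => y _; apply: eq_bigl => h; rewrite conjgM.
Qed.

Definition cfInduce : classFun C K := mkcf indfunJ.
End Induction.

Section Wreath.
Variable G : finGroupType.

Record wreath n := Wreath { wbase : {ffun 'I_n -> G}; wperm : {perm 'I_n} }.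

Section Group.
Variable n : nat.
Implicit Types x y z : wreath n.

Definition wreath_pair x := (wbase x, wperm x).
Definition pair_wreath (p : {ffun 'I_n -> G} * {perm 'I_n}) :=
  Wreath p.1 p.2.
Lemma wreath_pairK : cancel wreath_pair pair_wreath. Proof. by case. Qed.

HB.instance Definition _ := Finite.copy (wreath n) (can_type wreath_pairK).

Lemma wreathP x y :
  (forall i, wbase x i = wbase y i) -> (forall i, wperm x i = wperm y i) -> x = y.
Proof. by case: x y => [g s] [h t] /= /ffunP -> /permP ->. Qed.

(* The library composes permutations from left to right, so the composite     *)
(* sigma o tau of the mathematical product is the library's tau * sigma.       *)
Definition wmul x y := Wreath
  [ffun i => wbase x i * wbase y ((wperm x)^-1 i)]%g (wperm y * wperm x)%g.
Definition wone : wreath n := Wreath [ffun=> 1%g] 1%g.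
Definition winv x := Wreath [ffun i => (wbase x (wperm x i))^-1]%g (wperm x)^-1%g.

Fact wmulA : associative wmul.
Proof.
move=> x y z; apply: wreathP => i; last by rewrite /= mulgA.
by rewrite /= !ffunE mulgA invMg permM.
Qed.
Fact wmul1 : left_id wone wmul.
Proof.
move=> x; apply: wreathP => i; last by rewrite /= mulg1.
by rewrite /= !ffunE mul1g invg1 perm1.
Qed.
Fact wmulV : left_inverse wone winv wmul.
Proof.
move=> x; apply: wreathP => i; last by rewrite /= mulgV.
by rewrite /= !ffunE invgK mulVg.
Qed.

HB.instance Definition _ := Finite_isGroup.Build (wreath n) wmulA wmul1 wmulV.

Lemma wbaseM x y i : wbase (x * y)%g i = (wbase x i * wbase y ((wperm x)^-1%g i))%g.
Proof. by rewrite ffunE. Qed.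
Lemma wpermM x y : wperm (x * y)%g = (wperm y * wperm x)%g. Proof. by []. Qed.
Lemma wbase1 i : wbase (1%g : wreath n) i = 1%g. Proof. by rewrite ffunE. Qed.
Lemma wperm1 : wperm (1%g : wreath n) = 1%g. Proof. by []. Qed.
Lemma wpermV x : wperm x^-1%g = (wperm x)^-1%g. Proof. by []. Qed.

End Group.

Section Embedding.
Variables (n m k : nat) (e : (n + m)%N = k).

Definition psum_fun (s : 'I_n -> 'I_n) (t : 'I_m -> 'I_m) (i : 'I_k) : 'I_k :=
  cast_ord e (unsplit match fintype.split (cast_ord (esym e) i) with
                      | inl a => inl (s a) | inr b => inr (t b) end).

Lemma psum_comp s t s' t' i :
  psum_fun s t (psum_fun s' t' i) = psum_fun (s \o s') (t \o t') i.
Proof.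
rewrite /psum_fun cast_ordK unsplitK.
by case: (fintype.split (cast_ord (esym e) i)).
Qed.

Lemma psum_id s t i : s =1 id -> t =1 id -> psum_fun s t i = i.
Proof.
move=> sE tE; rewrite /psum_fun; set u := fintype.split _.
have -> : match u with inl a => inl (s a) | inr b => inr (t b) end = u.
  by case: u => a; rewrite ?sE ?tE.
by rewrite splitK cast_ordKV.
Qed.

Lemma psum_inj (s : {perm 'I_n}) (t : {perm 'I_m}) : injective (psum_fun s t).
Proof.
apply: (can_inj (g := psum_fun s^-1%g t^-1%g)) => i.
by rewrite psum_comp psum_id // => a /=; rewrite permK.
Qed.

Definition psum (s : {perm 'I_n}) (t : {perm 'I_m}) : {perm 'I_k} :=
  perm (@psum_inj s t).

(* Gamma_n x Gamma_m as a subgroup of Gamma_(n+m). *)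
Definition wemb (p : wreath n * wreath m) : wreath k :=
  Wreath [ffun i => match fintype.split (cast_ord (esym e) i) with
                    | inl a => wbase p.1 a | inr b => wbase p.2 b end]
         (psum (wperm p.1) (wperm p.2)).

Lemma wembM p q : wemb (p * q)%g = (wemb p * wemb q)%g.
Proof.
have psumV (s : {perm 'I_n}) (t : {perm 'I_m}) :
    (psum s t)^-1%g = psum s^-1%g t^-1%g.
  apply/eqP; rewrite -[_ == _](inj_eq (mulgI (psum s t))) mulgV eq_sym.
  apply/eqP/permP => i; rewrite permM !permE psum_comp psum_id // => a /=.
    by rewrite permK.
  by rewrite permK.
apply: wreathP => i /=.
  rewrite !ffunE psumV permE /psum_fun cast_ordK unsplitK.
  by case: (fintype.split _) => a; rewrite /= !ffunE.
rewrite permE permM !permE psum_comp /psum_fun; congr (cast_ord _ (unsplit _)).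
by case: (fintype.split _) => a; rewrite /= permM.
Qed.

End Embedding.

End Wreath.

Section WreathCharacters.
Variables (C : numClosedFieldType) (G : finGroupType).
Local Notation Gn n := (wreath G n).
Local Notation rep d := (mx_representation C [set: G] d).

(* V^{(x) n} has the basis v_a = v_{a 0} (x) ... (x) v_{a (n-1)}, a : I_n -> I_d,*)
(* and (g, s) sends w_0 (x) ... (x) w_(n-1) to the tensor with i-th factor      *)
(* g_i w_{s^-1 i}; the entry below is the coefficient of v_a in the image of v_b. *)
Section TensorPower.
Variables (d : nat) (V : rep d) (n : nat).

Definition tensor_idx (a : 'I_#|{ffun 'I_n -> 'I_d}|) : {ffun 'I_n -> 'I_d} :=
  enum_val a.

Definition tensor_mx (x : Gn n) : 'M[C]_#|{ffun 'I_n -> 'I_d}| :=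
  \matrix_(a, b) \prod_(i < n)
    V (wbase x i) (tensor_idx a i) (tensor_idx b ((wperm x)^-1%g i)).

Lemma tensor_mx_repr : mx_repr [set: Gn n] tensor_mx.
Proof.
split=> [|x y _ _]; apply/matrixP => a b; rewrite !mxE.
  rewrite -(inj_eq enum_val_inj).
  under eq_bigr => i _ do rewrite wbase1 wperm1 invg1 perm1 repr_mx1 mxE.
  have [ab|ab] := eqVneq; first by rewrite big1 // => i _; rewrite /tensor_idx ab eqxx.
  have [i abi] : exists i, tensor_idx a i != tensor_idx b i.
    apply/existsP; apply: contraNT ab => /existsPn h.
    by apply/eqP/ffunP => i; apply/eqP; rewrite -[_ == _]negbK h.
  by rewrite (bigD1 i) //= (negPf abi) mul0r.
under eq_bigr => i _ do rewrite wbaseM repr_mxM ?inE // mxE wpermM invMg permM.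
rewrite bigA_distr_bigA /= (reindex (fun c : {ffun 'I_n -> 'I_d} =>
  [ffun i => c ((wperm x)^-1%g i)])) /=; last first.
  exists (fun c : {ffun 'I_n -> 'I_d} => [ffun i => c (wperm x i)]) => c _;
    by apply/ffunP => i; rewrite !ffunE (permK, permKV).
rewrite (reindex (@enum_val {ffun 'I_n -> 'I_d} predT)) /=; last first.
  by apply: onW_bij; exact: enum_val_bij.
apply: eq_bigr => c _; rewrite !mxE big_split /=; congr (_ * _).
  by apply: eq_bigr => i _; rewrite ffunE.
rewrite [RHS](reindex_inj (@perm_inj _ (wperm x)^-1%g)) /=.
by apply: eq_bigr => i _; rewrite ffunE.
Qed.

Definition tensor_repr := MxRepresentation tensor_mx_repr.

Definition eta_rep : classFun C (Gn n) := rchar tensor_repr.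
End TensorPower.

Lemma wsgn_subproof n (x y : Gn n) :
  (-1) ^+ wperm (x ^ y)%g = (-1) ^+ wperm x :> C.
Proof. by rewrite /conjg !wpermM !odd_permM odd_permV addbAC addbb. Qed.

Definition wsgn n : classFun C (Gn n) := mkcf (@wsgn_subproof n).

Definition eps_rep d (V : rep d) n :
  classFun C (Gn n) := cf_mul (wsgn n) (eta_rep V n).

(* eta_n(beta - gamma), beta and gamma being the characters of V and W. *)
Definition eta_diff d (V : rep d)
    d' (W : rep d') n : classFun C (Gn n) :=
  \sum_(m < n.+1) (-1) ^+ m *:
    cfInduce (wemb (subnK (leq_ord m)))
      (fun p : Gn (n - m) * Gn m => eta_rep V (n - m) p.1 * eps_rep W m p.2).

(* The value does not depend on the choice of V and W, only on f; it is 0 if f *)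
(* is not a virtual character.                                                 *)
Definition eta n (f : classFun C G) : classFun C (Gn n) :=
  xget 0 [set h | exists d (V : rep d)
                         d' (W : rep d'),
                    f = rchar V - rchar W /\ h = eta_diff V W n]%classic.

Definition epsilon n (f : classFun C G) : classFun C (Gn n) :=
  cf_mul (wsgn n) (eta n f).

(* g_{i_n} ... g_{i_1} for the cycle of s through i_1; up to conjugacy it does *)
(* not depend on the choice of i_1 in the cycle.                               *)
Definition cycle_prod n (x : Gn n) (i1 : 'I_n) : G :=
  (\prod_(k < n) wbase x ((wperm x ^+ rev_ord k) i1))%g.

(* sigma_(n+1)(f): s is an (n+1)-cycle iff it has a single orbit. *)
Definition sigma n (f : classFun C G) (x : Gn n.+1) : C :=
  if #|porbits (wperm x)| == 1%N then n.+1%:R * f (cycle_prod x ord0) else 0.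

End WreathCharacters.

(* The external direct sum of a family of modules. *)
Section DirectSum.
Variables (K : pzRingType) (I : Type) (V : I -> lmodType K).

Definition finsupp (f : forall i, V i) := finite_set [set i | f i != 0]%classic.

Record dsum := DSum { dval :> forall i, V i; _ : `[< finsupp dval >] }.

HB.instance Definition _ := [isSub for dval].
HB.instance Definition _ := [Choice of dsum by <:].

Definition mkdsum f (h : finsupp f) : dsum := DSum (asboolT h).

Lemma dsum_fin (f : dsum) : finsupp f.
Proof. by case: f => f /= /asboolP. Qed.

Lemma dsumP (f g : dsum) : (forall i, f i = g i) -> f = g.
Proof. by move=> h; apply: val_inj; apply: functional_extensionality_dep. Qed.

Lemma ds_zero_fin : finsupp (fun i => 0 : V i).
Proof.
by apply: sub_finite_set (finite_set0 I) => i /=; rewrite eqxx.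
Qed.
Lemma ds_opp_fin (f : dsum) : finsupp (fun i => - f i).
Proof.
by apply: sub_finite_set (dsum_fin f) => i /=; rewrite oppr_eq0.
Qed.
Lemma ds_add_fin (f g : dsum) : finsupp (fun i => f i + g i).
Proof.
have := dsum_fin f; have := dsum_fin g => hg hf.
apply: sub_finite_set (_ : finite_set ([set i | f i != 0] `|` [set i | g i != 0])%classic).
  move=> i /= fg0; have [f0|?] := eqVneq (f i) 0; last by left.
  by right; rewrite f0 add0r in fg0.
by rewrite finite_setU.
Qed.
Lemma ds_scale_fin a (f : dsum) : finsupp (fun i => a *: f i).
Proof.
apply: sub_finite_set (dsum_fin f) => i /=.
by apply: contra_neq => ->; rewrite scaler0.
Qed.

Definition ds_zero := mkdsum ds_zero_fin.
Definition ds_opp f := mkdsum (ds_opp_fin f).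
Definition ds_add f g := mkdsum (ds_add_fin f g).
Definition ds_scale a f := mkdsum (ds_scale_fin a f).

Fact ds_addA : associative ds_add.
Proof. by move=> f g h; apply: dsumP => x; rewrite /= addrA. Qed.
Fact ds_addC : commutative ds_add.
Proof. by move=> f g; apply: dsumP => x; rewrite /= addrC. Qed.
Fact ds_add0 : left_id ds_zero ds_add.
Proof. by move=> f; apply: dsumP => x; rewrite /= add0r. Qed.
Fact ds_addN : left_inverse ds_zero ds_opp ds_add.
Proof. by move=> f; apply: dsumP => x; rewrite /= addNr. Qed.

HB.instance Definition _ :=
  GRing.isZmodule.Build dsum ds_addA ds_addC ds_add0 ds_addN.

Fact ds_scaleA a b f : ds_scale a (ds_scale b f) = ds_scale (a * b) f.
Proof. by apply: dsumP => x; rewrite /= scalerA. Qed.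
Fact ds_scale1 : left_id 1 ds_scale.
Proof. by move=> f; apply: dsumP => x; rewrite /= scale1r. Qed.
Fact ds_scaleDr : right_distributive ds_scale +%R.
Proof. by move=> a f g; apply: dsumP => x; rewrite /= scalerDr. Qed.
Fact ds_scaleDl f : {morph ds_scale^~ f : a b / a + b}.
Proof. by move=> a b; apply: dsumP => x; rewrite /= scalerDl. Qed.

HB.instance Definition _ := GRing.Zmodule_isLmodule.Build K dsum
  ds_scaleA ds_scale1 ds_scaleDr ds_scaleDl.

Lemma dsDE (f g : dsum) i : (f + g) i = f i + g i. Proof. by []. Qed.
Lemma dsZE a (f : dsum) i : (a *: f) i = a *: f i. Proof. by []. Qed.

End DirectSum.

Section OperatorsOnRGamma.
Variables (C : numClosedFieldType) (G : finGroupType).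
Local Notation Gn n := (wreath G n).

Definition RGamma := dsum (fun n => classFun C (Gn n)).

HB.instance Definition _ := GRing.Lmodule.on RGamma.

Definition wform (xi : classFun C G) n (f g : Gn n -> C) : C :=
  cform (fun x => eta n xi x * f x) g.

(* f in R(Gamma_m) |-> Ind (phi (x) f) in R(Gamma_(n+m)), written by components *)
(* of the image; n + (k - n) = k means n <= k, subtraction being truncated.     *)
Section Creation.
Variables (n : nat) (phi : Gn n -> C).

Definition cre_comp (f : forall m, classFun C (Gn m)) k : classFun C (Gn k) :=
  match (n + (k - n) =P k)%N with
  | ReflectT e =>
      cfInduce (wemb e)
        (fun p : Gn n * Gn (k - n) => phi p.1 * f (k - n)%N p.2)
  | ReflectF _ => 0
  end.

Lemma cre_comp_linear a (f g : RGamma) k :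
  cre_comp (a *: f + g) k = a *: cre_comp f k + cre_comp g k.
Proof.
rewrite /cre_comp; case: eqP => [h|_]; last by rewrite scaler0 addr0.
apply: classfunP => x; rewrite cfDE cfZE !mkcfE /indfun.
rewrite mulrCA -mulrDr; congr (_ * _); rewrite mulr_sumr -big_split.
apply: eq_bigr => y _; rewrite mulr_sumr -big_split.
by apply: eq_bigr => p _; rewrite dsDE dsZE cfDE cfZE mulrDr mulrCA.
Qed.

Lemma cre_fin (f : RGamma) : finsupp (cre_comp f).
Proof.
apply: sub_finite_set (finite_image (addn n) (dsum_fin f)) => k /=.
rewrite /cre_comp; case: eqP => [h nz|_]; last by rewrite eqxx.
exists (k - n)%N; last exact: h.
apply: contra_neq nz => f0; apply: classfunP => x; rewrite cf0E mkcfE /indfun.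
by rewrite big1 ?mulr0 // => y _; rewrite big1 // => p _; rewrite f0 cf0E mulr0.
Qed.

Definition cre (f : RGamma) : RGamma := mkdsum (cre_fin f).

Lemma cre_linear : linear cre.
Proof. by move=> a f g; apply: dsumP => k; exact: cre_comp_linear. Qed.
HB.instance Definition _ := GRing.isLinear.Build C RGamma RGamma _ cre cre_linear.
End Creation.

(* f in R(Gamma_(n+m)) |-> <phi, f restricted to Gamma_n x Gamma_m>_xi in       *)
(* R(Gamma_m), the form being taken on the first factor.                        *)
Section Annihilation.
Variables (xi : classFun C G) (n : nat) (phi : Gn n -> C).

Lemma ann_subproof (f : RGamma) m (y z : Gn m) :
  wform xi phi (fun x => f (n + m)%N (wemb erefl (x, (y ^ z)%g))) =
  wform xi phi (fun x => f (n + m)%N (wemb erefl (x, y))).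
Proof.
rewrite /wform /cform; congr (_ * _); apply: eq_bigr => x _; congr (_ * _).
have -> : ((x^-1)%g, (y ^ z)%g) = (((x^-1)%g, y) ^ ((1%g : Gn n), z))%g.
  by rewrite /conjg; congr pair; rewrite /= mulg1 ?invg1 ?mul1g.
have wembV (p : Gn n * Gn m) : wemb erefl p^-1%g = (wemb erefl p)^-1%g.
  have e1 : wemb (erefl (n + m)%N) 1%g = 1%g :> Gn _.
    by apply: (mulgI (wemb erefl 1%g)); rewrite -wembM !mulg1.
  by apply: (mulgI (wemb erefl p)); rewrite -wembM !mulgV e1.
by rewrite /conjg !wembM wembV -/(conjg _ _) classfunJ.
Qed.

Definition ann_comp (f : RGamma) m : classFun C (Gn m) :=
  mkcf (@ann_subproof f m).

Lemma ann_comp_linear a (f g : RGamma) m :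
  ann_comp (a *: f + g) m = a *: ann_comp f m + ann_comp g m.
Proof.
apply: classfunP => x; rewrite cfDE cfZE !mkcfE /wform /cform.
rewrite mulrCA -mulrDr; congr (_ * _); rewrite mulr_sumr -big_split.
by apply: eq_bigr => y _; rewrite dsDE dsZE cfDE cfZE mulrDr mulrCA.
Qed.

Lemma ann_fin (f : RGamma) : finsupp (ann_comp f).
Proof.
have inj : set_inj [set: nat]%classic (addn n) by move=> i j _ _ /addnI.
apply: sub_finite_set (finite_preimage (sub_in2 (fun _ _ => in_setT _) inj)
  (dsum_fin f)) => m /=.
apply: contra_neq => f0; apply: classfunP => x.
rewrite cf0E mkcfE /wform /cform f0 big1 ?mulr0 // => y _.
by rewrite cf0E mulr0.
Qed.

Definition ann (f : RGamma) : RGamma := mkdsum (ann_fin f).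

Lemma ann_linear : linear ann.
Proof. by move=> a f g; apply: dsumP => k; exact: ann_comp_linear. Qed.
HB.instance Definition _ := GRing.isLinear.Build C RGamma RGamma _ ann ann_linear.
End Annihilation.

(* opH n and opE n are H_{-n} and E_n; opa_cre n and opa_ann n are a_{-(n+1)}   *)
(* and a_{n+1}.                                                                 *)
Variable xi : classFun C G.
Definition opH n (f : classFun C G) : {linear RGamma -> RGamma} := cre (eta n f).
Definition opE n (f : classFun C G) : {linear RGamma -> RGamma} :=
  ann xi (epsilon n f).
Definition opa_cre n (f : classFun C G) : {linear RGamma -> RGamma} :=
  cre (@sigma C G n f).
Definition opa_ann n (f : classFun C G) : {linear RGamma -> RGamma} :=
  ann xi (@sigma C G n f).

End OperatorsOnRGamma.

(* The integer equal to z, if there is one. *)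
Definition toint (C : numClosedFieldType) (z : C) : int :=
  xget 0 [set m : int | m%:~R = z]%classic.

Section VertexOperators.
Variables (C : numClosedFieldType) (G : finGroupType).
Variables (xi : classFun C G) (r : nat) (gamma : 'I_r.+1 -> classFun C G).

(* R_Z(Gamma), by coordinates in the basis gamma_0, ..., gamma_r; the basis     *)
(* vector gamma_i = alpha_i is lbasis i.                                        *)
Definition lattice := 'rV[int]_r.+1.
Definition lbasis (i : 'I_r.+1) : lattice := delta_mx 0 i.

Definition lchar (al : lattice) : classFun C G :=
  \sum_i (al 0 i)%:~R *: gamma i.

Definition xiform (f g : classFun C G) : C := cform (cf_mul xi f) g.

Definition lform (al be : lattice) : int := toint (xiform (lchar al) (lchar be)).

Definition cartan : 'M[int]_r.+1 :=
  \matrix_(i, j) toint (xiform (gamma i) (gamma j)).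

Definition is_cocycle (eps : lattice -> lattice -> C) : Prop :=
  [/\ forall a b, eps a b != 0,
      forall a, eps a 0 = 1 /\ eps 0 a = 1,
      forall a b c, eps a b * eps (a + b) c = eps a (b + c) * eps b c
    & forall a b, eps a b * (eps b a)^-1 =
                  (-1) ^ (lform a b + lform a a * lform b b)].

(* R_Gamma (x) C[R_Z(Gamma)]: the component of v at be is the coefficient in    *)
(* R_Gamma of the basis element e^be.                                           *)
Definition Fock := dsum (fun _ : lattice => RGamma C G).

HB.instance Definition _ := GRing.Lmodule.on Fock.

Lemma onR_fin (T : {linear RGamma C G -> RGamma C G}) (v : Fock) :
  finsupp (fun be => T (v be)).
Proof.
by apply: sub_finite_set (dsum_fin v) => be /=; apply: contra_neq => ->;
  rewrite linear0.
Qed.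

Definition onR T (v : Fock) : Fock := mkdsum (onR_fin T v).

Lemma partial_fin (ga : lattice) (v : Fock) :
  finsupp (fun be => xiform (lchar ga) (lchar be) *: v be).
Proof.
by apply: sub_finite_set (dsum_fin v) => be /=; apply: contra_neq => ->;
  rewrite scaler0.
Qed.

Definition partial ga (v : Fock) : Fock := mkdsum (partial_fin ga v).

Definition opa (n : int) (ga : lattice) : Fock -> Fock :=
  match n with
  | Posz 0 => partial ga
  | Posz n'.+1 => onR (opa_ann xi n' (lchar ga))
  | Negz n' => onR (opa_cre n' (lchar ga))
  end.

Variable eps : lattice -> lattice -> C.

(* On f (x) e^be, the coefficient of z^{-n - <ga,ga>/2} in X(ga, z) collects    *)
(* the terms H_{-p}(ga) (-1)^q E_q(ga) f (x) eps(ga, be) e^{ga + be}            *)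
(* z^{p - q + <ga,be>}; the sum is finite since E_q f = 0 for large q.          *)
Definition X_sum (n : rat) (ga be : lattice) (f : RGamma C G) : RGamma C G :=
  \sum_(pq \in [set pq : nat * nat |
         (pq.1)%:R - (pq.2)%:R + (lform ga be)%:~R
           = - n - (lform ga ga)%:~R / 2%:R :> rat]%classic)
    (-1) ^+ pq.2 *: opH pq.1 (lchar ga) (opE xi pq.2 (lchar ga) f).

Lemma X_fin n ga (v : Fock) :
  finsupp (fun be => eps ga (be - ga) *: X_sum n ga (be - ga) (v (be - ga))).
Proof.
apply: sub_finite_set (finite_image (fun be => be + ga) (dsum_fin v)) => be /= nz.
exists (be - ga); last by rewrite subrK.
apply: contra_neq nz => ->; rewrite /X_sum fsbig1 ?scaler0 // => pq _.
by rewrite !linear0.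
Qed.

Definition opX n ga (v : Fock) : Fock := mkdsum (X_fin n ga v).

End VertexOperators.

HB.mixin Record Lmodule_isLie (K : pzRingType) L of GRing.Lmodule K L := {
  lie : L -> L -> L;
  lie_linearl : forall y, linear (lie^~ y);
  lie_linearr : forall x, linear (lie x);
  lie_alt : forall x, lie x x = 0;
  lie_jacobi : forall x y z, lie x (lie y z) + lie y (lie z x) + lie z (lie x y) = 0
}.

#[short(type="lieAlgType")]
HB.structure Definition LieAlgebra (K : pzRingType) :=
  {L of Lmodule_isLie K L & GRing.Lmodule K L}.

Definition lie_rep (K : pzRingType) (L : lieAlgType K) (V : lmodType K)
    (rho : L -> V -> V) : Prop :=
  [/\ forall x, linear (rho x), forall v, linear (rho^~ v)
    & forall x y v, rho (lie x y) v = rho x (rho y v) - rho y (rho x v)].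

(* The Lie algebra given by generators and relations: terms in the generators  *)
(* modulo the least Lie algebra congruence containing the relations.           *)
Section Presentation.
Variables (K : pzRingType) (X : Type).

Inductive lie_term :=
  | LGen of X
  | LZero
  | LAdd of lie_term & lie_term
  | LScale of K & lie_term
  | LBr of lie_term & lie_term.

HB.instance Definition _ := gen_eqMixin lie_term.
HB.instance Definition _ := gen_choiceMixin lie_term.

Variable rel : lie_term -> lie_term -> Prop.

Inductive lie_eq : lie_term -> lie_term -> Prop :=
  | LE_rel s t : rel s t -> lie_eq s t
  | LE_refl t : lie_eq t t
  | LE_sym s t : lie_eq s t -> lie_eq t s
  | LE_trans s t u : lie_eq s t -> lie_eq t u -> lie_eq s u
  | LE_add s s' t t' : lie_eq s s' -> lie_eq t t' -> lie_eq (LAdd s t) (LAdd s' t')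
  | LE_scale a t t' : lie_eq t t' -> lie_eq (LScale a t) (LScale a t')
  | LE_br s s' t t' : lie_eq s s' -> lie_eq t t' -> lie_eq (LBr s t) (LBr s' t')
  | LE_addA s t u : lie_eq (LAdd s (LAdd t u)) (LAdd (LAdd s t) u)
  | LE_addC s t : lie_eq (LAdd s t) (LAdd t s)
  | LE_add0 t : lie_eq (LAdd LZero t) t
  | LE_addN t : lie_eq (LAdd (LScale (-1) t) t) LZero
  | LE_scaleA a b t : lie_eq (LScale a (LScale b t)) (LScale (a * b) t)
  | LE_scale1 t : lie_eq (LScale 1 t) t
  | LE_scaleDr a s t : lie_eq (LScale a (LAdd s t)) (LAdd (LScale a s) (LScale a t))
  | LE_scaleDl a b t : lie_eq (LScale (a + b) t) (LAdd (LScale a t) (LScale b t))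
  | LE_brl a s t u :
      lie_eq (LBr (LAdd (LScale a s) t) u) (LAdd (LScale a (LBr s u)) (LBr t u))
  | LE_brr a s t u :
      lie_eq (LBr u (LAdd (LScale a s) t)) (LAdd (LScale a (LBr u s)) (LBr u t))
  | LE_alt t : lie_eq (LBr t t) LZero
  | LE_jacobi s t u :
      lie_eq (LAdd (LAdd (LBr s (LBr t u)) (LBr t (LBr u s))) (LBr u (LBr s t))) LZero.

Definition lie_eqb s t := `[< lie_eq s t >].

Lemma lie_eqb_refl : reflexive lie_eqb.
Proof. by move=> t; apply/asboolP; exact: LE_refl. Qed.
Lemma lie_eqb_sym : symmetric lie_eqb.
Proof. by move=> s t; apply/asboolP/asboolP; exact: LE_sym. Qed.
Lemma lie_eqb_trans : transitive lie_eqb.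
Proof. by move=> t s u /asboolP st /asboolP tu; apply/asboolP; exact: LE_trans tu. Qed.

Canonical lie_equiv := EquivRel lie_eqb lie_eqb_refl lie_eqb_sym lie_eqb_trans.

Definition presLie := {eq_quot lie_equiv}%qT.
HB.instance Definition _ := Choice.on presLie.

Definition lie_class (t : lie_term) : presLie := (\pi_({eq_quot lie_equiv}) t)%qT.

Lemma lie_classP s t : lie_eq s t <-> lie_class s = lie_class t.
Proof.
split=> [h|]; first by apply/eqmodP; apply/asboolP.
by move/eqmodP/asboolP.
Qed.

Definition lie_repr (x : presLie) : lie_term := repr (x : {eq_quot lie_equiv}%qT).
Lemma lie_reprK x : lie_class (lie_repr x) = x.
Proof. exact: reprK. Qed.

Lemma lie_repr_class t : lie_eq (lie_repr (lie_class t)) t.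
Proof. by apply/lie_classP; rewrite lie_reprK. Qed.

Lemma lie_classW (P : presLie -> Prop) :
  (forall t, P (lie_class t)) -> forall x, P x.
Proof. by move=> h x; rewrite -(lie_reprK x). Qed.

Definition pl_add x y := lie_class (LAdd (lie_repr x) (lie_repr y)).
Definition pl_scale a x := lie_class (LScale a (lie_repr x)).
Definition pl_br x y := lie_class (LBr (lie_repr x) (lie_repr y)).

Lemma pl_addE s t : pl_add (lie_class s) (lie_class t) = lie_class (LAdd s t).
Proof. by apply/lie_classP; apply: LE_add; exact: lie_repr_class. Qed.
Lemma pl_scaleE a t : pl_scale a (lie_class t) = lie_class (LScale a t).
Proof. by apply/lie_classP; apply: LE_scale; exact: lie_repr_class. Qed.
Lemma pl_brE s t : pl_br (lie_class s) (lie_class t) = lie_class (LBr s t).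
Proof. by apply/lie_classP; apply: LE_br; exact: lie_repr_class. Qed.
Definition plE := (pl_addE, pl_scaleE, pl_brE).

Fact pl_addA : associative pl_add.
Proof.
elim/lie_classW=> s; elim/lie_classW=> t; elim/lie_classW=> u.
by rewrite !plE; apply/lie_classP; exact: LE_addA.
Qed.
Fact pl_addC : commutative pl_add.
Proof.
elim/lie_classW=> s; elim/lie_classW=> t.
by rewrite !plE; apply/lie_classP; exact: LE_addC.
Qed.
Fact pl_add0 : left_id (lie_class LZero) pl_add.
Proof.
by elim/lie_classW=> s; rewrite !plE; apply/lie_classP; exact: LE_add0.
Qed.
Fact pl_addN : left_inverse (lie_class LZero) (pl_scale (-1)) pl_add.
Proof.
by elim/lie_classW=> s; rewrite !plE; apply/lie_classP; exact: LE_addN.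
Qed.

HB.instance Definition _ :=
  GRing.isZmodule.Build presLie pl_addA pl_addC pl_add0 pl_addN.

Fact pl_scaleA a b x : pl_scale a (pl_scale b x) = pl_scale (a * b) x.
Proof.
by elim/lie_classW: x => s; rewrite !plE; apply/lie_classP; exact: LE_scaleA.
Qed.
Fact pl_scale1 : left_id 1 pl_scale.
Proof.
by elim/lie_classW=> s; rewrite !plE; apply/lie_classP; exact: LE_scale1.
Qed.
Fact pl_scaleDr : right_distributive pl_scale pl_add.
Proof.
move=> a; elim/lie_classW=> s; elim/lie_classW=> t.
by rewrite !plE; apply/lie_classP; exact: LE_scaleDr.
Qed.
Fact pl_scaleDl x : {morph pl_scale^~ x : a b / a + b >-> pl_add a b}.
Proof.
move=> a b; elim/lie_classW: x => s.
by rewrite !plE; apply/lie_classP; exact: LE_scaleDl.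
Qed.

HB.instance Definition _ := GRing.Zmodule_isLmodule.Build K presLie
  pl_scaleA pl_scale1 pl_scaleDr pl_scaleDl.

Fact pl_linearl y : linear (pl_br^~ y).
Proof.
move=> a; elim/lie_classW: y => u; elim/lie_classW=> s; elim/lie_classW=> t.
rewrite -[_ *: _]/(pl_scale _ _) -[_ + _]/(pl_add _ _) /=.
rewrite -[_ *: _ + _]/(pl_add (pl_scale _ _) _) !plE.
by apply/lie_classP; exact: LE_brl.
Qed.
Fact pl_linearr x : linear (pl_br x).
Proof.
move=> a; elim/lie_classW: x => u; elim/lie_classW=> s; elim/lie_classW=> t.
rewrite -[_ *: _]/(pl_scale _ _) -[_ + _]/(pl_add _ _) /=.
rewrite -[_ *: _ + _]/(pl_add (pl_scale _ _) _) !plE.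
by apply/lie_classP; exact: LE_brr.
Qed.
Fact pl_alt x : pl_br x x = 0.
Proof.
by elim/lie_classW: x => s; rewrite !plE; apply/lie_classP; exact: LE_alt.
Qed.
Fact pl_jacobi x y z :
  pl_br x (pl_br y z) + pl_br y (pl_br z x) + pl_br z (pl_br x y) = 0.
Proof.
elim/lie_classW: x => s; elim/lie_classW: y => t; elim/lie_classW: z => u.
rewrite -[_ + _ + _]/(pl_add (pl_add _ _) _) !plE.
by apply/lie_classP; exact: LE_jacobi.
Qed.

HB.instance Definition _ := Lmodule_isLie.Build K presLie
  pl_linearl pl_linearr pl_alt pl_jacobi.

Definition lie_gen (x : X) : presLie := lie_class (LGen x).

End Presentation.

Section Toroidal.
Variables (C : numClosedFieldType) (r : nat) (A : 'M[int]_r.+1).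
Variable eps : lattice r -> lattice r -> C.

(* In TorX s i n the boolean s is the sign: x_n(alpha_i) if s = false and       *)
(* x_n(- alpha_i) if s = true.                                                  *)
Inductive tor_gen :=
  | TorC
  | TorH of 'I_r.+1 & int
  | TorX of bool & 'I_r.+1 & int.

Local Notation term := (lie_term C tor_gen).
Local Notation c := (@LGen C tor_gen TorC).
Local Notation h i n := (@LGen C tor_gen (TorH i n)).
Local Notation x s i n := (@LGen C tor_gen (TorX s i n)).

Inductive tor_rel : term -> term -> Prop :=
  | TR_central t : tor_rel (LBr c t) (LZero _ _)
  | TR_hh i j n m :
      tor_rel (LBr (h i n) (h j m))
              (LScale (if n == - m then (n * A i j)%:~R else 0) c)
  | TR_hx s i j n m :
      tor_rel (LBr (h i n) (x s j m))
              (LScale ((-1) ^+ s * (A i j)%:~R) (x s j (n + m)))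
  | TR_xx_eq i n m :
      tor_rel (LBr (x false i n) (x true i m))
              (LScale (eps (lbasis i) (- lbasis i))
                 (LAdd (h i (n + m)) (LScale (if n == - m then n%:~R else 0) c)))
  | TR_xx_neq i j n m : i != j ->
      tor_rel (LBr (x false i n) (x true j m)) (LZero _ _)
  | TR_xx_same s i n m : tor_rel (LBr (x s i n) (x s i m)) (LZero _ _)
  | TR_serre s i j m : i != j ->
      tor_rel (iter `|1 - A i j|%N (LBr (x s i 0)) (x s j m)) (LZero _ _).

Definition toroidal := presLie tor_rel.
HB.instance Definition _ := LieAlgebra.on toroidal.

Definition tor_c : toroidal := lie_gen tor_rel TorC.
Definition tor_h i n : toroidal := lie_gen tor_rel (TorH i n).
Definition tor_x s i n : toroidal := lie_gen tor_rel (TorX s i n).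

End Toroidal.

(* Main.v *)
(* Evaluating a class function on Gamma_(n+m) at x in Gamma_n with a single      *)
(* cycle is a derivation d_x of the induction product, and an element of         *)
(* positive degree vanishes as soon as all its d_x do. The families eta_n(gamma) *)
(* and epsilon_n(gamma) are eigenvectors of all the d_x, so they satisfy the     *)
(* Newton identities n eta_n = sum_k sigma_k eta_(n-k); together with Frobenius  *)
(* reciprocity this gives the Heisenberg relations and the commutators           *)
(* [a_n, H_(-p)] and [a_n, E_p]. Newton's identities alone then imply, writing   *)
(* c = <beta, gamma>, that                                                       *)
(* E_-(beta, w) H_+(gamma, z) = (1 - z/w)^c H_+(gamma, z) E_-(beta, w),          *)
(* and expanding the binomial for c >= 0 and c = -2 gives the commutators of the *)
(* modes X_n. For the Serre relations, X_0(alpha_i) and X_0(-alpha_i) are locally *)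
(* nilpotent and generate an sl_2 for which X_m(alpha_j) is a lowest weight      *)
(* vector, since it commutes with X_0(-alpha_i).                                 *)
(* Finally a_ii = 2 comes down to the vanishing of the multiplicity of gamma_i   *)
(* in pi * gamma_i: it is at most 2 as |pi| <= 2, it is not 2 as pi is faithful, *)
(* and it is not 1 because pi, hence pi (x) End, is symplectic.                  *)

(* Under the characteristic map, [RGamma] is a polynomial algebra in power sums indexed by a cycle
   length and a conjugacy class of Gamma. The induction product is multiplication, and [dx x] for a
   single cycle [x] is, up to a nonzero scalar, a partial derivative. The group-theoretic half of
   the proof is this calculus. [dx_cre] is the Leibniz rule: a cycle lies entirely in one of two
   complementary invariant sets. By [gn_cases] a class function of positive degree is known from its
   derivatives, so identities follow by induction on the degree. A family with [mult F u] is an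
   exponential of power sums; tensor powers are of this kind, virtual ones included because the
   exponent is additive ([mult_eta], [mult_epsilon]). Differentiating an exponential gives Newton's
   identities ([newton_cre]), and Frobenius reciprocity carries them to the adjoint operators
   ([newton_ann]). The scalars that remain reduce to the form on Gamma because cycle products are
   equidistributed ([avg_sigma]).

   The other half is the Frenkel-Kac construction, carried out over an abstract Heisenberg algebra.
   By [e_Hz], a product of two vertex operators is a power (1 - w/z)^c times a normally ordered
   product that is symmetric in the two operators ([WW], [T2C]). For c >= 0 the power is a
   polynomial, and the two orders differ by the sign (-1)^c, which the cocycle cancels ([opXC]). For
   c = -2 the two expansions differ by a derivative of the delta function; since the normally
   ordered product of opposite operators becomes the identity at z = w, what survives is a
   Heisenberg mode and a constant ([WW_opp], [opX_opp]). The Serre relations are sl_2 theory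
   ([serre]) once X_0 is locally nilpotent. It is, because X_0 preserves the degree plus half the
   norm of the lattice point while moving that point along a root of norm two, so the degree
   eventually becomes negative ([opX_nil]).

   The matrix of the form is integral and symmetric, with 2 on the diagonal and nonpositive entries
   elsewhere ([mckay_cartan]). Operators that satisfy the relations extend to exactly one
   representation of the presented algebra ([presLie_rep_unique]). *)
Require Import Defs.
From HB Require Import structures.
From mathcomp Require Import all_boot all_order all_algebra all_fingroup.
From mathcomp Require Import mxrepresentation spectral boolp reals complex.
From mathcomp Require Import zify ring ssrAC.

Set Implicit Arguments.
Unset Strict Implicit.
Unset Printing Implicit Defensive.
Import Order.TTheory GRing.Theory Num.Theory GroupScope.
Local Open Scope ring_scope.

(** * Block embeddings and induction *)

Section Embeddings.
Variables (C : numClosedFieldType) (G : finGroupType).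
Local Notation Gn n := (wreath G n).
Local Notation fam := (forall n, classFun C (Gn n)).
Implicit Type F : fam.

Section Blocks.
Variables (n m k : nat) (e : (n + m)%N = k).

Definition linj (a : 'I_n) : 'I_k := cast_ord e (lshift m a).
Definition rinj (b : 'I_m) : 'I_k := cast_ord e (rshift n b).

Lemma split_linj a : fintype.split (cast_ord (esym e) (linj a)) = inl a.
Proof. by rewrite cast_ordK (unsplitK (inl a)). Qed.

Lemma split_rinj b : fintype.split (cast_ord (esym e) (rinj b)) = inr b.
Proof. by rewrite cast_ordK (unsplitK (inr b)). Qed.

Lemma linj_inj : injective linj.
Proof. by move=> a a' /cast_ord_inj/lshift_inj. Qed.

Lemma rinj_inj : injective rinj.
Proof. by move=> a a' /cast_ord_inj/rshift_inj. Qed.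

Lemma lrinjF a b : linj a = rinj b -> False.
Proof. by move/cast_ord_inj/eqP; rewrite eq_lrshift. Qed.

Variant inj_spec : 'I_k -> Type :=
  | InjL a : inj_spec (linj a)
  | InjR b : inj_spec (rinj b).

Lemma injP i : inj_spec i.
Proof.
rewrite -(cast_ordKV e i); case: (split_ordP (cast_ord (esym e) i)) => j ->.
  exact: InjL.
exact: InjR.
Qed.

Variables (x : Gn n) (y : Gn m).

Lemma wembpl a : wperm (wemb e (x, y)) (linj a) = linj (wperm x a).
Proof. by rewrite permE /psum_fun split_linj. Qed.
Lemma wembpr b : wperm (wemb e (x, y)) (rinj b) = rinj (wperm y b).
Proof. by rewrite permE /psum_fun split_rinj. Qed.
Lemma wembbl a : wbase (wemb e (x, y)) (linj a) = wbase x a.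
Proof. by rewrite ffunE split_linj. Qed.
Lemma wembbr b : wbase (wemb e (x, y)) (rinj b) = wbase y b.
Proof. by rewrite ffunE split_rinj. Qed.

End Blocks.

Lemma wemb_inj n m k (e : (n + m)%N = k) : injective (@wemb G n m k e).
Proof.
move=> [x y] [x' y'] eq; congr (_, _); apply: wreathP => i.
- by rewrite -(wembbl e x y) -(wembbl e x' y') eq.
- by apply: (@linj_inj n m k e); rewrite -(wembpl e x y) -(wembpl e x' y') eq.
- by rewrite -(wembbr e x y) -(wembbr e x' y') eq.
- by apply: (@rinj_inj n m k e); rewrite -(wembpr e x y) -(wembpr e x' y') eq.
Qed.

(* [p] is the restriction of [z] to the invariant set [t(I_m)], up to the       *)
(* relabelling [t] and the conjugation by [h].                                  *)
Definition wsubp m k (p : Gn m) (z : Gn k) (t : 'I_m -> 'I_k) (h : 'I_m -> G) :=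
  [/\ injective t, forall i, wperm z (t i) = t (wperm p i)
    & forall i, wbase z (t (wperm p i))
        = (h (wperm p i) * wbase p (wperm p i) * (h i)^-1)%g].

(** The relabelling [u] and the ratio of the base changes [h] and [h'] assemble into a single wreath
    element, which conjugates. Hence class functions have a well-defined value on the restriction of
    [z] to an invariant set. *)
Lemma wsubp_conj m k (p p' : Gn m) (z : Gn k) t t' h h' (u : 'I_m -> 'I_m) :
    wsubp p z t h -> wsubp p' z t' h' -> (forall i, t i = t' (u i)) ->
  exists w, p' = (p ^ w)%g.
Proof.
move=> [tI pt bt] [tI' pt' bt'] tu.
have uI : injective u by move=> i j ij; apply: tI; rewrite !tu ij.
pose v : {perm 'I_m} := perm uI.
pose w : Gn m := Wreath [ffun i => ((h i)^-1 * h' (v i))%g] v^-1%g.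
have pu i : wperm p' (u i) = u (wperm p i).
  by apply: tI'; rewrite -pt' -tu pt tu.
exists w; rewrite conjgE; apply: (mulgI w); rewrite !mulgA mulgV mul1g.
apply: wreathP => i; last first.
  rewrite !wpermM /= !permM; apply: (@perm_inj _ v); rewrite permKV.
  set j := v^-1%g i; rewrite -(permKV v i) -/j !permE.
  exact: pu.
rewrite !wbaseM /= !ffunE invgK.
set j := ((wperm p)^-1%g i).
have ij : i = wperm p j by rewrite permKV.
have := bt j; rewrite tu -pu bt' pu !permE ij => E.
have E2 : (h' (u (wperm p j)) * wbase p' (u (wperm p j)) =
  h (wperm p j) * wbase p (wperm p j) * (h j)^-1 * h' (u j))%g by rewrite -E mulgKV.
by rewrite -mulgA E2 !mulgA mulVg mul1g.
Qed.

(** Working with a family over all degrees lets the sizes [m] and [m'] be provably equal without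
    being convertible. *)
Lemma wsubp_eq F m m' k (p : Gn m) (p' : Gn m') (z : Gn k) t t' h h' :
    wsubp p z t h -> wsubp p' z t' h' ->
    (forall i, exists j, t i = t' j) -> (forall j, exists i, t' j = t i) ->
  F m p = F m' p'.
Proof.
move=> s s' tt' t't.
have [u tu] := fin_all_exists tt'; have [u' tu'] := fin_all_exists t't.
have mm : m = m'.
  have uI : injective u by move=> i j ij; case: s => tI _ _; apply: tI; rewrite !tu ij.
  have uI' : injective u' by move=> i j ij; case: s' => tI _ _; apply: tI; rewrite !tu' ij.
  have := leq_card _ uI; have := leq_card _ uI'; rewrite !card_ord => h1 h2.
  by apply/eqP; rewrite eqn_leq h1 h2.
move: p' t' h' s' u tu {u' tu' tt' t't}; rewrite -mm => p' t' h' s' u tu.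
by have [w ->] := wsubp_conj s s' tu; rewrite classfunJ.
Qed.

(* Restriction to an invariant set; the value is junk if [S] is not invariant. *)
Definition wres_fun k (z : Gn k) (S : {set 'I_k}) (i : 'I_#|S|) : 'I_#|S| :=
  enum_rank_in (enum_valP i) (wperm z (enum_val i)).

Definition wres k (z : Gn k) (S : {set 'I_k}) : Gn #|S| :=
  Wreath [ffun i => wbase z (enum_val i)]
    (if injectiveP (@wres_fun k z S) is ReflectT fI then perm fI else 1%g).

Definition stable k (z : Gn k) (S : {set 'I_k}) :=
  [forall i, (wperm z i \in S) == (i \in S)].

Lemma stableP k (z : Gn k) (S : {set 'I_k}) :
  reflect (forall i, (wperm z i \in S) = (i \in S)) (stable z S).
Proof. exact: 'forall_eqP. Qed.

Lemma stableC k (z : Gn k) (S : {set 'I_k}) : stable z (~: S) = stable z S.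
Proof.
apply/stableP/stableP => zS i; last by rewrite !inE zS.
by apply: negb_inj; rewrite -!in_setC zS.
Qed.

Lemma wres_sub k (z : Gn k) (S : {set 'I_k}) :
  stable z S -> wsubp (wres z S) z enum_val (fun=> 1%g).
Proof.
move/stableP => zS; pose f := @wres_fun k z S.
have fE i : enum_val (f i) = wperm z (enum_val i).
  by rewrite enum_rankK_in // zS enum_valP.
have fI : injective f.
  move=> i j /(congr1 enum_val); rewrite !fE => /perm_inj.
  exact: enum_val_inj.
have pE i : wperm (wres z S) i = f i.
  by rewrite /=; case: injectiveP => // p; rewrite permE.
split=> [|i|i]; first exact: enum_val_inj.
  by rewrite pE fE.
by rewrite /= ffunE mul1g invg1 mulg1.
Qed.

Definition resv F k (z : Gn k) (S : {set 'I_k}) := F #|S| (wres z S).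

(** Allows [resv] to be computed from any convenient description of the restriction, instead of the
    enumeration of [S] built into [wres]. *)
Lemma resvE F m k (p : Gn m) (z : Gn k) (S : {set 'I_k}) t h :
    stable z S -> wsubp p z t h -> (forall i, t i \in S) ->
    (forall j, j \in S -> exists i, j = t i) ->
  resv F z S = F m p.
Proof.
move=> zS s tS St; apply: wsubp_eq (wres_sub zS) s _ _ => [i|j].
  by apply: St; exact: enum_valP.
by exists (enum_rank_in (tS j) (t j)); rewrite enum_rankK_in.
Qed.

Lemma resvT F k (z : Gn k) : resv F z setT = F k z.
Proof.
have s : wsubp z z id (fun=> 1%g) by split=> // i; rewrite mul1g invg1 mulg1.
apply: resvE (s) _ _ => //; first by apply/stableP => i; rewrite !inE.
  by move=> i; rewrite inE.
by move=> j; exists j.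
Qed.


(** * Induced products as sums over invariant subsets *)

Section InductionFormula.
Variables (n m k : nat) (e : (n + m)%N = k).

Definition lblock : {set 'I_k} := linj e @: setT.

Lemma linj_lblock a : linj e a \in lblock. Proof. exact: imset_f. Qed.
Lemma rinj_lblock b : rinj e b \in lblock = false.
Proof. by apply/imsetP => -[a _ /esym/lrinjF]. Qed.

Lemma card_lblock : #|lblock| = n.
Proof. by rewrite card_imset ?cardsT ?card_ord //; exact: linj_inj. Qed.

Lemma wemb_stable p : stable (wemb e p) lblock.
Proof.
case: p => x y; apply/stableP => i; case: (injP e i) => j.
  by rewrite wembpl !linj_lblock.
by rewrite wembpr !rinj_lblock.
Qed.

Lemma wemb_surj x : stable x lblock -> exists p, x = wemb e p.
Proof.
move=> /stableP xB.
have xl a : exists a', wperm x (linj e a) = linj e a'.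
  have := xB (linj e a); rewrite linj_lblock; case: (injP e (wperm x _)) => [a' _|b].
    by exists a'.
  by rewrite rinj_lblock.
have xr b : exists b', wperm x (rinj e b) = rinj e b'.
  have := xB (rinj e b); rewrite rinj_lblock; case: (injP e (wperm x _)) => [a'|b' _].
    by rewrite linj_lblock.
  by exists b'.
have [u xu] := fin_all_exists xl; have [v xv] := fin_all_exists xr.
have uI : injective u.
  by move=> a a' aa; apply/(@linj_inj _ _ _ e)/(@perm_inj _ (wperm x)); rewrite !xu aa.
have vI : injective v.
  by move=> a a' aa; apply/(@rinj_inj _ _ _ e)/(@perm_inj _ (wperm x)); rewrite !xv aa.
exists (Wreath [ffun a => wbase x (linj e a)] (perm uI),
        Wreath [ffun b => wbase x (rinj e b)] (perm vI)).
apply: wreathP => i; case: (injP e i) => j.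
- by rewrite wembbl ffunE.
- by rewrite wembbr ffunE.
- by rewrite wembpl permE.
- by rewrite wembpr permE.
Qed.

Lemma wpermJ (z y : Gn k) i : wperm (z ^ y)%g i = ((wperm y)^-1)%g (wperm z (wperm y i)).
Proof. by rewrite conjgE !wpermM wpermV !permM. Qed.

Lemma wbaseJ (z y : Gn k) i : wbase (z ^ y)%g i =
  ((wbase y (wperm y i))^-1 * wbase z (wperm y i) * wbase y ((wperm z)^-1%g (wperm y i)))%g.
Proof. by rewrite conjgE !wbaseM wpermV invgK /= ffunE mulgA. Qed.

Lemma wembJ_subl (z y : Gn k) p q : wemb e (p, q) = (z ^ y)%g ->
  wsubp p z (fun a => wperm y (linj e a)) (fun a => wbase y (wperm y (linj e a))).
Proof.
move=> zy.
have tp a : wperm z (wperm y (linj e a)) = wperm y (linj e (wperm p a)).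
  by rewrite -(wembpl e p q) zy wpermJ permKV.
split=> [a b /perm_inj/linj_inj|a|a] //.
by rewrite -(wembbl e p q) zy wbaseJ -tp permK !mulgA mulgV mul1g mulgK.
Qed.

Lemma wembJ_subr (z y : Gn k) p q : wemb e (p, q) = (z ^ y)%g ->
  wsubp q z (fun a => wperm y (rinj e a)) (fun a => wbase y (wperm y (rinj e a))).
Proof.
move=> zy.
have tp a : wperm z (wperm y (rinj e a)) = wperm y (rinj e (wperm q a)).
  by rewrite -(wembpr e p q) zy wpermJ permKV.
split=> [a b /perm_inj/rinj_inj|a|a] //.
by rewrite -(wembbr e p q) zy wbaseJ -tp permK !mulgA mulgV mul1g mulgK.
Qed.

Lemma stableJ (z y : Gn k) (S : {set 'I_k}) : stable (z ^ y)%g S = stable z (wperm y @: S).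
Proof.
have yS i : (i \in wperm y @: S) = ((wperm y)^-1%g i \in S).
  by rewrite -{1}(permKV (wperm y) i) mem_imset //; exact: perm_inj.
apply/stableP/stableP => h i.
  by rewrite !yS -[RHS]h wpermJ permKV.
by rewrite wpermJ -yS h yS permK.
Qed.

Lemma card_move (S : {set 'I_k}) : #|S| = n ->
  #|[set y : Gn k | wperm y @: lblock == S]| = #|{: Gn n * Gn m}|.
Proof.
move=> Sn.
have Sm : #|~: S| = m by apply/(@addnI n); rewrite -{1}Sn cardsC card_ord e.
pose f (i : 'I_k) : 'I_k := match fintype.split (cast_ord (esym e) i) with
  | inl a => enum_val (cast_ord (esym Sn) a) | inr b => enum_val (cast_ord (esym Sm) b) end.
have fl a : f (linj e a) = enum_val (cast_ord (esym Sn) a) by rewrite /f split_linj.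
have fr a : f (rinj e a) = enum_val (cast_ord (esym Sm) a) by rewrite /f split_rinj.
have fI : injective f.
  have no (a : 'I_#|S|) (b : 'I_#|~: S|) : enum_val a <> enum_val b.
    by move=> ab; have := enum_valP b; rewrite -ab inE enum_valP.
  move=> i j; case: (injP e i) => i'; case: (injP e j) => j'; rewrite ?fl ?fr.
  - by move/enum_val_inj/cast_ord_inj ->.
  - by move/no.
  - by move/esym/no.
  - by move/enum_val_inj/cast_ord_inj ->.
(* One element carrying the block onto [S]; all the others form its left coset under the image of
   [wemb]. *)
pose w : Gn k := Wreath [ffun=> 1%g] (perm fI).
have wB : wperm w @: lblock = S.
  apply/eqP; rewrite eqEcard card_imset ?card_lblock ?Sn ?leqnn ?andbT; last exact: perm_inj.
  apply/subsetP => _ /imsetP[_ /imsetP[a _ ->] ->].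
  by rewrite permE fl enum_valP.
rewrite -(card_imset _ (@wemb_inj n m k e)) -[RHS](card_imset _ (mulgI w)); congr #|pred_of_set _|.
apply/setP => y; rewrite inE; apply/eqP/imsetP => [yS|[_ /imsetP[p _ ->] ->]].
  have [|p yp] := @wemb_surj (w^-1 * y)%g; last first.
    by exists (wemb e p); rewrite ?imset_f // -yp mulKVg.
  apply/stableP => i; rewrite wpermM permM.
  have wE : lblock = (wperm w)^-1%g @: S.
    rewrite -wB -imset_comp -[LHS]imset_id; apply: eq_imset => j /=.
    by rewrite permK.
  rewrite {1}wE mem_imset; last exact: perm_inj.
  by rewrite -yS mem_imset //; exact: perm_inj.
apply/eqP; rewrite eqEcard card_imset ?card_lblock ?Sn ?leqnn ?andbT; last exact: perm_inj.
apply/subsetP => _ /imsetP[i iB ->]; rewrite wpermM permM -wB imset_f //.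
by move/stableP: (wemb_stable p) => ->.
Qed.

(** An element [y] contributes to the induced value only if [z] preserves the image of the block
    under [y]. Grouping the [y] by that image [S], all of them contribute the same product, and by
    [card_move] their number cancels the normalising factor. *)
Lemma cfInduceE (F H : fam) (z : Gn k) :
  cfInduce (wemb e) (fun p : Gn n * Gn m => F n p.1 * H m p.2) z =
  \sum_(S : {set 'I_k} | stable z S && (#|S| == n)) resv F z S * resv H z (~: S).
Proof.
rewrite mkcfE /indfun.
rewrite (partition_big (fun y : Gn k => wperm y @: lblock)
  (fun S : {set 'I_k} => #|S| == n)) /=; last first.
  by move=> y _; rewrite card_imset ?card_lblock //; exact: perm_inj.
rewrite mulr_sumr [RHS](bigID (stable z)) /= [X in _ = _ + X]big1 ?addr0; last first.
  by move=> S /andP[/andP[-> _]].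
rewrite [LHS](bigID (stable z)) /= [X in _ + X = _]big1 ?addr0; last first.
  move=> S /andP[_ zS]; rewrite big1 ?mulr0 // => y /eqP yS.
  rewrite big1 // => p /eqP zy; case/negP: zS.
  by rewrite -yS -stableJ -zy wemb_stable.
apply: eq_big => [S|S /andP[/eqP Sn zS]]; first by rewrite andbC andbAC andbb andbC.
have cT : #|{: Gn n * Gn m}|%:R != 0 :> C.
  by rewrite pnatr_eq0 -lt0n; apply/card_gt0P; exists 1%g.
apply: (mulfI cT); rewrite mulVKf // -(card_move Sn) mulr_natl -sumr_const.
apply: eq_big => [y|y /eqP yS]; first by rewrite inE.
have [|[p q] zy] := @wemb_surj (z ^ y)%g; first by rewrite stableJ yS.
rewrite (big_pred1 (p, q)) /=; last first.
  by move=> p'; rewrite zy (inj_eq (@wemb_inj _ _ _ _)).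
have yB i : wperm y i \in S = (i \in lblock).
  by rewrite -yS mem_imset //; exact: perm_inj.
congr (_ * _); apply/esym.
  apply: resvE zS (wembJ_subl (esym zy)) _ _ => [a|j]; first by rewrite yB linj_lblock.
  by rewrite -yS => /imsetP[_ /imsetP[a _ ->] ->]; exists a.
apply: resvE (wembJ_subr (esym zy)) _ _ => [|a|j]; first by rewrite stableC.
  by rewrite inE yB rinj_lblock.
rewrite -{1}(permKV (wperm y) j) inE yB => jB.
case: (injP e ((wperm y)^-1%g j)) (jB) (permKV (wperm y) j) => a.
  by rewrite linj_lblock.
by move=> _ <-; exists a.
Qed.

End InductionFormula.

End Embeddings.

(** * Derivations *)

Section Derivations.
Variables (C : numClosedFieldType) (G : finGroupType).
Local Notation Gn n := (wreath G n).
Local Notation fam := (forall n, classFun C (Gn n)).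
Implicit Types F H : fam.

(** The empty permutation has no orbit, so this is false in degree 0: a cycle always has positive
    length. *)
Definition wcyc n (x : Gn n) := #|porbits (wperm x)| == 1%N.

Lemma wcyc_stable n (x : Gn n) (S : {set 'I_n}) i :
  wcyc x -> stable x S -> i \in S -> S = setT.
Proof.
move=> /cards1P[O xO] /stableP xS iS; apply/setP => j; rewrite inE.
have : porbit (wperm x) i = porbit (wperm x) j.
  have mO l : porbit (wperm x) l \in [set O] by rewrite -xO imset_f.
  by have := mO i; have := mO j; rewrite !inE => /eqP -> /eqP ->.
move/eqP; rewrite eq_porbit_mem porbit_sym => /porbitP[m ->].
elim: m => [|m IH]; first by rewrite expg0 perm1.
by rewrite expgSr permM xS.
Qed.

Lemma dx_subproof n (x : Gn n) F m (y z : Gn m) :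
  F (n + m)%N (wemb erefl (x, (y ^ z)%g)) = F (n + m)%N (wemb erefl (x, y)).
Proof.
have -> : (x, (y ^ z)%g) = ((x, y) ^ (1%g, z))%g.
  by rewrite /conjg; congr pair; rewrite /= mulg1 ?invg1 ?mul1g.
have wembV (p : Gn n * Gn m) : wemb erefl p^-1%g = (wemb erefl p)^-1%g.
  have e1 : wemb (erefl (n + m)%N) 1%g = 1%g :> Gn _.
    by apply: (mulgI (wemb erefl 1%g)); rewrite -wembM !mulg1.
  by apply: (mulgI (wemb erefl p)); rewrite -wembM !mulgV e1.
by rewrite /conjg !wembM wembV -/(conjg _ _) classfunJ.
Qed.

(** When [x] is a single cycle this is, up to a nonzero scalar, the partial derivative along the
    power sum of the type of [x]. *)
Definition dx n (x : Gn n) F : fam := fun m => mkcf (@dx_subproof n x F m).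

Lemma dxE n (x : Gn n) F m y : dx x F m y = F (n + m)%N (wemb erefl (x, y)).
Proof. exact: mkcfE. Qed.

Section BlockRestriction.
Variables (a b k : nat) (e : (a + b)%N = k) (x : Gn a) (y : Gn b).
Local Notation z := (wemb e (x, y)).
Local Notation L := (lblock e).
Implicit Type S : {set 'I_b}.

Lemma mem_rinj S j : (rinj e j \in rinj e @: S) = (j \in S).
Proof. by rewrite mem_imset //; exact: rinj_inj. Qed.
Lemma linj_rinjS S j : (linj e j \in rinj e @: S) = false.
Proof. by apply/imsetP => -[? _ /lrinjF]. Qed.

Lemma setC_rinj S : ~: (rinj e @: S) = L :|: rinj e @: ~: S.
Proof.
apply/setP => i; rewrite !inE; case: (injP e i) => j.
  by rewrite linj_rinjS linj_lblock.
by rewrite !mem_rinj rinj_lblock inE.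
Qed.

Lemma setC_lrinj S : ~: (L :|: rinj e @: S) = rinj e @: ~: S.
Proof. by apply: setC_inj; rewrite setCK setC_rinj setCK. Qed.

Lemma stable_rinj S : stable z (rinj e @: S) = stable y S.
Proof.
apply/stableP/stableP => h i; first by rewrite -mem_rinj -(wembpr e x) h mem_rinj.
case: (injP e i) => j; first by rewrite wembpl !linj_rinjS.
by rewrite wembpr !mem_rinj.
Qed.

Lemma stable_lrinj S : stable z (L :|: rinj e @: S) = stable y S.
Proof. by rewrite -stableC setC_lrinj stable_rinj stableC. Qed.

Lemma card_lrinj S : #|L :|: rinj e @: S| = (a + #|S|)%N.
Proof.
rewrite cardsU card_lblock (card_imset _ (@rinj_inj _ _ _ e)).
suff -> : L :&: rinj e @: S = set0 by rewrite cards0 subn0.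
apply/setP => i; rewrite !inE; case: (injP e i) => j; first by rewrite linj_rinjS andbF.
by rewrite rinj_lblock.
Qed.

Lemma resv_rinj F S : stable y S -> resv F z (rinj e @: S) = resv F y S.
Proof.
move=> yS; have [tI tp tb] := wres_sub yS.
apply: (@resvE _ _ F _ _ (wres y S) z _ (fun i => rinj e (enum_val i)) (fun=> 1%g)).
- by rewrite stable_rinj.
- split=> [i j /rinj_inj/enum_val_inj|i|i] //; first by rewrite wembpr tp.
  by rewrite wembbr tb.
- by move=> i; rewrite mem_rinj enum_valP.
- by move=> j /imsetP[i iS ->]; exists (enum_rank_in iS i); rewrite enum_rankK_in.
Qed.

Lemma resv_lrinj F S : stable y S -> resv F z (L :|: rinj e @: S) = resv (dx x F) y S.
Proof.
move=> yS; have [tI tp tb] := wres_sub yS; rewrite [RHS]dxE.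
pose t (i : 'I_(a + #|S|)) : 'I_k :=
  match fintype.split (cast_ord (esym erefl) i) with inl i => linj e i | inr i => rinj e (enum_val i) end.
have tl i : t (linj erefl i) = linj e i by rewrite /t split_linj.
have tr i : t (rinj erefl i) = rinj e (enum_val i) by rewrite /t split_rinj.
apply: (@resvE _ _ F _ _ _ z _ t (fun=> 1%g)).
- by rewrite stable_lrinj.
- split=> [i j|i|i].
  + case: (injP erefl i) => i'; case: (injP erefl j) => j'; rewrite ?tl ?tr.
    * by move/linj_inj ->.
    * by move/lrinjF.
    * by move/esym/lrinjF.
    * by move/rinj_inj/enum_val_inj ->.
  + case: (injP erefl i) => i'.
      by rewrite tl !wembpl tl.
    by rewrite tr !wembpr tr tp.
  + rewrite invg1 mulg1 mul1g; case: (injP erefl i) => i'.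
      by rewrite wembpl tl !wembbl.
    by rewrite wembpr tr !wembbr tb mul1g invg1 mulg1.
- move=> i; case: (injP erefl i) => i'; rewrite ?tl ?tr inE ?linj_lblock //.
  by rewrite mem_rinj enum_valP orbT.
- move=> j; case: (injP e j) => j' jS; first by exists (linj erefl j').
  rewrite inE rinj_lblock mem_rinj /= in jS.
  by exists (rinj erefl (enum_rank_in jS j')); rewrite tr enum_rankK_in.
Qed.

(** An invariant set that meets the cycle [x] contains all of it. *)
Lemma stable_in (T : {set 'I_k}) i : wcyc x -> stable z T -> linj e i \in T ->
  L :|: rinj e @: (rinj e @^-1: T) = T.
Proof.
move=> xc /stableP zT iT.
have : linj e @^-1: T = setT.
  apply: (wcyc_stable xc (i := i)); rewrite ?inE //.
  by apply/stableP => j; rewrite !inE -(wembpl e x y) zT.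
move/setP => LT; apply/setP => j; rewrite inE; case: (injP e j) => j'.
  by rewrite linj_lblock; have := LT j'; rewrite !inE => ->.
by rewrite rinj_lblock mem_rinj inE.
Qed.

Lemma stable_notin (T : {set 'I_k}) i : wcyc x -> stable z T -> linj e i \notin T ->
  rinj e @: (rinj e @^-1: T) = T.
Proof.
move=> xc zT iT; rewrite -[RHS]setCK -(@stable_in (~: T) i) ?stableC ?inE //.
by rewrite setC_lrinj preimsetC setCK.
Qed.

End BlockRestriction.

Lemma cre_compE F H n k (z : Gn k) : cre_comp (F n) H k z =
  \sum_(S : {set 'I_k} | stable z S && (#|S| == n)) resv F z S * resv H z (~: S).
Proof.
rewrite /cre_comp; case: eqP => [e|ne]; first exact: cfInduceE.
rewrite cf0E big1 // => S /andP[_ /eqP Sn]; case: ne.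
by rewrite subnKC // -Sn -[leqRHS]card_ord max_card.
Qed.

(** Leibniz rule. In the formula for the induced product, either [S] or its complement contains the
    cycle [x]; membership of the point [i0] of the cycle separates the two kinds of terms. *)
Lemma dx_cre F H n a (x : Gn a.+1) m : wcyc x ->
  dx x (cre_comp (F n) H) m =
  (if (a < n)%N then cre_comp (dx x F (n - a.+1)) H m else 0) + cre_comp (F n) (dx x H) m.
Proof.
move=> xc; apply: classfunP => y; rewrite cfDE dxE !cre_compE.
set e := erefl; set z := wemb e _; pose i0 := linj e (@ord0 a).
rewrite (bigID (fun S : {set 'I__} => i0 \in S)) /=; congr (_ + _).
  have -> : (if (a < n)%N then cre_comp (dx x F (n - a.+1)) H m else 0) y =
    \sum_(S : {set 'I_m} | stable y S && (a.+1 + #|S| == n)%N) resv (dx x F) y S * resv H y (~: S).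
    case: ltnP => [an|na].
      rewrite cre_compE; apply: eq_bigl => S; congr (_ && _).
      by rewrite -(eqn_add2l a.+1) subnKC.
    rewrite cf0E big1 // => S /andP[_ /eqP Sn]; move: na.
    by rewrite -Sn leqNgt addSn ltnS leq_addr.
  rewrite (reindex_onto (fun S : {set 'I_m} => lblock e :|: rinj e @: S)
    (fun T : {set 'I__} => rinj e @^-1: T)) /=; last first.
    by move=> T /andP[/andP[zT _] iT]; exact: stable_in xc zT iT.
  apply: eq_big => [S|S].
    rewrite stable_lrinj card_lrinj inE linj_lblock /= andbT.
    rewrite (_ : rinj e @^-1: _ = S) ?eqxx ?andbT //.
    by apply/setP => i; rewrite !inE rinj_lblock mem_rinj.
  rewrite stable_lrinj => /andP[/andP[/andP[yS _] _] _].
  by rewrite setC_lrinj resv_lrinj // resv_rinj // stableC.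
rewrite (reindex_onto (fun S : {set 'I_m} => rinj e @: S)
  (fun T : {set 'I__} => rinj e @^-1: T)) /=; last first.
  by move=> T /andP[/andP[zT _] iT]; exact: stable_notin xc zT iT.
apply: eq_big => [S|S].
  rewrite stable_rinj (card_imset _ (@rinj_inj _ _ _ e)) linj_rinjS /= andbT.
  rewrite (_ : rinj e @^-1: _ = S) ?eqxx ?andbT //.
  by apply/setP => i; rewrite !inE mem_rinj.
rewrite stable_rinj => /andP[/andP[/andP[yS _] _] _].
by rewrite setC_rinj resv_lrinj ?stableC // resv_rinj.
Qed.

(** Splits off the cycle through [ord0]. The same [x] and [y] serve every family [F], so both sides
    of an identity can be differentiated at one cycle; this is the induction principle of all that
    follows. *)
Variant gn_spec k (z : Gn k) : Prop :=
  | GnZero of k = 0%N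
  | GnCons a b (x : Gn a.+1) (y : Gn b) of (a.+1 + b = k)%N & wcyc x &
      (forall F, F k z = dx x F b y).

Lemma gn_cases k (z : Gn k) : gn_spec z.
Proof.
case: k z => [|k] z; first exact: GnZero.
pose S := porbit (wperm z) ord0.
have zS : stable z S.
  apply/stableP => i; rewrite -!eq_porbit_mem; congr (_ == _); apply/esym/eqP.
  by rewrite eq_porbit_mem porbit_sym; exact: (mem_porbit (wperm z) 1 i).
have [tI tp tb] := wres_sub zS; have zCS : stable z (~: S) by rewrite stableC.
have [tI' tp' tb'] := wres_sub zCS.
have xc : wcyc (wres z S).
  have iS : ord0 \in S by exact: porbit_id.
  pose i0 := enum_rank_in iS ord0.
  apply/cards1P; exists (porbit (wperm (wres z S)) i0); apply/setP => O; rewrite inE.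
  apply/imsetP/eqP => [[i _ ->]|->]; last by exists i0.
  apply/eqP; rewrite eq_porbit_mem.
  have : enum_val i \in S by exact: enum_valP.
  case/porbitP => n ni; apply/porbitP; exists n; apply: tI; rewrite ni.
  have -> : ord0 = enum_val i0 by rewrite enum_rankK_in.
  elim: n {ni} => [|n IH]; first by rewrite !expg0 !perm1.
  by rewrite !expgSr !permM IH tp.
have S0 : (0 < #|S|)%N by apply/card_gt0P; exists ord0; exact: porbit_id.
have FE F : F k.+1 z = F (#|S| + #|~: S|)%N (wemb erefl (wres z S, wres z (~: S))).
  rewrite -resvT.
  pose t (i : 'I_(#|S| + #|~: S|)) : 'I_k.+1 :=
    match fintype.split (cast_ord (esym erefl) i) with inl i => enum_val i | inr i => enum_val i end.
  have tl i : t (linj erefl i) = enum_val i by rewrite /t split_linj.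
  have tr i : t (rinj erefl i) = enum_val i by rewrite /t split_rinj.
  have no (a : 'I_#|S|) (b : 'I_#|~: S|) : enum_val a <> enum_val b.
    by move=> ab; have := enum_valP b; rewrite -ab inE enum_valP.
  apply: (@resvE _ _ F _ _ _ z _ t (fun=> 1%g)) => [||i|j _].
  - by apply/stableP => i; rewrite !inE.
  - split=> [i j|i|i].
    + case: (injP erefl i) => i'; case: (injP erefl j) => j'; rewrite ?tl ?tr.
      * by move/enum_val_inj ->.
      * by move/no.
      * by move/esym/no.
      * by move/enum_val_inj ->.
    + case: (injP erefl i) => i'.
        by rewrite tl !wembpl tl tp.
      by rewrite tr !wembpr tr tp'.
    + rewrite invg1 mulg1 mul1g; case: (injP erefl i) => i'.
        by rewrite wembpl tl !wembbl tb mul1g invg1 mulg1.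
      by rewrite wembpr tr !wembbr tb' mul1g invg1 mulg1.
  - by rewrite inE.
  - have [jS|jS] := boolP (j \in S).
      by exists (linj erefl (enum_rank_in jS j)); rewrite tl enum_rankK_in.
    have {}jS : j \in ~: S by rewrite inE.
    by exists (rinj erefl (enum_rank_in jS j)); rewrite tr enum_rankK_in.
have eS : (#|S| + #|~: S| = k.+1)%N by rewrite cardsC card_ord.
move: S0 (wres z S) (wres z (~: S)) xc FE eS.
move: #|S| #|~: S| => [|a] b // _ x y xc FE eS.
by apply: (GnCons (x := x) (y := y) eS xc) => F; rewrite dxE FE.
Qed.

End Derivations.

(** * Induction products *)

Lemma cf_sumE (C : numClosedFieldType) (T : finGroupType) I r (P : pred I)
    (F : I -> classFun C T) x : (\sum_(i <- r | P i) F i) x = \sum_(i <- r | P i) F i x.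
Proof. by apply: (big_morph (fun f : classFun C T => f x)) => [f g|]; rewrite ?cf0E ?cfDE. Qed.

Section Product.
Variables (C : numClosedFieldType) (G : finGroupType).
Local Notation Gn n := (wreath G n).
Local Notation fam := (forall n, classFun C (Gn n)).
Implicit Types F H : fam.

Lemma cre_comp_lin n (phi phi' : Gn n -> C) F H H' c d k :
    (forall x, phi x = c * phi' x) -> (forall m, F m = d *: H m + H' m) ->
  cre_comp phi F k = (c * d) *: cre_comp phi' H k + c *: cre_comp phi' H' k.
Proof.
move=> pE FE; rewrite /cre_comp; case: eqP => [e|_]; last by rewrite !scaler0 addr0.
apply: classfunP => x; rewrite cfDE !cfZE !mkcfE /indfun.
rewrite 2![_ * (_^-1 * _)]mulrCA -mulrDr; congr (_ * _).
rewrite !mulr_sumr -big_split; apply: eq_bigr => y _.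
rewrite !mulr_sumr -big_split; apply: eq_bigr => p _ /=.
by rewrite pE FE cfDE cfZE mulrDr -!mulrA; congr (_ * _ + _); rewrite !mulrA [d * _]mulrC.
Qed.

Lemma cre_compZl n (phi phi' : Gn n -> C) F c k :
  (forall x, phi x = c * phi' x) -> cre_comp phi F k = c *: cre_comp phi' F k.
Proof.
move=> pE; have z0 : cre_comp phi' (fun=> 0) k = 0.
  rewrite (@cre_comp_lin _ phi' phi' (fun=> 0) (fun=> 0) (fun=> 0) 1 (-1)) => [|x|m].
  - by rewrite mul1r scale1r scaleN1r addNr.
  - by rewrite mul1r.
  - by rewrite scaler0 addr0.
rewrite (@cre_comp_lin _ phi phi' F F (fun=> 0) c 1) // => [|m].
  by rewrite mulr1 z0 scaler0 addr0.
by rewrite scale1r addr0.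
Qed.

Lemma eq_cre_comp n (phi phi' : Gn n -> C) F H k :
  phi =1 phi' -> (forall m, F m = H m) -> cre_comp phi F k = cre_comp phi' H k.
Proof.
move=> pE FE; rewrite (_ : F = H); last exact: functional_extensionality_dep.
by rewrite (@cre_compZl _ phi phi' H 1) ?scale1r // => x; rewrite mul1r.
Qed.

Lemma cre_compD n (phi : Gn n -> C) F H H' k :
  (forall m, F m = H m + H' m) -> cre_comp phi F k = cre_comp phi H k + cre_comp phi H' k.
Proof.
move=> FE; rewrite (@cre_comp_lin _ phi phi F H H' 1 1) ?scale1r ?mul1r ?scale1r // => m.
  by rewrite mul1r.
by rewrite FE scale1r.
Qed.

Lemma cre_comp0r n (phi : Gn n -> C) k : cre_comp phi (fun=> 0) k = 0.
Proof.
have := @cre_compD _ phi (fun=> 0) (fun=> 0) (fun=> 0) k (fun=> esym (addr0 _)).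
by move/eqP; rewrite -subr_eq subrr => /eqP <-.
Qed.

Lemma cre_compZr n (phi : Gn n -> C) F H c k :
  (forall m, F m = c *: H m) -> cre_comp phi F k = c *: cre_comp phi H k.
Proof.
move=> FE; rewrite (@cre_comp_lin _ phi phi F H (fun=> 0) 1 c) ?mul1r ?cre_comp0r ?scaler0 ?addr0 //.
  by move=> x; rewrite mul1r.
by move=> m; rewrite addr0.
Qed.

Lemma cre_comp_gt n (phi : Gn n -> C) H k : (k < n)%N -> cre_comp phi H k = 0.
Proof.
move=> kn; rewrite /cre_comp; case: eqP => // e.
by move: kn; rewrite -{1}e ltnNge leq_addr.
Qed.

Lemma cre_comp_unit H k (phi : classFun C (Gn 0)) :
  phi 1%g = 1 -> cre_comp phi H k = H k.
Proof.
move=> p1; rewrite (@eq_cre_comp _ phi (cf_one C (Gn 0)) H H) //; last first.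
  by move=> x; rewrite mkcfE (_ : x = 1%g) //; apply: wreathP => -[].
apply: classfunP => z.
rewrite (cre_compE (fun n => cf_one C (Gn n)) H) (big_pred1 set0) => [|S].
  by rewrite setC0 resvT /resv mkcfE mul1r.
rewrite cards_eq0 /=; case: eqVneq => [->|]; rewrite ?andbF // andbT.
by apply/stableP => i; rewrite !inE.
Qed.

Lemma cre_comp0 F H n (z : Gn 0) :
  cre_comp (F n) H 0 z = if n == 0%N then F 0%N 1%g * H 0%N 1%g else 0.
Proof.
rewrite (_ : z = 1%g); last by apply: wreathP => -[].
case: n => [|n]; last by rewrite cre_comp_gt ?cf0E.
rewrite (@cre_compZl _ _ (cf_one C (Gn 0)) H (F 0%N 1%g)) => [|x].
  by rewrite cre_comp_unit ?cfZE // mkcfE.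
by rewrite mkcfE mulr1 (_ : x = 1%g) //; apply: wreathP => -[].
Qed.

Lemma dx_creE F H n a (x : Gn a.+1) : wcyc x ->
  dx x (cre_comp (F n) H) = fun m =>
    (if (a < n)%N then cre_comp (dx x F (n - a.+1)) H m else 0) + cre_comp (F n) (dx x H) m.
Proof.
by move=> xc; apply: functional_extensionality_dep => m; rewrite dx_cre.
Qed.

(** Both sides have the same derivatives: the three kinds of Leibniz terms match by induction on the
    degree. *)
Lemma cre_compC F F' n n' H k :
  cre_comp (F n) (cre_comp (F' n') H) k = cre_comp (F' n') (cre_comp (F n) H) k.
Proof.
have [K] := ubnP k; elim: K => // K IH in k F F' n n' H *; rewrite ltnS => kK.
apply: classfunP => z; case: (gn_cases C z) => [k0|a b x y e xc zE].
  rewrite k0 in z *; rewrite !cre_comp0; do 2!case: eqP => // _; rewrite ?mulr0 ?mul0r //.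
  by rewrite mulrCA.
have bK : (b < K)%N by apply: leq_trans kK; rewrite -e addSn ltnS leq_addl.
rewrite !zE; congr (cfval _ y); rewrite !dx_creE //.
rewrite (cre_compD _ _ (fun=> erefl)) addrA.
rewrite [in RHS](cre_compD _ _ (fun=> erefl)) addrA.
rewrite [cre_comp (F n) (cre_comp (F' n') _) b]IH //; congr (_ + _).
rewrite addrC; congr (_ + _).
  by case: ifP => _; rewrite ?cre_comp0r // IH.
by case: ifP => _; rewrite ?cre_comp0r // IH.
Qed.

(** Equivalently, [F] takes at each element the product of [u] over its cycles, so that the
    generating series of [F] is an exponential of power sums. *)
Definition mult F (u : forall a, Gn a.+1 -> C) :=
  F 0%N 1%g = 1 /\ forall a (x : Gn a.+1), wcyc x -> forall m, dx x F m = u a x *: F m.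

Lemma mult_uniq F H u : mult F u -> mult H u -> forall k, F k = H k.
Proof.
move=> [F0 Fu] [H0 Hu] k.
have [K] := ubnP k; elim: K => // K IH in k *; rewrite ltnS => kK.
apply: classfunP => z; case: (gn_cases C z) => [k0|a b x y e xc zE].
  by rewrite k0 in z *; rewrite (_ : z = 1%g) ?F0 ?H0 //; apply: wreathP => -[].
rewrite !zE Fu // Hu // IH //.
by apply: leq_trans kK; rewrite -e addSn ltnS leq_addl.
Qed.

Lemma eq_mult F u v : (forall a x, u a x = v a x) -> mult F u -> mult F v.
Proof. by move=> uv [F0 Fu]; split=> // a x xc m; rewrite Fu // uv. Qed.

Lemma mult_mul F H u v : mult F u -> mult H v ->
  mult (fun n => cf_mul (F n) (H n)) (fun a x => u a x * v a x).
Proof.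
move=> [F0 Fu] [H0 Hu]; split=> [|a x xc m]; first by rewrite mkcfE F0 H0 mulr1.
apply: classfunP => y; rewrite dxE cfZE !mkcfE -!dxE Fu // Hu // !cfZE.
by rewrite mulrACA.
Qed.

Lemma dx_mult_cre F u H n a (x : Gn a.+1) : mult F u -> wcyc x ->
  dx x (cre_comp (F n) H) = fun m =>
    (if (a < n)%N then u a x *: cre_comp (F (n - a.+1)%N) H m else 0) + cre_comp (F n) (dx x H) m.
Proof.
move=> [_ Fu] xc; rewrite dx_creE //; apply: functional_extensionality_dep => m.
congr (_ + _); case: ifP => // _; apply: cre_compZl => y; by rewrite Fu // cfZE.
Qed.

(** The alternating sum is the degree [n] part of the product of the series of [F] and of [H] at -z,
    and exponents add. Differentiating the second factor shifts the summation index by a+1, whence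
    the sign. *)
Lemma mult_diff F H u v : mult F u -> mult H v ->
  mult (fun n => \sum_(m < n.+1) (-1) ^+ m *:
          cfInduce (wemb (subnK (leq_ord m)))
            (fun p : Gn (n - m) * Gn m => F (n - m)%N p.1 * H m p.2))
       (fun a x => u a x + (-1) ^+ a.+1 * v a x).
Proof.
move=> mF mH; have [F0 Fu] := mF; have [H0 Hu] := mH.
have IE n (m : 'I_n.+1) : cfInduce (wemb (subnK (leq_ord m)))
    (fun p : Gn (n - m) * Gn m => F (n - m)%N p.1 * H m p.2) = cre_comp (F (n - m)%N) H n.
  by apply: classfunP => z; rewrite cre_compE cfInduceE.
pose D n : classFun C (Gn n) := \sum_(0 <= l < n.+1) (-1) ^+ l *: cre_comp (F (n - l)%N) H n.
have DE n : \sum_(m < n.+1) (-1) ^+ m *: cfInduce (wemb (subnK (leq_ord m)))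
    (fun p : Gn (n - m) * Gn m => F (n - m)%N p.1 * H m p.2) = D n.
  by rewrite /D big_mkord; apply: eq_bigr => m _; rewrite IE.
split=> [|a x xc m].
  by rewrite DE /D big_nat1 expr0 scale1r cre_comp0 F0 H0 mulr1.
rewrite DE; apply: classfunP => y; rewrite dxE DE.
have -> : D (a.+1 + m)%N (wemb erefl (x, y)) = (\sum_(0 <= l < (a.+1 + m).+1)
    (-1) ^+ l *: dx x (cre_comp (F (a.+1 + m - l)%N) H) m) y.
  by rewrite !cf_sumE; apply: eq_bigr => l _; rewrite !cfZE dxE.
congr (cfval _ y).
under eq_bigr => l _ do rewrite (dx_mult_cre _ _ mF xc) scalerDr.
rewrite big_split /= scalerDl; congr (_ + _).
  (* For [l] above [m] the factor [F] has degree at most [a], too small to contain the cycle. *)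
  rewrite (@big_cat_nat _ _ _ m.+1) //=; last by rewrite ltnS leq_addl.
  rewrite [X in _ + X]big_nat_cond [X in _ + X]big1 ?addr0; last first.
    move=> l /andP[/andP[ml _] _]; rewrite ltnNge (_ : _ <= a)%N ?scaler0 //.
    by rewrite leq_subLR addSnnS [(l + a)%N]addnC leq_add2l.
  rewrite scaler_sumr big_nat_cond [RHS]big_nat_cond; apply: eq_bigr => l /andP[/andP[_ lm] _].
  rewrite -addnBA // ltnS leq_addr scalerA mulrC -scalerA; congr (_ *: (_ *: _)).
  by rewrite addKn.
(* For [l] at most [a] the degree of [F] exceeds [m], so the product vanishes in degree [m]. *)
rewrite (@big_cat_nat _ _ _ a.+1) //=; last by rewrite ltnW // ltnS leq_addr.
rewrite big_nat_cond big1 ?add0r; last first.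
  move=> l /andP[/andP[_ la] _]; rewrite cre_comp_gt ?scaler0 //.
  by rewrite ltn_subRL [(l + m)%N]addnC addnC ltn_add2r.
rewrite -{1}[a.+1]add0n big_addn subSn ?leq_addr // addKn scaler_sumr.
apply: eq_bigr => l _; rewrite (@cre_compZr _ _ _ H (v a x)) => [|b]; last exact: Hu.
rewrite !scalerA exprD [(l + a.+1)%N]addnC subnDl; congr (_ *: _).
by rewrite [RHS]mulrC mulrA.
Qed.

End Product.

(** * Cycle products *)

Section Cycles.
Variables (C : numClosedFieldType) (G : finGroupType).
Local Notation Gn n := (wreath G n).
Local Notation fam := (forall n, classFun C (Gn n)).
Implicit Types F H : fam.

Lemma wcycP n (x : Gn n.+1) :
  reflect (forall S, stable x S -> ord0 \in S -> S = setT) (wcyc x).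
Proof.
apply: (iffP idP) => [xc S xS S0|xS]; first exact: wcyc_stable xc xS S0.
have xO : porbit (wperm x) ord0 = setT.
  apply: xS; last exact: porbit_id.
  apply/stableP => i; rewrite -!eq_porbit_mem; congr (_ == _); apply/esym/eqP.
  by rewrite eq_porbit_mem porbit_sym; exact: (mem_porbit (wperm x) 1 i).
apply/cards1P; exists (porbit (wperm x) ord0); apply/setP => O; rewrite inE.
apply/imsetP/eqP => [[i _ ->]|->]; last by exists ord0.
by apply/eqP; rewrite eq_porbit_mem xO inE.
Qed.

Lemma wcyc_porbit n (x : Gn n.+1) i j : wcyc x -> exists k, j = iter k (wperm x) i.
Proof.
move=> xc; have : porbit (wperm x) i = setT.
  apply: (wcyc_stable xc (i := i)); last exact: porbit_id.
  apply/stableP => l; rewrite -!eq_porbit_mem; congr (_ == _); apply/esym/eqP.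
  by rewrite eq_porbit_mem porbit_sym; exact: (mem_porbit (wperm x) 1 l).
move/setP/(_ j); rewrite inE => /porbitP[k ->]; exists k.
by rewrite permX.
Qed.

Lemma wperm_iter n (x : Gn n) k i : wperm (x ^+ k)%g i = iter k (wperm x) i.
Proof.
elim: k => [|k IH]; first by rewrite perm1.
by rewrite expgS wpermM permM IH.
Qed.

Lemma wcyc_permX n (x : Gn n.+1) : wcyc x -> wperm (x ^+ n.+1)%g = 1%g.
Proof.
move=> xc; apply/permP => i; rewrite wperm_iter perm1.
have := iter_porbit (wperm x) i; suff -> : porbit (wperm x) i = setT by rewrite cardsT card_ord.
apply/setP => j; rewrite inE; have [k ->] := wcyc_porbit i j xc.
by rewrite -permX mem_porbit.
Qed.

Lemma wcycJ n (x w : Gn n.+1) : wcyc (x ^ w)%g = wcyc x.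
Proof.
have half (z v : Gn n.+1) : wcyc z -> wcyc (z ^ v)%g.
  move=> zc; apply/wcycP => S zS S0.
  have : wperm v @: S = setT.
    apply: (wcyc_stable zc (i := wperm v ord0)); first by rewrite -stableJ.
    exact: imset_f.
  move/setP => vS; apply/setP => i; rewrite inE.
  have := vS (wperm v i); rewrite inE mem_imset //; exact: perm_inj.
by apply/idP/idP => [/(half _ w^-1%g)|/half]; rewrite ?conjgK.
Qed.

Lemma wcycV n (x : Gn n.+1) : wcyc x^-1%g = wcyc x.
Proof.
have half (z : Gn n.+1) : wcyc z -> wcyc z^-1%g.
  move=> zc; apply/wcycP => S /stableP zS S0; apply: wcyc_stable zc _ S0.
  by apply/stableP => i; rewrite -zS wpermV permK.
by apply/idP/idP => /half; rewrite ?invgK.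
Qed.

(** Reads the cycle product off a power in the wreath group, which turns statements about cycle
    products into group identities. *)
Lemma cycle_prodE n (x : Gn n) i :
  cycle_prod x i = wbase (x ^+ n)%g ((wperm x ^+ n.-1)%g i).
Proof.
have wX k j : wbase (x ^+ k)%g j = (\prod_(l < k) wbase x (((wperm x)^-1 ^+ l)%g j))%g.
  elim: k j => [|k IH] j; first by rewrite big_ord0 wbase1.
  rewrite expgS wbaseM IH big_ord_recl expg0 perm1; congr (_ * _)%g.
  by apply: eq_bigr => l _; rewrite expgS permM.
rewrite wX /cycle_prod; apply: eq_bigr => k _; congr (wbase x _).
rewrite -permM; congr (fun_of_perm _ i); case: n x i k {wX} => [|n] x i k; first by case: k.
rewrite [nat_of_ord (rev_ord k)]/= subSS [n.+1.-1]/=.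
have := leq_ord k; move: (nat_of_ord k) (wperm x) => l s ln.
have -> : (s ^+ n = s ^+ (n - l) * s ^+ l)%g by rewrite -expgD subnK.
by rewrite expgVn -mulgA mulgV mulg1.
Qed.

(** The power [x ^+ n.+1] has trivial permutation and commutes with [x], so its base components at
    successive points of the cycle are conjugate. *)
Lemma cycle_prod_cst n (x : Gn n.+1) (f : classFun C G) i j : wcyc x ->
  f (cycle_prod x i) = f (wbase (x ^+ n.+1)%g j).
Proof.
move=> xc; rewrite cycle_prodE.
have [k ->] := wcyc_porbit j ((wperm x ^+ n.+1.-1)%g i) xc.
elim: k => [|k <-] //=; set l := iter k _ _.
have := congr1 (fun y => wbase y (wperm x l)) (commuteX n.+1 (commute_refl x)).
rewrite !wbaseM permK wcyc_permX // invg1 perm1 => /esym/(canRL (mulgK _)) ->.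
by rewrite -{1}[wbase x _]invgK -mulgA -conjgE classfunJ.
Qed.

Definition ucyc (f : classFun C G) a (x : Gn a.+1) := f (cycle_prod x ord0).

Lemma ucycJ f n (x w : Gn n.+1) : wcyc x -> ucyc f (x ^ w)%g = ucyc f x.
Proof.
move=> xc; rewrite /ucyc (cycle_prod_cst _ _ ord0) ?wcycJ // -conjXg wbaseJ.
rewrite wcyc_permX // invg1 perm1 -mulgA -conjgE classfunJ.
by rewrite -(cycle_prod_cst _ ord0 (wperm w ord0)).
Qed.

Lemma cf_inv_subproof (f : classFun C G) x y : f ((x ^ y)^-1)%g = f x^-1%g.
Proof. by rewrite -conjVg classfunJ. Qed.
Definition cf_inv f := mkcf (cf_inv_subproof f).

Lemma ucycV f n (x : Gn n.+1) : wcyc x -> ucyc f x^-1%g = ucyc (cf_inv f) x.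
Proof.
move=> xc; rewrite /ucyc (cycle_prod_cst _ _ ord0) ?wcycV //.
rewrite (cycle_prod_cst _ _ ord0) // mkcfE expgVn; congr (f _).
by rewrite /= ffunE wcyc_permX // perm1.
Qed.

Lemma sigmaJ n (f : classFun C G) (x w : Gn n.+1) : sigma f (x ^ w)%g = sigma f x.
Proof.
rewrite /sigma -!/(wcyc _) wcycJ; case: ifP => // xc.
by have := ucycJ f w xc; rewrite /ucyc => ->.
Qed.

Definition sigf f n : classFun C (Gn n) :=
  if n is m.+1 then mkcf (@sigmaJ m f) else 0.

Lemma sigmaE n (f : classFun C G) (x : Gn n.+1) : sigma f x = if wcyc x then n.+1%:R * ucyc f x else 0.
Proof. by []. Qed.

Lemma dx_x F a (x : Gn a.+1) : dx x F 0 1%g = F a.+1 x.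
Proof.
rewrite dxE -[RHS]resvT; set z := wemb _ _.
apply/esym/(@resvE _ _ F _ _ z x _ (fun i => match fintype.split (cast_ord (esym erefl) i) with
    inl i => i | inr i => ord0 end) (fun=> 1%g)).
- by apply/stableP => i; rewrite !inE.
- split=> [i j|i|i].
  + by case: (injP erefl i) => [i'|[]//]; case: (injP erefl j) => [j'|[]//]; rewrite !split_linj => ->.
  + case: (injP erefl i) => [i'|[]//]; rewrite wembpl.
    by rewrite !split_linj.
  + case: (injP erefl i) => [i'|[]//]; rewrite wembpl wembbl mul1g invg1 mulg1.
    by rewrite !split_linj.
- by move=> i; rewrite inE.
- by move=> j _; exists (linj erefl j); rewrite split_linj.
Qed.

Lemma wcyc_wemb a b (x : Gn a.+1) (y : Gn b) :
  (0 < b)%N -> wcyc (wemb erefl (x, y)) = false.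
Proof.
case: b y => // b y _; apply/negP => zc.
have := wcyc_stable zc (wemb_stable erefl (x, y)) (linj_lblock erefl ord0).
by move/setP/(_ (rinj erefl ord0)); rewrite rinj_lblock inE.
Qed.

Lemma dx_sigf f a (x : Gn a.+1) b : wcyc x ->
  dx x (sigf f) b = if b == 0%N then (a.+1%:R * ucyc f x) *: cf_one C (Gn b) else 0.
Proof.
move=> xc; case: eqP => [->|/eqP b0]; apply: classfunP => y.
  rewrite (_ : y = 1%g); last by apply: wreathP => -[].
  by rewrite dx_x cfZE !mkcfE mulr1 sigmaE xc.
by rewrite dxE cf0E mkcfE sigmaE wcyc_wemb ?lt0n.
Qed.

(** The derivative of a power sum is a constant ([dx_sigf]), so [dx] and multiplication by [sigma]
    commute up to a scalar, like d/dp and p. *)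
Lemma dx_cre_sigma f H m a (x : Gn a.+1) k : wcyc x ->
  dx x (cre_comp (@sigma C G m f) H) k =
  (if a == m then (m.+1%:R * ucyc f x) *: H k else 0) + cre_comp (@sigma C G m f) (dx x H) k.
Proof.
move=> xc; have cE H' : cre_comp (@sigma C G m f) H' = cre_comp (sigf f m.+1) H'.
  by apply: functional_extensionality_dep => l; apply: eq_cre_comp => // y; rewrite mkcfE.
rewrite !cE dx_cre //; congr (_ + _); rewrite ltnS leq_eqVlt subSS.
have [am|am] := eqVneq a m.
  case: m / am cE => cE; rewrite orTb.
  have := subnn a; move: (a - a)%N => b ->.
  rewrite (@cre_compZl _ _ _ _ (cf_one C _) _ (a.+1%:R * ucyc f x)) => [|y].
    by rewrite cre_comp_unit // mkcfE.
  by rewrite dx_sigf // eqxx cfZE.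
rewrite orFb; case: ifP => // lam; rewrite (@cre_compZl _ _ _ _ (cf_one C _) _ 0) ?scale0r // => y.
by rewrite dx_sigf // subn_eq0 leqNgt lam cf0E mul0r.
Qed.

End Cycles.

(** * The characters of tensor powers *)

Section Characters.
Variables (C : numClosedFieldType) (G : finGroupType).
Local Notation Gn n := (wreath G n).
Local Notation fam := (forall n, classFun C (Gn n)).
Implicit Types F H : fam.

Lemma card_porbits_wemb n m (x : Gn n) (y : Gn m) :
  #|porbits (wperm (wemb erefl (x, y)))| = (#|porbits (wperm x)| + #|porbits (wperm y)|)%N.
Proof.
set z := wemb _ _; set e := erefl : (n + m = n + m)%N.
have Xl k i : (wperm z ^+ k)%g (linj e i) = linj e ((wperm x ^+ k)%g i).
  by elim: k => [|k IH]; rewrite ?expg0 ?perm1 // !expgSr !permM IH wembpl.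
have Xr k i : (wperm z ^+ k)%g (rinj e i) = rinj e ((wperm y ^+ k)%g i).
  by elim: k => [|k IH]; rewrite ?expg0 ?perm1 // !expgSr !permM IH wembpr.
have Ol i : porbit (wperm z) (linj e i) = linj e @: porbit (wperm x) i.
  apply/setP => j; apply/porbitP/imsetP => [[k ->]|[_ /porbitP[k ->] ->]].
    by exists ((wperm x ^+ k)%g i); rewrite ?mem_porbit.
  by exists k.
have Or i : porbit (wperm z) (rinj e i) = rinj e @: porbit (wperm y) i.
  apply/setP => j; apply/porbitP/imsetP => [[k ->]|[_ /porbitP[k ->] ->]].
    by exists ((wperm y ^+ k)%g i); rewrite ?mem_porbit.
  by exists k.
have -> : porbits (wperm z) = [set linj e @: (O : {set 'I_n}) | O in porbits (wperm x)]
    :|: [set rinj e @: (O : {set 'I_m}) | O in porbits (wperm y)].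
  apply/setP => O; rewrite inE; apply/imsetP/orP => [[i _ ->]|[]].
  - by case: (injP e i) => j; [left; rewrite Ol | right; rewrite Or]; rewrite !imset_f.
  - by move=> /imsetP[_ /imsetP[i _ ->] ->]; exists (linj e i); rewrite ?Ol.
  - by move=> /imsetP[_ /imsetP[i _ ->] ->]; exists (rinj e i); rewrite ?Or.
rewrite cardsU (card_imset _ (imset_inj (@linj_inj _ _ _ e))).
rewrite (card_imset _ (imset_inj (@rinj_inj _ _ _ e))).
rewrite (_ : _ :&: _ = set0) ?cards0 ?subn0 //; apply/setP => O; rewrite !inE.
apply/negP => /andP[/imsetP[_ /imsetP[i _ ->] ->] /imsetP[_ /imsetP[j _ ->]]].
rewrite -Ol -Or => /eqP; rewrite eq_porbit_mem Or => /imsetP[l _].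
by move/lrinjF.
Qed.

(** A cycle of length a+1 has sign (-1)^a, and signs multiply over blocks. *)
Lemma wsgn_dx F u : mult F u ->
  mult (fun n => cf_mul (wsgn C G n) (F n)) (fun a x => (-1) ^+ a * u a x).
Proof.
move=> [F0 Fu]; split=> [|a x xc m].
  by rewrite mkcfE F0 mkcfE odd_perm1 expr0 mulr1.
apply: classfunP => y; rewrite dxE cfZE !mkcfE -dxE Fu // cfZE [RHS]mulrACA; congr (_ * _).
rewrite !/odd_perm card_porbits_wemb (eqP xc) !card_ord.
rewrite -[(-1) ^+ a]signr_odd -signr_addb; congr (_ ^+ nat_of_bool _).
by rewrite !oddD /=; case: (odd a); case: (odd m); case: (odd #|_|).
Qed.

Section Tensor.
Variables (d : nat) (V : mx_representation C [set: G] d).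

Lemma eta_repE n (x : Gn n) : eta_rep V n x =
  \sum_(a : {ffun 'I_n -> 'I_d}) \prod_(i < n)
    V (wbase x i) (a i) (a ((wperm x)^-1%g i)).
Proof.
rewrite mkcfE /mxtrace [RHS](reindex (@enum_val {ffun 'I_n -> 'I_d} predT)) /=.
  by apply: eq_bigr => a _; rewrite mxE.
by apply: onW_bij; exact: enum_val_bij.
Qed.

Lemma eta_rep_wemb n m (x : Gn n) (y : Gn m) :
  eta_rep V (n + m) (wemb erefl (x, y)) = eta_rep V n x * eta_rep V m y.
Proof.
set e := erefl : (n + m = n + m)%N.
rewrite !eta_repE big_distrlr pair_big.
pose f (p : {ffun 'I_n -> 'I_d} * {ffun 'I_m -> 'I_d}) : {ffun 'I_(n + m) -> 'I_d} :=
  [ffun i => match fintype.split (cast_ord (esym e) i) with inl i => p.1 i | inr i => p.2 i end].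
have fl p i : f p (linj e i) = p.1 i by rewrite ffunE split_linj.
have fr p i : f p (rinj e i) = p.2 i by rewrite ffunE split_rinj.
rewrite (reindex f); last first.
  exists (fun a : {ffun 'I_(n + m) -> 'I_d} => ([ffun i => a (linj e i)], [ffun i => a (rinj e i)])) => [[a b] _|a _].
    by congr pair; apply/ffunP => i; rewrite ffunE (fl, fr).
  by apply/ffunP => i; case: (injP e i) => j; rewrite ?fl ?fr ffunE.
apply: eq_big => // p _; rewrite big_split_ord.
have Vl i : (wperm (wemb e (x, y)))^-1%g (linj e i) = linj e ((wperm x)^-1%g i).
  by apply: (@perm_inj _ (wperm (wemb e (x, y)))); rewrite permKV wembpl permKV.
have Vr i : (wperm (wemb e (x, y)))^-1%g (rinj e i) = rinj e ((wperm y)^-1%g i).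
  by apply: (@perm_inj _ (wperm (wemb e (x, y)))); rewrite permKV wembpr permKV.
have lE i : lshift m i = linj e i by rewrite /linj cast_ord_id.
have rE i : rshift n i = rinj e i by rewrite /rinj cast_ord_id.
congr (_ * _); apply: eq_bigr => i _.
  by rewrite lE wembbl Vl !fl.
by rewrite rE wembbr Vr !fr.
Qed.

(* A wreath element with a single cycle is conjugate to one whose base is       *)
(* trivial except at one point, where the tensor trace is immediate.            *)
Lemma eta_rep_cyc n (x : Gn n.+1) : wcyc x -> eta_rep V n.+1 x = ucyc (rchar V) x.
Proof.
move=> xc; rewrite /ucyc (cycle_prod_cst _ _ ord0) //; set g := wbase _ _.
pose s := wperm x; pose N := n.+1.
pose ka i := index i (traject s ord0 N).
have trT i : i \in traject s ord0 N.
  have := porbit_traject s ord0; rewrite (_ : porbit s ord0 = setT) => [|]; last first.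
    apply/setP => j; rewrite inE; have [k ->] := wcyc_porbit ord0 j xc.
    by rewrite -permX mem_porbit.
  by move/(_ i); rewrite cardsT card_ord inE.
have kaN i : (ka i < N)%N by have := trT i; rewrite -index_mem size_traject.
have kaE i : i = iter (ka i) s ord0.
  by rewrite -(nth_traject s (kaN i)) nth_index.
have uT : uniq (traject s ord0 N).
  have := uniq_traject_porbit s ord0; rewrite (_ : porbit s ord0 = setT) ?cardsT ?card_ord //.
  apply/setP => j; rewrite inE; have [k ->] := wcyc_porbit ord0 j xc.
  by rewrite -permX mem_porbit.
have kaI k : (k < N)%N -> ka (iter k s ord0) = k.
  by move=> kN; rewrite -(nth_traject s kN) /ka index_uniq ?size_traject.
have ka0 : ka ord0 = 0%N by exact: (kaI 0%N).
have sN i : iter N s i = i by rewrite -wperm_iter wcyc_permX ?perm1.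
have kaS i : s i = iter (ka i).+1 s ord0 by rewrite {1}(kaE i).
(* Since [ka i] counts the steps from [ord0] to [i] along the cycle, [h] accumulates the base
   entries met on the way; the whole cycle product is thereby pushed to [ord0]. *)
pose h i := wbase (x ^+ ka i)%g i.
pose p : Gn N := Wreath [ffun j => if j == ord0 then g else 1%g] s.
have sp : wsubp p x id h.
  split=> // i; rewrite /= ffunE.
  have := kaN i; rewrite leq_eqVlt => /orP[/eqP kN|kN].
    have s0 : s i = ord0 by rewrite kaS kN sN.
    rewrite s0 eqxx /h ka0 expg0 wbase1 mul1g /g.
    have -> : (x ^+ N = x * x ^+ ka i)%g by rewrite -expgS kN.
    rewrite wbaseM.
    by rewrite -s0 permK mulgK.
  have kS : ka (s i) = (ka i).+1 by rewrite kaS kaI.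
  case: eqP => [s0|_]; first by rewrite s0 ka0 in kS.
  by rewrite /h kS expgS wbaseM permK mulg1 mulgK.
have sx : wsubp x x id (fun=> 1%g) by split=> // i; rewrite mul1g invg1 mulg1.
have -> : eta_rep V N x = eta_rep V N p.
  by apply: (@wsubp_eq _ _ (fun n => eta_rep V n) _ _ _ _ _ _ _ _ _ _ sx sp) => j; exists j.
(* Away from [ord0] the matrices are identities, so only constant index functions survive, and they
   sum to the trace at [g]. *)
rewrite eta_repE (bigID (fun a : {ffun 'I_N -> 'I_d} => a == [ffun=> a ord0])) /=.
rewrite [X in _ + X]big1 ?addr0 => [|a /eqP na]; last first.
  have [i /andP[i0 ai]] : exists i, (i != ord0) && (a i != a (s^-1%g i)).
    apply/existsP; apply: contra_notT na => /existsPn na; apply/ffunP => i; rewrite ffunE.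
    rewrite (kaE i); have := kaN i; elim: (ka i) => // k IH kN.
    rewrite -IH ?(ltnW kN) //=; have := na (s (iter k s ord0)).
    rewrite permK negb_and !negbK => /orP[/eqP s0|/eqP //].
    by have := kaI _ kN; rewrite /= s0 ka0.
  by rewrite (bigD1 i) //= ffunE (negPf i0) repr_mx1 mxE (negPf ai) mul0r.
rewrite [RHS]ffunE /mxtrace (reindex_onto (fun c : 'I_d => [ffun=> c])
  (fun a : {ffun 'I_N -> 'I_d} => a ord0)) => [|a /eqP/esym //].
apply: eq_big => [c|c _]; first by rewrite !ffunE !eqxx.
rewrite (bigD1 ord0) //= !ffunE eqxx big1 ?mulr1 // => i i0.
by rewrite !ffunE (negPf i0) repr_mx1 mxE eqxx.
Qed.

Lemma mult_eta_rep : mult (fun n => eta_rep V n) (@ucyc C G (rchar V)).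
Proof.
split=> [|a x xc m].
  rewrite eta_repE (eq_bigr (fun=> 1)) => [|a _]; last by rewrite big_ord0.
  by rewrite sumr_const card_ffun !card_ord expn0.
by apply: classfunP => y; rewrite dxE cfZE eta_rep_wemb eta_rep_cyc.
Qed.

Lemma mult_eps_rep : mult (fun n => eps_rep V n)
  (fun a x => (-1) ^+ a * ucyc (rchar V) x).
Proof. exact: wsgn_dx mult_eta_rep. Qed.

End Tensor.

Definition virtual (f : classFun C G) := exists d (V : mx_representation C [set: G] d)
  d' (W : mx_representation C [set: G] d'), f = rchar V - rchar W.

Lemma cfNE (T : finGroupType) (f : classFun C T) x : (- f) x = - f x.
Proof. exact: mkcfE. Qed.

(** The sign (-1)^(a+1) of the alternating sum and the sign (-1)^a of the cycle multiply to -1, so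
    the eigenvalue is the value of the virtual character itself. *)
Lemma mult_eta_diff d (V : mx_representation C [set: G] d)
    d' (W : mx_representation C [set: G] d') :
  mult (fun n => eta_diff V W n) (@ucyc C G (rchar V - rchar W)).
Proof.
apply: eq_mult (mult_diff (mult_eta_rep V) (mult_eps_rep W)) => a x.
by rewrite mulrA -exprD addSn addnn exprS -signr_odd odd_double expr0 mulr1 mulN1r /ucyc cfDE cfNE.
Qed.

(** The eigenvalues depend on [f] alone, so by [mult_uniq] the choice of two representations made in
    [eta] does not matter. *)
Lemma mult_eta f : virtual f -> mult (fun n => Defs.eta n f) (@ucyc C G f).
Proof.
case=> d [V [d' [W fE]]].
rewrite (_ : (fun n => Defs.eta n f) = (fun n => eta_diff V W n)).
  by rewrite fE; exact: mult_eta_diff.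
apply: functional_extensionality_dep => n; rewrite /Defs.eta.
case: classical_sets.xgetP => [h _ [d1 [V1 [d1' [W1 [fE1 ->]]]]]|/(_ (eta_diff V W n)) []].
  apply: (mult_uniq (F := fun n => eta_diff V1 W1 n)
    (H := fun n => eta_diff V W n) (mult_eta_diff V1 W1)).
  by rewrite -fE1 fE; exact: mult_eta_diff.
by exists d, V, d', W.
Qed.

Lemma mult_epsilon f : virtual f ->
  mult (fun n => epsilon n f) (fun a x => (-1) ^+ a * ucyc f x).
Proof. by move/mult_eta/wsgn_dx. Qed.

End Characters.

(** * Annihilation operators *)

Lemma sum_trunc (W : nmodType) (g : nat -> W) n n' :
  (n <= n')%N -> (forall k, (n <= k)%N -> g k = 0) -> \sum_(k < n') g k = \sum_(k < n) g k.
Proof.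
move=> nn g0; rewrite -!(big_mkord xpredT) (@big_cat_nat _ _ _ n) //=.
by rewrite [X in _ + X]big_nat_cond [X in _ + X]big1 ?addr0 // => k /andP[/andP[/g0 ->]].
Qed.

Lemma natr_card_neq0 (C : numClosedFieldType) (T : finGroupType) : #|T|%:R != 0 :> C.
Proof. by rewrite pnatr_eq0 -lt0n; apply/card_gt0P; exists 1%g. Qed.

(** Frobenius reciprocity with values in a module; [annf_induce] takes for [W] the derivative
    [dx x^-1 A m] as a function of [x]. *)
Lemma cfInduce_reciprocity (C : numClosedFieldType) (H K : finGroupType) (i : H -> K)
    (f : H -> C) (V : lmodType C) (W : K -> V) :
    (forall x y, W (x ^ y)%g = W x) ->
  #|K|%:R^-1 *: (\sum_x cfInduce i f x *: W x) = #|H|%:R^-1 *: (\sum_h f h *: W (i h)).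
Proof.
move=> WJ; transitivity (#|K|%:R^-1 *: \sum_x #|H|%:R^-1 *:
    \sum_y \sum_(h | i h == (x ^ y)%g) f h *: W (i h)).
  congr (_ *: _); apply: eq_bigr => x _; rewrite mkcfE /indfun -scalerA; congr (_ *: _).
  rewrite scaler_suml; apply: eq_bigr => y _; rewrite scaler_suml.
  by apply: eq_bigr => h /eqP ->; rewrite WJ.
rewrite -scaler_sumr scalerA mulrC -scalerA; congr (_ *: _); rewrite exchange_big /=.
transitivity (#|K|%:R^-1 *: \sum_(y : K) \sum_h f h *: W (i h)).
  congr (_ *: _); apply: eq_bigr => y _; rewrite (exchange_big_dep predT) //=.
  by apply: eq_bigr => h _; rewrite (big_pred1 (i h ^ y^-1)%g) // => x; rewrite /= -(can2_eq (conjgK y) (conjgKV y)) eq_sym.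
by rewrite sumr_const -scaler_nat scalerA mulVf ?scale1r // natr_card_neq0.
Qed.

Section Annihilators.
Variables (C : numClosedFieldType) (G : finGroupType).
Local Notation Gn n := (wreath G n).
Local Notation fam := (forall n, classFun C (Gn n)).
Implicit Types F H A : fam.

Lemma cre_comp_sum n (phi : Gn n -> C) I (r : seq I) (c : I -> C) (H : I -> fam) F k :
    (forall m, F m = \sum_(i <- r) c i *: H i m) ->
  cre_comp phi F k = \sum_(i <- r) c i *: cre_comp phi (H i) k.
Proof.
elim: r F => [|i r IH] F FE.
  by rewrite big_nil -(cre_comp0r phi k); apply: eq_cre_comp => // m; rewrite FE big_nil.
rewrite big_cons -(IH (fun m => \sum_(i <- r) c i *: H i m)) // -(@cre_compZr _ _ _ _ (fun m => c i *: H i m)) //.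
by apply: cre_compD => m; rewrite FE big_cons.
Qed.

Lemma dx_sum n (x : Gn n) I (r : seq I) (c : I -> C) (H : I -> fam) F k :
    (forall m, F m = \sum_(i <- r) c i *: H i m) ->
  dx x F k = \sum_(i <- r) c i *: dx x (H i) k.
Proof.
move=> FE; apply: classfunP => y; rewrite dxE FE !cf_sumE.
by apply: eq_bigr => i _; rewrite !cfZE dxE.
Qed.

Lemma wembV n m k (e : (n + m)%N = k) (p : Gn n * Gn m) : wemb e p^-1%g = (wemb e p)^-1%g.
Proof.
have e1 : wemb e 1%g = 1%g :> Gn _.
  by apply: (mulgI (wemb e 1%g)); rewrite -wembM !mulg1.
by apply: (mulgI (wemb e p)); rewrite -wembM !mulgV e1.
Qed.

Lemma dxJ n (x w : Gn n) A m : dx (x ^ w)%g A m = dx x A m.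
Proof.
apply: classfunP => y; rewrite !dxE.
have -> : ((x ^ w)%g, y) = ((x, y) ^ (w, 1%g))%g.
  by rewrite /conjg; congr pair; rewrite /= mulg1 ?invg1 ?mul1g.
by rewrite /conjg !wembM wembV -/(conjg _ _) classfunJ.
Qed.

Lemma fam_iso A k k' (z : Gn k) (z' : Gn k') t : injective t ->
    (forall j, exists i, j = t i) ->
    (forall i, wperm z' (t i) = t (wperm z i)) ->
    (forall i, wbase z' (t i) = wbase z i) -> A k z = A k' z'.
Proof.
move=> tI ts tp tb; rewrite -[RHS]resvT; apply/esym/(@resvE _ _ A _ _ z z' _ t (fun=> 1%g)).
- by apply/stableP => i; rewrite !inE.
- by split=> // i; rewrite tb mul1g invg1 mulg1.
- by move=> i; rewrite inE.
- by move=> j _; exact: ts.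
Qed.

(** Only the bracketing of three blocks differs between the two sides; [t] is the relabelling that
    reassociates them. *)
Lemma dx_dx n b k (e : (n + b)%N = k) (p : Gn n) (q : Gn b) A m :
  dx q (dx p A) m = dx (wemb e (p, q)) A m.
Proof.
apply: classfunP => y; rewrite !dxE; set e1 := erefl; set e2 := erefl; set e3 := erefl.
pose t (i : 'I_(n + (b + m))) : 'I_(k + m) :=
  match fintype.split (cast_ord (esym e1) i) with
  | inl i => linj e3 (linj e i)
  | inr i => match fintype.split (cast_ord (esym e2) i) with
             | inl i => linj e3 (rinj e i) | inr i => rinj e3 i end
  end.
have t1 i : t (linj e1 i) = linj e3 (linj e i) by rewrite /t split_linj.
have t2 i : t (rinj e1 (linj e2 i)) = linj e3 (rinj e i) by rewrite /t split_rinj split_linj.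
have t3 i : t (rinj e1 (rinj e2 i)) = rinj e3 i by rewrite /t !split_rinj.
apply: (@fam_iso A _ _ _ _ t) => [i j|j|i|i].
- case: (injP e1 i) => {}i; [|case: (injP e2 i) => {}i];
  (case: (injP e1 j) => {}j; [|case: (injP e2 j) => {}j]); rewrite ?t1 ?t2 ?t3.
  + by move/linj_inj/linj_inj ->.
  + by move/linj_inj/lrinjF.
  + by move/lrinjF.
  + by move/linj_inj/esym/lrinjF.
  + by move/linj_inj/rinj_inj ->.
  + by move/lrinjF.
  + by move/esym/lrinjF.
  + by move/esym/lrinjF.
  + by move/rinj_inj ->.
- case: (injP e3 j) => {}j; [case: (injP e j) => {}j|].
  + by exists (linj e1 j).
  + by exists (rinj e1 (linj e2 j)).
  + by exists (rinj e1 (rinj e2 j)).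
- case: (injP e1 i) => {}i; [|case: (injP e2 i) => {}i].
  + by rewrite t1 !wembpl t1.
  + by rewrite t2 wembpl !wembpr wembpl t2.
  + by rewrite t3 !wembpr t3.
- case: (injP e1 i) => {}i; [|case: (injP e2 i) => {}i].
  + by rewrite t1 !wembbl.
  + by rewrite t2 wembbl !wembbr wembbl.
  + by rewrite t3 !wembbr.
Qed.

Lemma dxC n b (p : Gn n) (q : Gn b) A m : dx q (dx p A) m = dx p (dx q A) m.
Proof.
apply: classfunP => y; rewrite !dxE.
set e1 := erefl; set e2 := erefl; set e3 := erefl; set e4 := erefl.
pose t (i : 'I_(n + (b + m))) : 'I_(b + (n + m)) :=
  match fintype.split (cast_ord (esym e1) i) with
  | inl i => rinj e3 (linj e4 i)
  | inr i => match fintype.split (cast_ord (esym e2) i) with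
             | inl i => linj e3 i | inr i => rinj e3 (rinj e4 i) end
  end.
have t1 i : t (linj e1 i) = rinj e3 (linj e4 i) by rewrite /t split_linj.
have t2 i : t (rinj e1 (linj e2 i)) = linj e3 i by rewrite /t split_rinj split_linj.
have t3 i : t (rinj e1 (rinj e2 i)) = rinj e3 (rinj e4 i) by rewrite /t !split_rinj.
apply: (@fam_iso A _ _ _ _ t) => [i j|j|i|i].
- case: (injP e1 i) => {}i; [|case: (injP e2 i) => {}i];
  (case: (injP e1 j) => {}j; [|case: (injP e2 j) => {}j]); rewrite ?t1 ?t2 ?t3.
  + by move/rinj_inj/linj_inj ->.
  + by move/esym/lrinjF.
  + by move/rinj_inj/lrinjF.
  + by move/lrinjF.
  + by move/linj_inj ->.
  + by move/lrinjF.
  + by move/rinj_inj/esym/lrinjF.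
  + by move/esym/lrinjF.
  + by move/rinj_inj/rinj_inj ->.
- case: (injP e3 j) => {}j; [|case: (injP e4 j) => {}j].
  + by exists (rinj e1 (linj e2 j)).
  + by exists (linj e1 j).
  + by exists (rinj e1 (rinj e2 j)).
- case: (injP e1 i) => {}i; [|case: (injP e2 i) => {}i].
  + by rewrite t1 wembpr !wembpl t1.
  + by rewrite t2 wembpl !wembpr wembpl t2.
  + by rewrite t3 !wembpr t3.
- case: (injP e1 i) => {}i; [|case: (injP e2 i) => {}i].
  + by rewrite t1 wembbr !wembbl.
  + by rewrite t2 wembbl !wembbr wembbl.
  + by rewrite t3 !wembbr.
Qed.

(** The adjoint of multiplication by [phi], as an average of derivatives. The weight of the form is
    absorbed in [phi], which need not be a class function. *)
Definition annf n (phi : Gn n -> C) A m : classFun C (Gn m) :=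
  #|{: Gn n}|%:R^-1 *: \sum_x phi x *: dx x^-1%g A m.

Lemma annfE n (phi : Gn n -> C) A m :
  annf phi A m = \sum_x (#|{: Gn n}|%:R^-1 * phi x) *: dx x^-1%g A m.
Proof. by rewrite /annf scaler_sumr; apply: eq_bigr => x _; rewrite scalerA. Qed.

Lemma ann_compE xi n (phi : Gn n -> C) (f : RGamma C G) m :
  ann_comp xi phi f m = annf (fun x => Defs.eta n xi x * phi x) f m.
Proof.
apply: classfunP => y; rewrite mkcfE /wform /cform cfZE cf_sumE; congr (_ * _).
by apply: eq_bigr => x _; rewrite cfZE dxE.
Qed.

Lemma dx_annf n (phi : Gn n -> C) A b (q : Gn b) m :
  dx q (annf phi A) m = \sum_x (#|{: Gn n}|%:R^-1 * phi x) *: dx q (dx x^-1%g A) m.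
Proof. by apply: dx_sum => l; rewrite annfE. Qed.

Lemma annfC n b (phi : Gn n -> C) (psi : Gn b -> C) A m :
  annf phi (annf psi A) m = annf psi (annf phi A) m.
Proof.
rewrite !annfE; under eq_bigr do rewrite dx_annf scaler_sumr.
under [RHS]eq_bigr do rewrite dx_annf scaler_sumr.
rewrite exchange_big; apply: eq_bigr => x _; apply: eq_bigr => y _.
by rewrite !scalerA mulrC dxC.
Qed.

(** The adjoint of a product is the composite of the adjoints: Frobenius reciprocity combined with
    [dx_dx]. *)
Lemma annf_induce n b k (e : (n + b)%N = k) (phi : Gn n -> C) (psi : Gn b -> C) A m :
  annf (cfInduce (wemb e) (fun p : Gn n * Gn b => phi p.1 * psi p.2)) A m =
  annf psi (annf phi A) m.
Proof.
rewrite /annf (@cfInduce_reciprocity _ _ _ _ _ _ (fun x => dx x^-1%g A m)); last first.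
  by move=> x y; rewrite -conjVg dxJ.
rewrite (card_prod (Gn n) (Gn b)) natrM invfM mulrC -scalerA; congr (_ *: _).
rewrite scaler_sumr -(pair_bigA _ (fun p q => #|{: Gn n}|%:R^-1 *:
  ((phi p * psi q) *: dx (wemb e (p, q))^-1%g A m))) exchange_big.
apply: eq_bigr => q _; rewrite dx_annf scaler_sumr; apply: eq_bigr => p _.
rewrite (dx_dx e) -wembV !scalerA; congr (_ *: _).
by rewrite mulrA mulrC.
Qed.

Lemma annf_cre F n H k A m : (n <= k)%N ->
  annf (cre_comp (F n) H k) A m = annf (H (k - n)%N) (annf (F n) A) m.
Proof.
move=> nk; rewrite /cre_comp; case: eqP => [e|]; last by rewrite subnKC.
exact: annf_induce.
Qed.

Lemma eq_annf n (phi psi : Gn n -> C) A B m :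
  phi =1 psi -> (forall k, A k = B k) -> annf phi A m = annf psi B m.
Proof.
move=> pp AB; rewrite (_ : A = B); last exact: functional_extensionality_dep.
by congr (_ *: _); apply: eq_bigr => x _; rewrite pp.
Qed.

(** As [phi] vanishes off the single cycles, every derivative that occurs in [annf phi] obeys the
    Leibniz rule. *)
Lemma annf_cre_sigma a (phi : Gn a.+1 -> C) m (f : classFun C G) H k :
    (forall x, ~~ wcyc x -> phi x = 0) ->
  annf phi (cre_comp (@sigma C G m f) H) k =
  (if a == m then (#|{: Gn a.+1}|%:R^-1 * \sum_x phi x * (m.+1%:R * ucyc f x^-1%g)) *: H k else 0)
  + cre_comp (@sigma C G m f) (annf phi H) k.
Proof.
move=> phi0; rewrite (cre_comp_sum _ _ (annfE phi H)) annfE.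
rewrite mulr_sumr scaler_suml.
have -> : (if a == m then \sum_i (#|{: Gn a.+1}|%:R^-1 * (phi i * (m.+1%:R * ucyc f i^-1%g))) *: H k else 0)
  = \sum_i (if a == m then (#|{: Gn a.+1}|%:R^-1 * (phi i * (m.+1%:R * ucyc f i^-1%g))) *: H k else 0).
  by case: eqP => // _; rewrite big1.
rewrite -big_split; apply: eq_bigr => x _ /=.
have [xc|/phi0 ->] := boolP (wcyc x); last by rewrite !(mulr0, mul0r, scale0r) if_same addr0.
rewrite dx_cre_sigma ?wcycV // scalerDr; congr (_ + _).
by case: eqP => _; rewrite ?scaler0 // scalerA -mulrA.
Qed.

Lemma annf_cre_mult a (phi : Gn a.+1 -> C) F u n H k :
    (forall x, ~~ wcyc x -> phi x = 0) -> mult F u ->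
  annf phi (cre_comp (F n) H) k =
  (if (a < n)%N then (#|{: Gn a.+1}|%:R^-1 * \sum_x phi x * u a x^-1%g) *: cre_comp (F (n - a.+1)%N) H k else 0)
  + cre_comp (F n) (annf phi H) k.
Proof.
move=> phi0 mF; rewrite (cre_comp_sum _ _ (annfE phi H)) annfE.
rewrite mulr_sumr scaler_suml; set B := cre_comp _ H k.
have -> : (if (a < n)%N then \sum_i (#|{: Gn a.+1}|%:R^-1 * (phi i * u a i^-1%g)) *: B else 0)
  = \sum_i (if (a < n)%N then (#|{: Gn a.+1}|%:R^-1 * (phi i * u a i^-1%g)) *: B else 0).
  by case: ltnP => // _; rewrite big1.
rewrite -big_split; apply: eq_bigr => x _ /=.
have [xc|/phi0 ->] := boolP (wcyc x); last by rewrite !(mulr0, mul0r, scale0r) if_same addr0.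
rewrite (dx_mult_cre _ _ mF) ?wcycV // scalerDr; congr (_ + _).
by case: ltnP => _; rewrite ?scaler0 // scalerA -mulrA.
Qed.


(** * Newton's identities for multiplicative families *)

Section Newton.
Variables (F : fam) (c : nat -> C) (f : classFun C G).
Hypothesis mF : mult F (fun a x => c a * ucyc f x).

(** This is z F'(z) = (sum of c_l sigma_(l+1) z^(l+1)) F(z), read coefficientwise and applied to
    [H]. It is proved by differentiating both sides at a cycle and inducting on the degree. *)
Lemma newton_cre H n k : n%:R *: cre_comp (F n) H k =
  \sum_(l < n) c l *: cre_comp (@sigma C G l f) (cre_comp (F (n - l.+1)%N) H) k.
Proof.
have [K] := ubnP k; elim: K => // K IH in k n H *; rewrite ltnS => kK.
apply: classfunP => z; case: (gn_cases C z) => [k0|a b x y e xc zE].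
  rewrite k0 in z *; rewrite cfZE cre_comp0 cf_sumE big1 => [|l _]; last first.
    by rewrite cre_comp_gt // scaler0 cf0E.
  by case: n => [|n]; rewrite ?mul0r ?mulr0.
have bK : (b < K)%N by apply: leq_trans kK; rewrite -e addSn ltnS leq_addl.
rewrite cfZE cf_sumE !zE; under eq_bigr do rewrite cfZE zE.
transitivity ((n%:R *: dx x (cre_comp (F n) H) b) y); first by rewrite cfZE.
transitivity ((\sum_(l < n) c l *: dx x (cre_comp (@sigma C G l f) (cre_comp (F (n - l.+1)%N) H)) b) y); last first.
  by rewrite cf_sumE; apply: eq_bigr => l _; rewrite cfZE.
congr (cfval _ y); rewrite (dx_mult_cre _ _ mF xc) scalerDr IH //.
under [RHS]eq_bigr => l _ do rewrite dx_cre_sigma // (dx_mult_cre _ _ mF xc)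
   (cre_compD _ _ (fun=> erefl)) !scalerDr.
rewrite 2!big_split /= addrA; congr (_ + _).
case: ltnP => an; last first.
  rewrite scaler0 !big1 ?addr0 // => l _.
    rewrite ltnNge (leq_trans (leq_subr _ _)) // cre_comp0r scaler0 //.
  by rewrite gtn_eqF ?scaler0 // (leq_trans (ltn_ord l)).
rewrite (bigD1 (Ordinal an)) //= eqxx big1 ?addr0 => [|l la]; last first.
  by rewrite -(inj_eq val_inj) /= eq_sym in la; rewrite (negPf la) scaler0.
have -> : \sum_(i < n) c i *: cre_comp (@sigma C G i f) (fun k0 => if (a < n - i.+1)%N
     then (c a * ucyc f x) *: cre_comp (F (n - i.+1 - a.+1)%N) H k0 else 0) b =
   (c a * ucyc f x) *: ((n - a.+1)%:R *: cre_comp (F (n - a.+1)%N) H b).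
  rewrite IH // scaler_sumr.
  rewrite (@sum_trunc _ (fun i => c i *: cre_comp (@sigma C G i f) (fun k0 => if (a < n - i.+1)%N
     then (c a * ucyc f x) *: cre_comp (F (n - i.+1 - a.+1)%N) H k0 else 0) b) (n - a.+1)
     n) ?leq_subr // => [|i ni]; last first.
    have -> : (a < n - i.+1)%N = false by lia.
    by rewrite cre_comp0r scaler0.
  apply: eq_bigr => i _; have -> : (a < n - i.+1)%N.
    by have := ltn_ord i; lia.
  rewrite (@cre_compZr _ _ _ _ _ (cre_comp (F (n - a.+1 - i.+1)%N) H) (c a * ucyc f x)) => [|m].
    by rewrite !scalerA mulrC.
  by rewrite subnAC.
rewrite !scalerA -scalerDl; congr (_ *: _).
(* The weight a+1 comes from [sigma] absorbing the cycle, the weight n-a-1 from the induction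
   hypothesis. *)
rewrite -{1}(subnKC an) natrD mulrDl; congr (_ + _); last by rewrite mulrC.
by rewrite mulrCA mulrA.
Qed.

(** The unit of the induction product; applying [newton_cre] to it gives the identity for the family
    [F] alone. *)
Definition vac n : classFun C (Gn n) := if n == 0%N then cf_one C (Gn n) else 0.

Lemma cre_comp_vac (H : fam) n k : cre_comp (H n) vac k = if k == n then H k else 0.
Proof.
apply: classfunP => z; rewrite cre_compE.
have vE (S : {set 'I_k}) : resv vac z (~: S) = (S == setT)%:R.
  rewrite /resv /vac cards_eq0 -{1}setCT (inj_eq (@setC_inj _)).
  by case: eqP => _; rewrite ?cf0E ?mkcfE.
case: eqVneq => [<-|kn].
  rewrite (bigD1 setT) /=; last first.
    by rewrite cardsT card_ord eqxx andbT; apply/stableP => i; rewrite !inE.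
  rewrite vE eqxx mulr1 resvT big1 ?addr0 // => S /andP[_ /negPf ST].
  by rewrite vE ST mulr0.
rewrite cf0E big1 // => S /andP[_ /eqP Sn]; rewrite vE; case: eqP => [ST|]; last by rewrite mulr0.
by move: Sn; rewrite ST cardsT card_ord => Sn; rewrite Sn eqxx in kn.
Qed.

Lemma eq_cre_comp_at n (phi : Gn n -> C) (H H' : fam) k :
  H (k - n)%N = H' (k - n)%N -> cre_comp phi H k = cre_comp phi H' k.
Proof. by rewrite /cre_comp; case: eqP => // e ->. Qed.

Lemma newton n : n%:R *: F n = \sum_(l < n) c l *: cre_comp (@sigma C G l f) F n.
Proof.
have := newton_cre vac n n; rewrite cre_comp_vac eqxx => ->.
apply: eq_bigr => l _; congr (_ *: _); apply: eq_cre_comp_at.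
by rewrite cre_comp_vac eqxx.
Qed.

Lemma cre_sigf l (H : fam) k : cre_comp (@sigma C G l f) H k = cre_comp (sigf f l.+1) H k.
Proof. by apply: eq_cre_comp => // y; rewrite mkcfE. Qed.

Lemma newton_ann A n m : n%:R *: annf (F n) A m =
  \sum_(l < n) c l *: annf (F (n - l.+1)%N) (annf (@sigma C G l f) A) m.
Proof.
transitivity (annf (n%:R *: F n) A m).
  rewrite !annfE scaler_sumr; apply: eq_bigr => x _; rewrite cfZE scalerA.
  by rewrite mulrCA.
rewrite newton annfE.
transitivity (\sum_(l < n) c l *: annf (cre_comp (@sigma C G l f) F n) A m).
  under [RHS]eq_bigr do rewrite annfE scaler_sumr.
  rewrite exchange_big; apply: eq_bigr => x _; rewrite cf_sumE mulr_sumr scaler_suml.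
  by apply: eq_bigr => l _; rewrite cfZE scalerA mulrCA.
apply: eq_bigr => l _; congr (_ *: _).
rewrite (eq_annf (psi := cre_comp (sigf f l.+1) F n) (B := A)) => [|x|//]; last by rewrite cre_sigf.
rewrite annf_cre ?ltn_ord //; apply: eq_annf => // k.
by apply: eq_annf => // x; rewrite mkcfE.
Qed.

End Newton.

Lemma mult_one : mult (fun n => cf_one C (Gn n)) (fun a x => 1 * ucyc (cf_one C G) x).
Proof.
split=> [|a x xc m]; first by rewrite mkcfE.
by apply: classfunP => y; rewrite dxE cfZE /ucyc !mkcfE !mulr1.
Qed.

Lemma annf_one n (phi : Gn n -> C) m :
  annf phi (fun k => cf_one C (Gn k)) m =
  (#|{: Gn n}|%:R^-1 * \sum_x phi x) *: cf_one C (Gn m).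
Proof.
rewrite annfE mulr_sumr scaler_suml; apply: eq_bigr => x _; congr (_ *: _).
by apply: classfunP => y; rewrite dxE !mkcfE.
Qed.

(** Equivalent to the proportion of (n+1)-cycles being 1/(n+1). Pairing Newton's identities for the
    constant family 1 with that family writes k as the sum of the first k averages, so each average
    is 1. *)
Lemma avg_sigma_one n :
  #|{: Gn n.+1}|%:R^-1 * \sum_x @sigma C G n (cf_one C G) x = 1.
Proof.
pose K l := #|{: Gn l.+1}|%:R^-1 * \sum_x @sigma C G l (cf_one C G) x.
have KE k : k%:R = \sum_(l < k) K l.
  have := congr1 (fun h : classFun C (Gn 0) => h 1%g)
    (newton_ann (c := fun=> 1) mult_one (fun k => cf_one C (Gn k)) k 0).
  have one1 j : #|{: Gn j}|%:R^-1 * \sum_x cf_one C (Gn j) x = 1.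
    under eq_bigr do rewrite mkcfE.
    by rewrite sumr_const -[1 *+ _]/(_%:R) mulVf // natr_card_neq0.
  rewrite annf_one one1 scale1r cfZE mkcfE mulr1 cf_sumE => ->.
  apply: eq_bigr => l _; rewrite cfZE mul1r.
  rewrite (_ : annf (@sigma C G l _) _ = fun m => K l *: cf_one C (Gn m)); last first.
    by apply: functional_extensionality_dep => m; rewrite annf_one.
  rewrite annfE cf_sumE; under eq_bigr do rewrite cfZE dxE cfZE !mkcfE !mulr1.
  rewrite -mulr_suml sumr_const -[_ *+ _]mulr_natl divff ?mul1r //.
  exact: natr_card_neq0.
change (K n = 1); have := KE n.+1.
by rewrite big_ord_recr /= -KE -natr1 => /addrI.
Qed.

(** Multiplying the base entry at [ord0] by a uniform [t] keeps the permutation and makes the cycle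
    product uniform in G; the proportion of cycles is then [avg_sigma_one]. *)
Lemma avg_sigma n (f : classFun C G) :
  #|{: Gn n.+1}|%:R^-1 * \sum_x @sigma C G n f x = #|G|%:R^-1 * \sum_g f g.
Proof.
pose u t : Gn n.+1 := Wreath [ffun i => if i == ord0 then t else 1%g] 1%g.
have uc t x : wcyc (u t * x)%g = wcyc x by rewrite /wcyc wpermM mulg1.
have uE x : wcyc x -> exists p, forall t, cycle_prod (u t * x)%g ord0 = (p * t * wbase x ord0)%g.
  move=> xc; pose p := (\prod_(k < n) wbase x ((wperm x ^+ (n - k))%g ord0))%g.
  exists p => t; rewrite /cycle_prod big_ord_recr -mulgA; congr (_ * _)%g; last first.
    have -> : nat_of_ord (rev_ord (@ord_max n)) = 0%N by rewrite /= subnn.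
    by rewrite expg0 perm1 wbaseM ffunE eqxx invg1 perm1.
  apply: eq_bigr => k _.
  have -> : nat_of_ord (rev_ord (widen_ord (leqnSn n) k)) = (n - k)%N by rewrite /= subSS.
  rewrite wpermM mulg1 wbaseM ffunE invg1 perm1.
  (* The powers 1 to n of the cycle never return to [ord0], so [t] enters through the last factor
     only. *)
  case: eqP => [s0|_]; last by rewrite mul1g.
  have nk : (0 < n - k)%N by rewrite subn_gt0.
  have uT : uniq (traject (wperm x) ord0 n.+1).
    have := uniq_traject_porbit (wperm x) ord0; rewrite (_ : porbit _ ord0 = setT) ?cardsT ?card_ord //.
    apply/setP => j; rewrite inE; have [l ->] := wcyc_porbit ord0 j xc.
    by rewrite -permX mem_porbit.
  have nkn : (n - k < n.+1)%N by rewrite ltnS leq_subr.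
  move: s0; rewrite permX -(nth_traject _ nkn) => /eqP.
  rewrite -[X in _ == X](nth_traject (wperm x) (ltn0Sn n)) nth_uniq ?size_traject //.
  by move/eqP => nk0; rewrite nk0 in nk.
have g0 : #|G|%:R != 0 :> C by exact: natr_card_neq0.
apply: (mulfI g0); rewrite mulVKf // mulrCA.
rewrite -[RHS]mul1r -[X in _ = X * _](avg_sigma_one n) -[RHS]mulrA; congr (_ * _).
transitivity (\sum_t \sum_x @sigma C G n f (u t * x)%g).
  rewrite mulr_natl -sumr_const; apply: eq_bigr => t _.
  by rewrite [LHS](reindex_inj (mulgI (u t))).
rewrite exchange_big mulr_suml; apply: eq_bigr => x _.
rewrite sigmaE; under eq_bigr do rewrite sigmaE uc.
case: ifP => [/uE [p pE]|_]; last by rewrite big1 ?mul0r.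
rewrite /ucyc mkcfE mulr1 mulr_sumr.
under eq_bigr => t _ do rewrite pE.
rewrite [RHS](reindex_inj (mulgI p)) [RHS](reindex_inj (mulIg (wbase x ord0))) /=.
by apply: eq_bigr => t _; rewrite mulgA.
Qed.

End Annihilators.

(** * Vertex operators over a Heisenberg algebra *)

Section Convolution.
Variables (C : numFieldType) (V : lmodType C).
Variables (a : nat -> {linear V -> V}) (A B : nat -> {linear V -> V}).
Hypothesis A0 : forall v, A 0%N v = v.
Hypothesis B0 : forall v, B 0%N v = v.
Hypothesis aA : forall l n v, a l (A n v) = A n (a l v).
Hypothesis newtonA : forall n v, n%:R *: A n v = \sum_(l < n) a l (A (n - l.+1)%N v).
Hypothesis newtonB : forall n v, n%:R *: B n v = - \sum_(l < n) a l (B (n - l.+1)%N v).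

Lemma triangle_sum (W : zmodType) n (f : nat -> nat -> W) :
  \sum_(p < n.+1) \sum_(l < p) f l (p - l.+1)%N = \sum_(l < n) \sum_(p < (n - l.+1).+1) f l p.
Proof.
elim: n => [|n IH]; first by rewrite big_ord_recl !big_ord0 addr0.
rewrite big_ord_recr /= IH.
transitivity (\sum_(l < n) (\sum_(p < (n - l.+1).+1) f l p + f l (n.+1 - l.+1)%N) + f n 0%N).
  by rewrite big_ord_recr big_split addrA subnn.
rewrite [RHS]big_ord_recr subnn big_ord1; congr (_ + _).
apply: eq_bigr => l _; have -> : (n.+1 - l.+1 = (n - l.+1).+1)%N by have := ltn_ord l; lia.
by rewrite [RHS]big_ord_recr.
Qed.

Lemma conv_shift n v :
  \sum_(p < n.+1) p%:R *: A p (B (n - p)%N v) =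
  \sum_(l < n) a l (\sum_(p < (n - l.+1).+1) A p (B (n - l.+1 - p)%N v)).
Proof.
under eq_bigr do rewrite newtonA.
have t := triangle_sum n (fun l p => a l (A p (B (n - l.+1 - p)%N v))).
under [RHS]eq_bigr do rewrite linear_sum; rewrite -t.
apply: eq_bigr => p _; apply: eq_bigr => l _.
by congr (a l (A _ (B _ v))); have := ltn_ord p; have := ltn_ord l; lia.
Qed.

(** The recursions say that A(z) and B(z) are exponentials of opposite series, so A(z)B(z) = 1.
    After multiplication by n = p + (n - p), the two Newton sums cancel. *)
Lemma conv_eq n v : \sum_(p < n.+1) A p (B (n - p)%N v) = if n == 0%N then v else 0.
Proof.
have [K] := ubnP n; elim: K => // K IH in n *; rewrite ltnS => nK.
case: n nK => [|n] nK; first by rewrite big_ord_recl big_ord0 addr0 A0 B0.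
apply: (@scalerI _ _ n.+1%:R); first by rewrite pnatr_eq0.
rewrite scaler0 scaler_sumr.
transitivity (\sum_(p < n.+2) p%:R *: A p (B (n.+1 - p)%N v) +
              \sum_(p < n.+2) A p ((n.+1 - p)%:R *: B (n.+1 - p)%N v)).
  rewrite -big_split; apply: eq_bigr => p _; rewrite linearZ /= -scalerDl -natrD subnKC //.
  by rewrite -ltnS ltn_ord.
rewrite conv_shift.
have -> : \sum_(p < n.+2) A p ((n.+1 - p)%:R *: B (n.+1 - p)%N v) =
  - \sum_(p < n.+2) \sum_(l < n.+1 - p) a l (A p (B (n.+1 - p - l.+1)%N v)).
  rewrite -sumrN; apply: eq_bigr => p _; rewrite newtonB linearN linear_sum; congr (- _).
  by apply: eq_bigr => l _; rewrite aA.
rewrite [X in _ - X](reindex_inj rev_ord_inj) /=.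
have -> : \sum_(j < n.+2) \sum_(l < n.+1 - (n.+2 - j.+1)) a l
     (A (n.+2 - j.+1)%N (B (n.+1 - (n.+2 - j.+1) - l.+1)%N v)) =
  \sum_(j < n.+2) \sum_(l < j) (fun l p => a l (A (n.+1 - l.+1 - p)%N (B p v))) l (j - l.+1)%N.
  apply: eq_bigr => j _; have jn := ltn_ord j.
  have -> : (n.+1 - (n.+2 - j.+1) = j)%N by lia.
  apply: eq_bigr => l _; have lj := ltn_ord l.
  by congr (a l (A _ _)); lia.
rewrite (triangle_sum n.+1 (fun l p => a l (A (n.+1 - l.+1 - p)%N (B p v)))).
rewrite -sumrB big1 // => l _.
rewrite linear_sum [X in _ - X](reindex_inj rev_ord_inj) /= -sumrB big1 // => p _.
have pl := ltn_ord p; have ln := ltn_ord l; apply/eqP; rewrite subr_eq0; apply/eqP.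
by congr (a l (A _ (B _ _))); lia.
Qed.

(** The logarithmic derivative: z A'(z) B(z) is the series of the [a l]. *)
Lemma conv_weight n v : \sum_(p < n.+1) p%:R *: A p (B (n - p)%N v) =
  if n is m.+1 then a m v else 0.
Proof.
rewrite conv_shift; case: n => [|n]; first by rewrite big_ord0.
rewrite big_ord_recr /= subnn conv_eq big1 ?add0r // => l _.
by rewrite conv_eq ifF ?linear0 //; have := ltn_ord l; lia.
Qed.

End Convolution.

Lemma sum_drop (W : nmodType) (g : nat -> W) t n :
  (t <= n)%N -> (forall k, (k < t)%N -> g k = 0) -> \sum_(k < n) g k = \sum_(k < n - t) g (t + k)%N.
Proof.
move=> tn g0; rewrite -!(big_mkord xpredT) (@big_cat_nat _ _ _ t) //=.
rewrite big_nat_cond big1 ?add0r => [|k /andP[/andP[_ /g0 ->]] //].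
rewrite -{1}[t]add0n big_addn big_mkord.
by apply: eq_bigr => k _; rewrite addnC.
Qed.

Lemma triangle_exchange (W : zmodType) n (f : nat -> nat -> W) :
  \sum_(l < n) \sum_(p < n - l) f l p = \sum_(l < n) \sum_(p < n - l) f p l.
Proof.
have E (g : nat -> nat -> W) : \sum_(l < n) \sum_(p < n - l) g l p =
    \sum_(p < n.+1) \sum_(l < p) g l (p - l.+1)%N.
  rewrite triangle_sum; apply: eq_bigr => l _.
  by have -> : ((n - l.+1).+1 = n - l)%N by have := ltn_ord l; lia.
rewrite E (E (fun l p => f p l)); apply: eq_bigr => p _.
rewrite (reindex_inj rev_ord_inj); apply: eq_bigr => l _ /=.
by congr f; have := ltn_ord l; lia.
Qed.

Section Kappa.
Variables (C : numFieldType) (c : int) (k : nat -> C).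
(* The coefficients of [(1 - t)^c]. *)
Definition is_binom := k 0%N = 1 /\ forall i, i.+1%:R * k i.+1 = (i%:R - c%:~R) * k i.

(** The coefficient form of t K' = -c t/(1-t) K, which is the shape in which the binomial meets
    Newton's recursion. *)
Lemma binom_partial : is_binom -> forall i, i%:R * k i = - c%:~R * \sum_(j < i) k j.
Proof.
move=> [k0 kS]; elim=> [|i IH]; first by rewrite big_ord0 mul0r mulr0.
by rewrite kS big_ord_recr /= mulrDr -IH mulrBl mulNr.
Qed.
End Kappa.

Lemma binom_nat (C : numFieldType) (l : nat) : is_binom l (fun i => (-1) ^+ i * 'C(l, i)%:R : C).
Proof.
split=> [|i]; first by rewrite bin0 mulr1.
rewrite mulrCA -natrM mul_bin_left.
rewrite natrM -pmulrn; have [il|li] := leqP i l.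
  by rewrite natrB // exprS; ring.
by rewrite bin_small // !mulr0.
Qed.

Lemma binom_neg2 (C : numFieldType) : is_binom (- 2) (fun i => i.+1%:R : C).
Proof. by split=> [|i] //; rewrite -!natr1; ring. Qed.

(** * Normal ordering and products of two vertex operators *)

Section VertexOperators.
Variables (C : numFieldType) (V : lmodType C) (I : Type).
(* [H i p] stands for H_{-p}, [e i q] for (-1)^q E_q, and [am i l], [ap i l]    *)
(* for a_{-(l+1)}, a_{l+1}; [dlt D] says that the degree is less than [D].      *)
Variables (H e am ap : I -> nat -> {linear V -> V}) (c : I -> I -> int).
Variables (dlt : nat -> V -> Prop) (dbound : V -> nat).
Hypothesis H0 : forall i v, H i 0 v = v.
Hypothesis e0 : forall i v, e i 0 v = v.
Hypothesis HC : forall i j p q v, H i p (H j q v) = H j q (H i p v).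
Hypothesis eC : forall i j p q v, e i p (e j q v) = e j q (e i p v).
Hypothesis amH : forall i j l p v, am i l (H j p v) = H j p (am i l v).
Hypothesis ape : forall i j l p v, ap i l (e j p v) = e j p (ap i l v).
Hypothesis newtonH : forall i n v, n%:R *: H i n v = \sum_(l < n) am i l (H i (n - l.+1)%N v).
Hypothesis newtonE : forall i n v, n%:R *: e i n v = - \sum_(l < n) e i (n - l.+1)%N (ap i l v).
Hypothesis apH : forall i j l p v, ap i l (H j p v) =
  H j p (ap i l v) + (if (l < p)%N then (c i j)%:~R *: H j (p - l.+1)%N v else 0).
Hypothesis apam : forall i j l m v, ap i l (am j m v) =
  am j m (ap i l v) + (if l == m then (m.+1%:R * (c i j)%:~R) *: v else 0).
Hypothesis cC : forall i j, c i j = c j i.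
Hypothesis dltP : forall v, dlt (dbound v) v.
Hypothesis dlt_le : forall D D' v, (D <= D')%N -> dlt D v -> dlt D' v.
Hypothesis dlt0 : forall v, dlt 0 v -> v = 0.
Hypothesis dlt_zero : forall D, dlt D 0.
Hypothesis dltD : forall D v w, dlt D v -> dlt D w -> dlt D (v + w).
Hypothesis dltZ : forall D a v, dlt D v -> dlt D (a *: v).
Hypothesis dlt_H : forall D i p v, dlt D v -> dlt (D + p) (H i p v).
Hypothesis dlt_e : forall D i q v, dlt D v -> dlt (D - q) (e i q v).
Hypothesis dlt_ap : forall D i q v, dlt D v -> dlt D (ap i q v).
Hypothesis dlt_am : forall D i q v, dlt D v -> dlt (D + q.+1) (am i q v).

(** Extension by zero to negative indices removes the side conditions from index shifts. *)
Definition Hz i (p : int) : {linear V -> V} :=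
  if p is Posz n then H i n else @GRing.null_fun V V.

Lemma Hz_neg i p v : p < 0 -> Hz i p v = 0. Proof. by case: p. Qed.

Lemma apHz i j l p v :
  ap i l (Hz j p v) = Hz j p (ap i l v) + (c i j)%:~R *: Hz j (p - l.+1%:Z) v.
Proof.
case: p => p; last by rewrite linear0 !Hz_neg ?scaler0 ?addr0 //; lia.
rewrite apH; congr (_ + _); case: ltnP => lp.
  by have -> : Posz p - l.+1%:Z = (p - l.+1)%N by lia.
by rewrite Hz_neg ?scaler0 //; lia.
Qed.

Lemma amHz i j l p v : am i l (Hz j p v) = Hz j p (am i l v).
Proof. by case: p => p /=; rewrite ?linear0 ?amH. Qed.

Lemma HzC i j p q v : Hz i p (Hz j q v) = Hz j q (Hz i p v).
Proof.
case: p => [p|p]; case: q => [q|q].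
- exact: HC.
- exact: (linear0 (H i p)).
- exact/esym/(linear0 (H j q)).
- by [].
Qed.

(** Induction on [q]: Newton's identity expresses [e] through the [ap], whose commutators with [am]
    are scalars. The weights l+1 and q-l-1 then add up to q. *)
Lemma am_e i j l q v : am j l (e i q v) = e i q (am j l v) +
  (if (l < q)%N then (c i j)%:~R *: e i (q - l.+1)%N v else 0).
Proof.
have [K] := ubnP q; elim: K => // K IH in q v *; rewrite ltnS => qK.
case: q qK => [|q] qK; first by rewrite !e0 addr0.
apply: (@scalerI _ _ q.+1%:R); first by rewrite pnatr_eq0.
rewrite -linearZ newtonE linearN linear_sum scalerDr newtonE -sumrN -[in RHS]sumrN.
have -> : \sum_(i0 < q.+1) - am j l (e i (q.+1 - i0.+1)%N (ap i i0 v)) =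
  \sum_(k < q.+1) (- e i (q.+1 - k.+1)%N (ap i k (am j l v))
    + ((if k == l :> nat then (l.+1%:R * (c i j)%:~R) *: e i (q.+1 - k.+1)%N v else 0)
    - (if (l < q.+1 - k.+1)%N then (c i j)%:~R *: e i (q.+1 - k.+1 - l.+1)%N (ap i k v) else 0))).
  apply: eq_bigr => k _; rewrite IH; last by have := ltn_ord k; lia.
  have -> : am j l (ap i k v) = ap i k (am j l v)
      - (if k == l :> nat then (l.+1%:R * (c i j)%:~R) *: v else 0).
    by rewrite apam addrK.
  rewrite linearB (fun_if (e i (q.+1 - k.+1)%N)) linear0 linearZ /=.
  by rewrite opprD opprB addrA [X in X - _]addrC.
rewrite big_split; congr (_ + _) => /=; rewrite sumrB.
case: (ltnP l q.+1) => lq; last first.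
  rewrite scaler0 !big1 ?subr0 // => k _.
    by rewrite ifF //; have := ltn_ord k; lia.
  by rewrite ifF //; have := ltn_ord k; lia.
rewrite (bigD1 (Ordinal lq)) //= eqxx big1 ?addr0 => [|k kl]; last first.
  by rewrite -(inj_eq val_inj) /= in kl; rewrite (negPf kl).
have -> : \sum_(k < q.+1) (if (l < q.+1 - k.+1)%N then (c i j)%:~R *: e i (q.+1 - k.+1 - l.+1)%N (ap i k v) else 0)
  = - ((c i j)%:~R *: ((q.+1 - l.+1)%:R *: e i (q.+1 - l.+1)%N v)).
  rewrite newtonE scalerN opprK scaler_sumr.
  rewrite (@sum_trunc _ (fun k => if (l < q.+1 - k.+1)%N then (c i j)%:~R *: e i (q.+1 - k.+1 - l.+1)%N (ap i k v) else 0) (q.+1 - l.+1)) ?leq_subr // => [|k kq]; last by rewrite ifF //; lia.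
  apply: eq_bigr => k _; rewrite ifT; last by have := ltn_ord k; lia.
  by rewrite subnAC.
rewrite opprK !scalerA -scalerDl; congr (_ *: _).
rewrite mulrC -mulrDr mulrC -natrD; congr (_%:R * _); lia.
Qed.

Lemma e_gt D i q v : dlt D v -> (D <= q)%N -> e i q v = 0.
Proof. by move=> Dv Dq; apply: dlt0; have := dlt_e i q Dv; rewrite (eqP Dq). Qed.

(** The coefficients of E_-(i, w) H_+(j, z) = (1 - z/w)^c H_+(j, z) E_-(i, w). Induction on [q]
    through Newton's identity for [e]. *)
Lemma e_Hz i j (k : nat -> C) q p v : is_binom (c i j) k ->
  e i q (Hz j p v) = \sum_(t < q.+1) k t *: Hz j (p - t%:Z) (e i (q - t)%N v).
Proof.
move=> kb; have [k0 _] := kb; have kP := binom_partial kb.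
have [K] := ubnP q; elim: K => // K IH in q p v *; rewrite ltnS => qK.
case: q qK => [|q] qK; first by rewrite big_ord1 k0 scale1r subr0 !e0.
apply: (@scalerI _ _ q.+1%:R); first by rewrite pnatr_eq0.
rewrite newtonE.
transitivity (- \sum_(l < q.+1) (\sum_(t < q.+1 - l) k t *: Hz j (p - t%:Z) (e i (q - l - t)%N (ap i l v))
   + (c i j)%:~R *: \sum_(t < (q.+1 - l.+1).+1) k t *: Hz j (p - (l + t).+1%:Z) (e i (q.+1 - (l + t).+1)%N v))).
  congr (- _); apply: eq_bigr => l _; have lq := ltn_ord l.
  rewrite apHz linearD linearZ /= !IH; try lia.
  have E : ((q.+1 - l.+1).+1 = q.+1 - l)%N by lia.
  rewrite -E; congr (_ + _ *: _); apply: eq_bigr => t _; first by congr (_ *: Hz _ _ (e i _ _)); lia.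
rewrite big_split opprD /=.
rewrite (triangle_exchange _ (fun l t => k t *: Hz j (p - t%:Z) (e i (q - l - t)%N (ap i l v)))).
rewrite -scaler_sumr -(triangle_sum _ (fun l t => k t *: Hz j (p - (l + t).+1%:Z) (e i (q.+1 - (l + t).+1)%N v))).
(* Splitting the factor q+1 as (q+1-t) + t separates Newton's identity for [e] from the recursion of
   the binomial. *)
rewrite scaler_sumr; transitivity (\sum_(t < q.+2) ((q.+1 - t)%:R * k t + t%:R * k t) *: Hz j (p - t%:Z) (e i (q.+1 - t)%N v)); last first.
  rewrite [RHS]scaler_sumr; apply: eq_bigr => t _; rewrite scalerA -mulrDl -natrD subnK //; exact: leq_ord.
under [RHS]eq_bigr do rewrite scalerDl.
rewrite big_split /=; congr (_ + _).
  rewrite [RHS]big_ord_recr /= subnn mul0r scale0r addr0 -sumrN.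
  apply: eq_bigr => t _; have tq := ltn_ord t.
  have -> : ((q.+1 - t)%:R * k t) *: Hz j (p - t%:Z) (e i (q.+1 - t)%N v) =
      k t *: Hz j (p - t%:Z) ((q.+1 - t)%:R *: e i (q.+1 - t)%N v).
    by rewrite linearZ scalerA mulrC.
  rewrite newtonE [in RHS]linearN scalerN; congr (- _); rewrite linear_sum scaler_sumr.
  by apply: eq_bigr => l _; congr (_ *: Hz _ _ (e i _ _)); lia.
rewrite -sumrN; apply: eq_bigr => t _.
rewrite kP mulNr scaleNr -scalerA scaler_suml (reindex_inj rev_ord_inj) /=; congr (- (_ *: _)).
apply: eq_bigr => l _; have lt := ltn_ord l.
have -> : (t - l.+1 + (t - (t - l.+1).+1)).+1 = t :> nat by lia.
by congr (k _ *: _); lia.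
Qed.

(* [Wd D i N] is the coefficient of z^N in H_+(i, z) E_-(i, z) on vectors of    *)
(* degree less than [D].                                                        *)
Definition Wd D i (N : int) v := \sum_(q < D) Hz i (N + q%:Z) (e i q v).

Lemma Wd_stable D D' i N v : dlt D v -> (D <= D')%N -> Wd D' i N v = Wd D i N v.
Proof.
move=> Dv DD; rewrite /Wd (@sum_trunc _ (fun q => Hz i (N + q%:Z) (e i q v)) D) // => q Dq.
by rewrite (e_gt i Dv Dq) linear0.
Qed.

Lemma Wd_linear D i N : linear (Wd D i N).
Proof.
move=> b u v; rewrite /Wd scaler_sumr -big_split; apply: eq_bigr => q _.
by rewrite !linearP.
Qed.

(** The truncation depends on [v]; [WE] shows that any valid bound gives the same value, and
    linearity rests on that. *)
Definition W i N v := Wd (dbound v) i N v.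

Lemma WE D i N v : dlt D v -> W i N v = Wd D i N v.
Proof.
move=> Dv; rewrite /W -(Wd_stable i N Dv (leq_maxl D (dbound v))).
by rewrite (Wd_stable i N (dltP v) (leq_maxr D (dbound v))).
Qed.

Lemma W_linear i N : linear (W i N).
Proof.
move=> b u v; pose D := maxn (dbound u) (dbound v).
have Du : dlt D u by apply: dlt_le (dltP u); exact: leq_maxl.
have Dv : dlt D v by apply: dlt_le (dltP v); exact: leq_maxr.
have Dbv : dlt D (b *: u + v) by apply: dltD => //; exact: dltZ.
by rewrite (WE _ _ Du) (WE _ _ Dv) (WE _ _ Dbv) Wd_linear.
Qed.

Lemma ap_W i j l N v :
  ap i l (W j N v) = W j N (ap i l v) + (c i j)%:~R *: W j (N - l.+1%:Z) v.
Proof.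
have Dv := dltP v; set D := dbound v in Dv.
rewrite (WE _ _ Dv) (WE _ _ (dlt_ap i l Dv)) (WE _ _ Dv) /Wd scaler_sumr linear_sum -big_split.
apply: eq_bigr => q _; rewrite apHz ape; congr (_ + _ *: Hz _ _ _); lia.
Qed.

Lemma am_W i j l N v :
  am i l (W j N v) = W j N (am i l v) + (c i j)%:~R *: W j (N + l.+1%:Z) v.
Proof.
have Dv := dltP v; set D := dbound v in Dv.
have Dv' : dlt (D + l.+1) v by apply: dlt_le Dv; exact: leq_addr.
rewrite (WE _ _ Dv') (WE _ _ (dlt_am i l Dv)) (WE _ _ Dv) /Wd scaler_sumr linear_sum.
transitivity (\sum_(q < D + l.+1) (Hz j (N + q%:Z) (e j q (am i l v)) +
   Hz j (N + q%:Z) (if (l < q)%N then (c i j)%:~R *: e j (q - l.+1)%N v else 0))).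
  by apply: eq_bigr => q _; rewrite amHz am_e linearD cC.
rewrite big_split /=; congr (_ + _).
rewrite addnC big_split_ord /= big1 ?add0r => [|q _]; last first.
  by rewrite ifF ?linear0 //; have := ltn_ord q; lia.
apply: eq_bigr => q _; rewrite ifT; last by lia.
rewrite linearZ /= addKn; congr (_ *: Hz _ _ _); lia.
Qed.

Lemma dlt_sum D n (f : 'I_n -> V) : (forall k, dlt D (f k)) -> dlt D (\sum_k f k).
Proof.
move=> fD; apply: (big_ind (dlt D)) => //; last by move=> x y; exact: dltD.
Qed.

(** The coefficient of z^N w^M in the normally ordered product of the operators of [i] and [j], on
    vectors of degree less than [D]; it is symmetric by [T2C]. *)
Definition T2 D i j N M v :=
  \sum_(r < D) \sum_(q < D) Hz i (N + r%:Z) (Hz j (M + q%:Z) (e i r (e j q v))).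

Lemma T2C D i j N M v : T2 D i j N M v = T2 D j i M N v.
Proof.
rewrite /T2 exchange_big; apply: eq_bigr => r _; apply: eq_bigr => q _.
by rewrite HzC eC.
Qed.

Lemma T2_lt1 D i j N M v : N + D%:Z <= 0 -> T2 D i j N M v = 0.
Proof.
by move=> ND; rewrite /T2 big1 // => r _; rewrite big1 // => q _; rewrite Hz_neg //;
  have := ltn_ord r; lia.
Qed.

Lemma T2_lt2 D i j N M v : M + D%:Z <= 0 -> T2 D i j N M v = 0.
Proof. by move=> MD; rewrite T2C T2_lt1. Qed.

Lemma dlt_W D i N v : dlt D v -> dlt (D + `|N|%N) (W i N v).
Proof.
move=> Dv; rewrite (WE _ _ Dv) /Wd; apply: dlt_sum => q.
have qD := ltn_ord q; case E : (N + q%:Z) => [p|p] /=.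
  apply: dlt_le (dlt_H i p (dlt_e i q Dv)); lia.
exact: dlt_zero.
Qed.

(** Normal ordering by [e_Hz]: the factor (1 - w/z)^c moves [t] units of exponent from w to z.
    Beyond [T] the exponent of w is too small to contribute. *)
Lemma WW D i j (k : nat -> C) N M v T : is_binom (c i j) k -> dlt D v -> (M + D%:Z <= T%:Z) ->
  W i N (W j M v) = \sum_(t < T) k t *: T2 D i j (N + t%:Z) (M - t%:Z) v.
Proof.
(* D + |M| bounds the degree of the inner vector; the rest leaves room for every shift by [t] below
   [T]. *)
move=> kb Dv DT; pose D' := (D + `|M| + T + D)%N.
have D'v : dlt D' (W j M v) by apply: dlt_le (dlt_W j M Dv); rewrite /D'; lia.
rewrite (WE _ _ D'v) (WE _ _ Dv) /Wd.
transitivity (\sum_(q1 < D') \sum_(q < D) \sum_(t < D') k t *: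
   Hz i (N + q1%:Z) (Hz j (M + q%:Z - t%:Z) (if (t <= q1)%N then e i (q1 - t) (e j q v) else 0))).
  apply: eq_bigr => q1 _; rewrite !linear_sum; apply: eq_bigr => q _.
  rewrite (e_Hz _ _ _ kb) linear_sum /=.
  rewrite (@sum_trunc _ (fun t => k t *: Hz i (N + q1%:Z) (Hz j (M + q%:Z - t%:Z)
    (if (t <= q1)%N then e i (q1 - t) (e j q v) else 0))) q1.+1) // => [|t tq].
    by apply: eq_bigr => t _; rewrite -ltnS ltn_ord linearZ.
  by rewrite leqNgt tq /= !linear0.
under eq_bigr do rewrite exchange_big; rewrite exchange_big /=.
transitivity (\sum_(t < D') k t *: T2 D i j (N + t%:Z) (M - t%:Z) v).
  apply: eq_bigr => t _; have [MD|MD] := lerP (M - t%:Z + D%:Z) 0.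
    rewrite T2_lt2 // scaler0 big1 // => q1 _; rewrite big1 // => q _.
    by rewrite [Hz j _ _]Hz_neg ?linear0 ?scaler0 //; have := ltn_ord q; lia.
  rewrite /T2 scaler_sumr; under [RHS]eq_bigr do rewrite scaler_sumr.
  have tD := ltn_ord t.
  rewrite (@sum_drop _ (fun q1 => \sum_(q < D) k t *: Hz i (N + q1%:Z) (Hz j (M + q%:Z - t%:Z)
    (if (t <= q1)%N then e i (q1 - t) (e j q v) else 0))) t) ?(ltnW tD) // => [|q1 q1t]; last first.
    by rewrite big1 // => q _; rewrite leqNgt q1t /= !linear0.
  rewrite (@sum_trunc _ (fun r => \sum_(q < D) k t *: Hz i (N + (t + r)%:Z) (Hz j (M + q%:Z - t%:Z)
    (if (t <= t + r)%N then e i (t + r - t) (e j q v) else 0))) D) => [||r Dr].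
  - apply: eq_bigr => r _; apply: eq_bigr => q _; rewrite leq_addr addKn; congr (_ *: Hz _ _ (Hz _ _ _)); lia.
  - by move: MD; rewrite /D' in tD *; lia.
  - rewrite big1 // => q _; rewrite leq_addr addKn (e_gt i (dlt_e j q Dv)) ?linear0 //.
    by apply: leq_trans Dr; exact: leq_subr.
apply: (@sum_trunc _ (fun t => k t *: T2 D i j (N + t%:Z) (M - t%:Z) v)) => [|t Tt].
  by rewrite /D'; lia.
by rewrite T2_lt2 ?scaler0 //; lia.
Qed.

(** With c = l the factor is a polynomial with l+1 terms, and (z - w)^l = (-1)^l (w - z)^l:
    reversing the sum exchanges the two operators. *)
Lemma WW_ge0 i j (l : nat) N M v : c i j = l ->
  W i (N - l%:Z) (W j M v) = (-1) ^+ l *: W j (M - l%:Z) (W i N v).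
Proof.
move=> cl; have kb : is_binom (c i j) (fun t => (-1) ^+ t * 'C(l, t)%:R : C).
  by rewrite cl; exact: binom_nat.
have kb' : is_binom (c j i) (fun t => (-1) ^+ t * 'C(l, t)%:R : C) by rewrite cC.
have Dv := dltP v; set D := dbound v in Dv; pose T := (l.+1 + `|M| + `|N| + D)%N.
rewrite (@WW D _ _ _ _ _ _ T kb) // /T; last lia.
rewrite (@WW D _ _ _ _ _ _ T kb') // /T; last lia.
rewrite (@sum_trunc _ (fun t => ((-1) ^+ t * 'C(l, t)%:R) *: T2 D i j (N - l%:Z + t%:Z) (M - t%:Z) v) l.+1) //;
  [|lia|by move=> t tl; rewrite bin_small // mulr0 scale0r].
rewrite (@sum_trunc _ (fun t => ((-1) ^+ t * 'C(l, t)%:R) *: T2 D j i (M - l%:Z + t%:Z) (N - t%:Z) v) l.+1) //;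
  [|lia|by move=> t tl; rewrite bin_small // mulr0 scale0r].
rewrite [RHS]scaler_sumr (reindex_inj rev_ord_inj) /=; apply: eq_bigr => t _.
have tl : (t <= l)%N by rewrite -ltnS.
rewrite scalerA subSS bin_sub // mulrA -exprD T2C; congr (_ *: _).
  congr (_ * _); rewrite -signr_odd -[RHS]signr_odd oddD oddB //; congr (_ ^+ nat_of_bool _).
by congr (T2 _ _ _ _ _ _); lia.
Qed.

Lemma sum_int_shift (f : int -> V) (a a' : int) (n n' : nat) :
    a' <= a -> a + n%:Z <= a' + n'%:Z ->
    (forall x : int, x < a -> f x = 0) -> (forall x : int, a + n%:Z <= x -> f x = 0) ->
  \sum_(x < n') f (a' + x%:Z) = \sum_(x < n) f (a + x%:Z).
Proof.
move=> aa nn f0 f1; have [d da] : exists d : nat, a = a' + d%:Z by exists `|a - a'|%N; lia.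
have dn : (d + n <= n')%N by lia.
rewrite (@sum_drop _ (fun x : nat => f (a' + x%:Z)) d) => [||k kd]; [|lia|by apply: f0; lia].
rewrite (@sum_trunc _ (fun x => f (a' + (d + x)%:Z)) n) => [||k kd]; [|lia|by apply: f1; lia].
by apply: eq_bigr => x _; congr f; lia.
Qed.

Lemma sum_square D (g : nat -> nat -> V) : (forall r q, (D <= r + q)%N -> g r q = 0) ->
  \sum_(r < D) \sum_(q < D) g r q = \sum_(Q < D) \sum_(r < Q.+1) g r (Q - r)%N.
Proof.
move=> g0; transitivity (\sum_(r < D) \sum_(q < (D - r.+1).+1) g r q).
  apply: eq_bigr => r _; have rD := ltn_ord r.
  by apply: (@sum_trunc _ (g r)) => [|q Dq]; [lia|apply: g0; lia].
by rewrite -triangle_sum big_ord_recl big_ord0 add0r.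
Qed.

(** The mode of index 0 is null because a_0 acts on the lattice factor only. *)
Definition amode i (n : int) : {linear V -> V} :=
  match n with
  | Posz 0 => @GRing.null_fun V V
  | Posz m.+1 => ap i m
  | Negz m => am i m
  end.

(** * Opposite roots: the double pole *)

Section Opposite.
Variables (i j : I).
Hypothesis cij : c i j = - 2%:Z.
Hypothesis amN : forall l v, am j l v = - am i l v.
Hypothesis apN : forall l v, ap j l v = - ap i l v.

Let newtonHj n v : n%:R *: H j n v = - \sum_(l < n) am i l (H j (n - l.+1)%N v).
Proof. by rewrite newtonH -sumrN; apply: eq_bigr => l _; rewrite amN. Qed.

Let na l : {linear V -> V} := \- (ap i l).

Let newtonEi n v : n%:R *: e i n v = \sum_(l < n) na l (e i (n - l.+1)%N v).
Proof. by rewrite newtonE -sumrN; apply: eq_bigr => l _ /=; rewrite ape. Qed.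

Let newtonEj n v : n%:R *: e j n v = - \sum_(l < n) na l (e j (n - l.+1)%N v).
Proof.
by rewrite newtonE; congr (- _); apply: eq_bigr => l _ /=; rewrite apN ape linearN.
Qed.

Let naE l n v : na l (e i n v) = e i n (na l v).
Proof. by rewrite /= ape linearN. Qed.

(** Since H_+(i, z) H_+(j, z) = 1, applying z d/dz to the first factor leaves the series of creation
    operators; [x] weights the identity itself. *)
Lemma HHj n w (x : C) : \sum_(p < n.+1) (p%:R + x) *: H i p (H j (n - p)%N w) =
  (if n is m.+1 then am i m w else 0) + (if n == 0%N then x *: w else 0).
Proof.
under eq_bigr do rewrite scalerDl; rewrite big_split -scaler_sumr /=.
rewrite (conv_weight (H0 i) (H0 j) (amH i i) (newtonH i) newtonHj).
rewrite (conv_eq (H0 i) (H0 j) (amH i i) (newtonH i) newtonHj).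
by congr (_ + _); case: eqP; rewrite ?scaler0.
Qed.

Lemma eej n w (x : C) : \sum_(p < n.+1) (x - p%:R) *: e i p (e j (n - p)%N w) =
  (if n is m.+1 then ap i m w else 0) + (if n == 0%N then x *: w else 0).
Proof.
under eq_bigr do rewrite scalerBl; rewrite sumrB -scaler_sumr.
rewrite (conv_weight (e0 i) (e0 j) naE newtonEi newtonEj).
rewrite (conv_eq (e0 i) (e0 j) naE newtonEi newtonEj).
rewrite addrC; congr (_ + _); first by case: n => [|n] /=; rewrite ?oppr0 ?opprK.
by case: eqP; rewrite ?scaler0.
Qed.

Lemma HzHz (P : int) (a : int) n w (x : C) : a <= 0 -> P < a + n%:Z ->
  \sum_(k < n) ((a + k%:Z)%:~R + x) *: Hz i (a + k%:Z) (Hz j (P - (a + k%:Z)) w) =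
  (if P is Posz m.+1 then am i m w else 0) + (if P == 0 then x *: w else 0).
Proof.
move=> a0 Pn; case: P Pn => [P|P] Pn; last first.
  rewrite big1 => [|k _]; first by rewrite addr0.
  have [ak|ak] := ltP (a + k%:Z) 0; first by rewrite Hz_neg ?scaler0.
  by rewrite [Hz j _ _]Hz_neg ?linear0 ?scaler0 //; lia.
rewrite (@sum_int_shift (fun y => (y%:~R + x) *: Hz i y (Hz j (P%:Z - y) w)) 0 _ P.+1) //.
- have := HHj P w x; rewrite -[P%:Z == 0]/(P == 0%N) => <-.
  apply: eq_bigr => p _; have pP := ltn_ord p; rewrite add0r.
  by have -> : P%:Z - p%:Z = (P - p)%N by lia.
- by move=> y y0; rewrite Hz_neg ?scaler0.
- by move=> y y0; rewrite [Hz j _ _]Hz_neg ?linear0 ?scaler0 //; lia.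
Qed.

(** The difference of the two expansions of the double pole is a derivative of the delta function: a
    normally ordered sum over all integers with a linear weight. By [HHj] and [eej] such a sum
    collapses to one Heisenberg mode and a constant. *)
Lemma WW_opp N M v :
  W i (N + 2) (W j M v) - W j (M + 2) (W i N v) =
  amode i (- N - M - 2) v + (if N + M + 2 == 0 then (- N - 1)%:~R *: v else 0).
Proof.
pose S := N + M + 2.
have [D Dv DS] : exists2 D, dlt D v & (`|S| < D)%N.
  exists (dbound v + `|S|.+1)%N; last by lia.
  by apply: dlt_le (dltP v); exact: leq_addr.
have [T TE] : exists T, (`|N| + `|M| + `|S| + D + D + 3 <= T)%N by eexists.
have kb : is_binom (c i j) (fun t => t.+1%:R : C) by rewrite cij; exact: binom_neg2.
have kb' : is_binom (c j i) (fun t => t.+1%:R : C) by rewrite cC.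
rewrite (@WW D _ _ _ _ _ _ T kb) //; last by lia.
rewrite (@WW D _ _ _ _ _ _ T kb') //; last by lia.
(* The first product gives X = N+2+t with weight t+1, the second X = N-t with weight -(t+1), and the
   missing index X = N+1 has weight 0; so the difference is a single two-sided sum of [f]. *)
pose f (X : int) := (X - N - 1)%:~R *: T2 D i j X (S - X) v.
have f0 X : X <= - D%:Z -> f X = 0 by move=> XD; rewrite /f T2_lt1 ?scaler0 //; lia.
have f1 X : S + D%:Z <= X -> f X = 0 by move=> XD; rewrite /f T2_lt2 ?scaler0 //; lia.
transitivity (\sum_(x < T + (1 + T)) f (N - T%:Z + 1 + x%:Z)).
  rewrite [RHS]big_split_ord [X in _ = _ + X]big_split_ord /= big_ord1 [X in _ = X + _](reindex_inj rev_ord_inj) /= [LHS]addrC -sumrN.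
  congr (_ + _).
    apply: eq_bigr => t _; have tT := ltn_ord t; rewrite /f T2C -scaleNr; congr (_ *: _).
      by rewrite -[LHS]/((Negz t)%:~R); congr (_%:~R); lia.
    by congr (T2 _ _ _ _ _ _); rewrite /S; lia.
  rewrite [X in _ = X + _](_ : _ = 0) ?add0r; last first.
    by rewrite /f (_ : _ - N - 1 = 0) ?scale0r //; lia.
  apply: eq_bigr => t _; rewrite /f; congr (_ *: T2 _ _ _ _ _ _).
  - by rewrite -[LHS]/(t.+1%:~R); congr (_%:~R); lia.
  - by lia.
  - by rewrite /S; lia.
rewrite (@sum_int_shift f (- D%:Z) _ (`|S| + D + D)); last first.
- by move=> x Sx; apply: f1; lia.
- by move=> x xD; apply: f0; lia.
- by lia.
- by lia.
pose U := (`|S| + D + D)%N; rewrite -/U.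
(* For fixed [r] and [q] the sum over X involves creation operators only and is evaluated by
   [HzHz]. *)
transitivity (\sum_(r < D) \sum_(q < D) (
   (if S + r%:Z + q%:Z is Posz m.+1 then am i m (e i r (e j q v)) else 0) +
   (if S + r%:Z + q%:Z == 0 then (- r%:Z - N - 1)%:~R *: e i r (e j q v) else 0))).
  rewrite /f /T2; under eq_bigr do rewrite scaler_sumr; rewrite exchange_big /=.
  apply: eq_bigr => r _; under eq_bigr do rewrite scaler_sumr; rewrite exchange_big /=.
  apply: eq_bigr => q _; have rD := ltn_ord r; have qD := ltn_ord q.
  rewrite -(@HzHz _ (r%:Z - D%:Z) U); try lia.
  apply: eq_bigr => x _; rewrite -rmorphD /=.
  congr (_%:~R *: Hz _ _ (Hz _ _ _)); lia.
rewrite (@sum_square D (fun r q => (if S + r%:Z + q%:Z is Posz m.+1 then am i m (e i r (e j q v)) else 0) +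
   (if S + r%:Z + q%:Z == 0 then (- r%:Z - N - 1)%:~R *: e i r (e j q v) else 0))); last first.
  move=> r q Drq; rewrite (e_gt i (dlt_e j q Dv)); last by rewrite leq_subLR addnC.
  by rewrite scaler0 if_same addr0; case: (_ + _) => // -[] // m; rewrite linear0.
(* Grouping by Q = r + q, the annihilation side collapses by [conv_eq] and [eej]. *)
transitivity (\sum_(Q < D) (
   (if S + Q%:Z is Posz m.+1 then am i m (if Q == 0 :> nat then v else 0) else 0) +
   (if S + Q%:Z == 0 then (if Q : nat is m.+1 then ap i m v else 0) +
      (if Q == 0 :> nat then (- N - 1)%:~R *: v else 0) else 0))).
  apply: eq_bigr => Q _.
  rewrite -(conv_eq (e0 i) (e0 j) naE newtonEi newtonEj) -eej.
  transitivity (\sum_(r < Q.+1) ((if S + Q%:Z is Posz m.+1 then am i m (e i r (e j (Q - r)%N v)) else 0) +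
   (if S + Q%:Z == 0 then (- r%:Z - N - 1)%:~R *: e i r (e j (Q - r)%N v) else 0))).
    apply: eq_bigr => r _; have rQ := ltn_ord r.
    by have -> : S + r%:Z + (Q - r)%N%:Z = S + Q%:Z by lia.
  rewrite big_split /=; congr (_ + _).
    case: (S + _) => [[|m]|m]; [by rewrite big1| |by rewrite big1].
    by rewrite linear_sum.
  case: eqP => _; last by rewrite big1.
  apply: eq_bigr => r _; congr (_ *: _).
  by rewrite -[r%:R]/(r%:Z%:~R) -rmorphB /=; congr (_%:~R); lia.
have D0 : (0 < D)%N by lia.
rewrite big_split /=; have -> : \sum_(Q < D) (if S + Q%:Z is Posz m.+1 then am i m (if Q == 0 :> nat then v else 0) else 0)
   = (if S is Posz m.+1 then am i m v else 0).
  rewrite (bigD1 (Ordinal D0)) //= addr0 big1 ?addr0 // => Q Q0.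
  have -> : (Q == 0 :> nat) = false by apply: negbTE; rewrite -(inj_eq val_inj) in Q0.
  by case: (S + _) => [[|m]|m] //; rewrite linear0.
have -> : - N - M - 2 = - S by rewrite /S; lia.
have -> : N + M + 2 = S by [].
clear f0 f1 TE; clear U f; move: S DS => {}S DS; clear T kb kb'.
(* S = 0 leaves the constant, S > 0 a creation operator, S < 0 an annihilation operator. *)
case: S DS => [[|s]|s] DS.
- rewrite (bigD1 (Ordinal D0)) //= big1 ?addr0 ?add0r // => Q Q0.
  by rewrite ifF //; move: Q0; rewrite -(inj_eq val_inj) /=; lia.
- by rewrite big1 ?addr0 // => Q _; rewrite ifF //; lia.
have sD : (s.+1 < D)%N by lia.
rewrite (bigD1 (Ordinal sD)) //= ifT; last lia.
rewrite big1 ?addr0 ?add0r => [|Q Q0]; last first.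
  by rewrite ifF //; move: Q0; rewrite -(inj_eq val_inj) /=; lia.
by [].
Qed.

End Opposite.

End VertexOperators.

(** * Serre relations *)

(* [e], [f], [h] span sl_2 up to the factor [s]; [v] is a lowest weight vector  *)
(* of weight -l in End(V), so (ad e)^(l+1) v is one of weight l + 2 > 0, which  *)
(* the local nilpotency of [e] and [f] forces to vanish.                        *)
Section Serre.
Variables (C : numFieldType) (V : lmodType C).
Variables (e f h v : {linear V -> V}) (s : C) (l : nat).
Hypothesis s0 : s != 0.
Hypothesis ef : forall w, e (f w) - f (e w) = h w.
Hypothesis he : forall w, h (e w) = e (h w) + (2 * s) *: e w.
Hypothesis hv : forall w, h (v w) = v (h w) - (l%:R * s) *: v w.
Hypothesis fv : forall w, f (v w) = v (f w).
Hypothesis e_nil : forall w, exists N, iter N e w = 0.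
Hypothesis f_nil : forall w, exists N, iter N f w = 0.

Fixpoint adpow n (w : V) : V :=
  if n is m.+1 then e (adpow m w) - adpow m (e w) else v w.

Lemma adpowS n w : adpow n.+1 w = e (adpow n w) - adpow n (e w).
Proof. by []. Qed.

Lemma adpow_linear n : linear (adpow n).
Proof.
elim: n => [|n IH] a x y /=; first exact: linearP.
by rewrite IH !linearP IH scalerBr; rewrite !opprD addrACA.
Qed.
HB.instance Definition _ n := GRing.isLinear.Build C V V _ (adpow n) (adpow_linear n).

Lemma h_adpow n w : h (adpow n w) = adpow n (h w) + ((2 * n%:R - l%:R) * s) *: adpow n w.
Proof.
elim: n w => [|n IH] w; first by rewrite /= hv mulr0 sub0r mulNr scaleNr.
set p := (2 * n%:R - l%:R) * s; set q := 2 * s.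
have pq : (2 * n.+1%:R - l%:R) * s = p + q by rewrite /p /q -natr1; ring.
have -> : h (adpow n.+1 w) = h (e (adpow n w)) - h (adpow n (e w)) by rewrite -linearB.
rewrite he !IH he pq.
have -> : e (adpow n (h w) + p *: adpow n w) = e (adpow n (h w)) + p *: e (adpow n w).
  by rewrite linearD linearZ.
have -> : adpow n (e (h w) + q *: e w) = adpow n (e (h w)) + q *: adpow n (e w).
  by rewrite linearD linearZ.
have lm (a b c d : V) (x y : C) :
    a + x *: b + y *: b - (c + y *: d + x *: d) = (a - c) + (x + y) *: (b - d).
  rewrite -[X in X - _]addrA -[X in _ - X]addrA -!scalerDl opprD addrACA.
  by rewrite [y + x]addrC -scalerBr.
exact: lm.
Qed.

Lemma f_e w : f (e w) = e (f w) - h w.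
Proof. by rewrite -ef opprB addrC subrK. Qed.

Lemma f_adpow n w : f (adpow n.+1 w) =
  adpow n.+1 (f w) - (n.+1%:R * (n%:R - l%:R) * s) *: adpow n w.
Proof.
elim: n w => [|n IH] w.
  rewrite !adpowS.
  have -> : f (e (adpow 0 w) - adpow 0 (e w)) = f (e (v w)) - f (v (e w)) by rewrite linearB.
  rewrite f_e !fv f_e.
  have -> : v (e (f w) - h w) = v (e (f w)) - v (h w) by rewrite linearB.
  rewrite hv mul1r sub0r mulNr scaleNr opprK.
  have lm (a b c d : V) : a - (b - c) - (d - b) = a - d + c.
    by rewrite !opprB !addrA (ACl (1*5*2*(4*3))) /= subrr addr0.
  exact: lm.
have -> : f (adpow n.+2 w) = f (e (adpow n.+1 w)) - f (adpow n.+1 (e w)).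
  by rewrite adpowS linearB.
rewrite f_e !IH h_adpow f_e.
set c := n.+1%:R * _ * s; set k := (2 * _ - _) * s.
have -> : n.+2%:R * (n.+1%:R - l%:R) * s = c + k by rewrite /c /k -!natr1; ring.
have -> : e (adpow n.+1 (f w) - c *: adpow n w) = e (adpow n.+1 (f w)) - c *: e (adpow n w).
  by rewrite linearB linearZ.
have -> : adpow n.+1 (e (f w) - h w) = adpow n.+1 (e (f w)) - adpow n.+1 (h w) by rewrite linearB.
rewrite [adpow n.+2 (f w)]adpowS scalerDl.
have -> : c *: adpow n.+1 w = c *: e (adpow n w) - c *: adpow n (e w) by rewrite adpowS scalerBr.
have lm (a1 a3 a5 X Y Z : V) : a1 - X - (a3 + Y) - (a5 - a3 - Z) = a1 - a5 - (X - Z + Y).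
  by rewrite !opprD !opprK !addrA (ACl (1*5*2*7*4*(6*3))) /= subrr addr0.
exact: lm.
Qed.

(** Once all high powers kill [e w], further steps on [w] are plain applications of [e], which is
    locally nilpotent. *)
Lemma adpow_nil w : exists N, forall n, (N <= n)%N -> adpow n w = 0.
Proof.
have [T] := e_nil w; elim: T w => [|T IH] w.
  by move=> /= ->; exists 0%N => n _; rewrite linear0.
rewrite iterSr => /IH [N NP].
have [m mP] := e_nil (adpow N w); exists (N + m)%N => n Nn.
have AE k : adpow (N + k) w = iter k e (adpow N w).
  elim: k => [|k IHk]; first by rewrite addn0.
  by rewrite addnS adpowS IHk NP ?leq_addr // subr0.
rewrite -(subnKC (leq_trans (leq_addr m N) Nn)) AE.
have -> : (n - N = (n - N - m) + m)%N by lia.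
rewrite iterD mP; elim: (_ - m)%N => //= k ->.
by rewrite linear0.
Qed.

(** Downward induction on the power. All high powers vanish uniformly on the finitely many nonzero
    [iter k f w]; by [f_adpow] vanishing at n+1 forces vanishing at n, as the scalar (n+1)(n-l)s is
    nonzero for n > l. *)
Lemma serre w : adpow l.+1 w = 0.
Proof.
have [S fS] := f_nil w.
have [N NP] : exists N, forall n k, (N <= n)%N -> adpow n (iter k f w) = 0.
  have f0 k : (S <= k)%N -> iter k f w = 0.
    by move=> Sk; rewrite -(subnK Sk) iterD fS; elim: (_ - S)%N => //= j ->; rewrite linear0.
  have : forall T, exists N, forall n k, (k < T)%N -> (N <= n)%N -> adpow n (iter k f w) = 0.
    elim=> [|T [N NP]]; first by exists 0%N.
    have [N' NP'] := adpow_nil (iter T f w); exists (maxn N N') => n k.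
    rewrite ltnS leq_eqVlt geq_max => /orP[/eqP ->|kT] /andP[Nn Nn']; first exact: NP'.
    exact: NP.
  case/(_ S) => N NP; exists N => n k Nn; have [kS|Sk] := ltnP k S; first exact: NP.
  by rewrite f0 // linear0.
have : forall d n k, (l.+1 <= n)%N -> (N <= n + d)%N -> adpow n (iter k f w) = 0.
  elim=> [|d IH] n k ln Nn; first by apply: NP; rewrite addn0 in Nn.
  have := f_adpow n (iter k f w); rewrite -[f (iter k f w)]/(iter k.+1 f w).
  rewrite (IH n.+1 k) ?(IH n.+1 k.+1); try lia; rewrite linear0 sub0r.
  move/esym/eqP; rewrite oppr_eq0 scaler_eq0 mulf_eq0 (negPf s0) orbF mulf_eq0.
  rewrite pnatr_eq0 /= subr_eq0 eqr_nat => /orP[/eqP nl|/eqP //]; lia.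
by move=> /(_ N l.+1 0%N); apply; lia.
Qed.

End Serre.

(** * Relations between the operators on R_Gamma *)

Section OperatorRelations.
Variables (C : numClosedFieldType) (G : finGroupType) (xi : classFun C G).
Hypothesis xi_virtual : virtual xi.
Local Notation Gn n := (wreath G n).
Local Notation fam := (forall n, classFun C (Gn n)).
Local Notation RG := (RGamma C G).
Implicit Types (f g : classFun C G) (v : RG).

Lemma eta_cyc f n (x : Gn n.+1) : virtual f -> wcyc x -> Defs.eta n.+1 f x = ucyc f x.
Proof.
move=> /mult_eta [e1 eu] xc; rewrite -(dx_x (fun n => Defs.eta n f)) eu // cfZE e1.
by rewrite mulr1.
Qed.

Lemma sigma_mul f g n (x : Gn n.+1) :
  sigma (cf_mul f g) x = (if wcyc x then ucyc f x else 0) * sigma g x.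
Proof.
rewrite !sigmaE; case: ifP => _; last by rewrite mulr0.
by rewrite /ucyc mkcfE mulrCA.
Qed.

(** As [sigma] lives on single cycles, where [eta n xi] is [xi] of the cycle product, the weight
    merges into [sigma (xi f)]. *)
Lemma opa_annE n f v m : opa_ann xi n f v m = annf (@sigma C G n (cf_mul xi f)) v m.
Proof.
rewrite [LHS]ann_compE; apply: eq_annf => // x; rewrite sigma_mul sigmaE.
by case: ifP => [xc|_]; rewrite ?mulr0 // eta_cyc.
Qed.

Definition eps_weighted f n := cf_mul (Defs.eta n xi) (epsilon n f).

Lemma mult_eps_weighted f : virtual f ->
  mult (eps_weighted f) (fun a x => (-1) ^+ a * ucyc (cf_mul xi f) x).
Proof.
move=> fv; apply: eq_mult (mult_mul (mult_eta xi_virtual) (mult_epsilon fv)) => a x.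
by rewrite /ucyc mkcfE mulrCA.
Qed.

Lemma opEE n f v m : opE xi n f v m = annf (eps_weighted f n) v m.
Proof. by rewrite [LHS]ann_compE; apply: eq_annf => // x; rewrite [RHS]mkcfE. Qed.

Lemma avg_xiform n f g :
  #|{: Gn n.+1}|%:R^-1 * \sum_x @sigma C G n (cf_mul xi f) x * ucyc g x^-1%g = xiform xi f g.
Proof.
transitivity (#|G|%:R^-1 * \sum_x cf_mul (cf_mul xi f) (cf_inv g) x).
  rewrite -(avg_sigma n); congr (_ * _); apply: eq_bigr => x _; rewrite !sigmaE.
  by case: ifP => [xc|_]; rewrite ?mul0r // ucycV // -mulrA /ucyc !mkcfE.
by congr (_ * _); apply: eq_bigr => x _; rewrite !mkcfE.
Qed.

Lemma sigma_ncyc n f (x : Gn n.+1) : ~~ wcyc x -> sigma f x = 0.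
Proof. by move=> /negPf xc; rewrite sigmaE xc. Qed.

Lemma opa_ann_cre k l f g v : opa_ann xi k f (opa_cre l g v) =
  opa_cre l g (opa_ann xi k f v) + (if k == l then (l.+1%:R * xiform xi f g) *: v else 0).
Proof.
apply: dsumP => m; rewrite dsDE opa_annE annf_cre_sigma; last exact: sigma_ncyc.
rewrite addrC; congr (_ + _).
  by apply: eq_cre_comp => // j; rewrite opa_annE.
case: eqP => // _; rewrite dsZE; congr (_ *: _); rewrite -(avg_xiform k) mulrCA; congr (_ * _).
by rewrite mulr_sumr; apply: eq_bigr => x _; rewrite mulrCA.
Qed.

Lemma opa_ann_H k p f g v : virtual g -> opa_ann xi k f (opH p g v) =
  opH p g (opa_ann xi k f v) + (if (k < p)%N then xiform xi f g *: opH (p - k.+1) g v else 0).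
Proof.
move=> gv; apply: dsumP => m; rewrite dsDE opa_annE.
rewrite (annf_cre_mult (F := fun n => Defs.eta n g) p v m _ (mult_eta gv)); last exact: sigma_ncyc.
rewrite addrC; congr (_ + _).
  by apply: eq_cre_comp => // j; rewrite opa_annE.
by case: ltnP => // _; rewrite dsZE avg_xiform.
Qed.

Lemma opa_annC k l f g v : opa_ann xi k f (opa_ann xi l g v) = opa_ann xi l g (opa_ann xi k f v).
Proof.
apply: dsumP => m; rewrite !opa_annE.
transitivity (annf (@sigma C G k (cf_mul xi f)) (annf (@sigma C G l (cf_mul xi g)) v) m).
  by apply: eq_annf => // j; rewrite opa_annE.
by rewrite annfC; apply: eq_annf => // j; rewrite opa_annE.
Qed.

Lemma opa_ann_E k p f g v : opa_ann xi k f (opE xi p g v) = opE xi p g (opa_ann xi k f v).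
Proof.
apply: dsumP => m; rewrite opa_annE opEE.
transitivity (annf (@sigma C G k (cf_mul xi f)) (annf (eps_weighted g p) v) m).
  by apply: eq_annf => // j; rewrite opEE.
by rewrite annfC; apply: eq_annf => // j; rewrite opa_annE.
Qed.

Lemma opEC p q f g v : opE xi p f (opE xi q g v) = opE xi q g (opE xi p f v).
Proof.
apply: dsumP => m; rewrite !opEE.
transitivity (annf (eps_weighted f p) (annf (eps_weighted g q) v) m).
  by apply: eq_annf => // j; rewrite opEE.
by rewrite annfC; apply: eq_annf => // j; rewrite opEE.
Qed.

Lemma opa_creC k l f g v : opa_cre k f (opa_cre l g v) = opa_cre l g (opa_cre k f v).
Proof.
apply: dsumP => m; transitivity (cre_comp (sigf f k.+1) (cre_comp (sigf g l.+1) v) m).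
  by rewrite -cre_sigf; apply: eq_cre_comp => // j; rewrite -cre_sigf.
by rewrite cre_compC -cre_sigf; apply: eq_cre_comp => // j; rewrite -cre_sigf.
Qed.

Lemma opa_cre_H k p f g v : opa_cre k f (opH p g v) = opH p g (opa_cre k f v).
Proof.
apply: dsumP => m; transitivity (cre_comp (sigf f k.+1) (cre_comp (Defs.eta p g) v) m).
  by rewrite -cre_sigf.
rewrite (cre_compC (sigf f) (fun n => Defs.eta n g)); apply: eq_cre_comp => // j.
by rewrite -cre_sigf.
Qed.

Lemma opHC p q f g v : opH p f (opH q g v) = opH q g (opH p f v).
Proof.
by apply: dsumP => m; exact: (cre_compC (fun n => Defs.eta n f) (fun n => Defs.eta n g)).
Qed.

Lemma ds_sumE (I : Type) (r : seq I) (P : pred I) (F : I -> RG) k :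
  (\sum_(i <- r | P i) F i) k = \sum_(i <- r | P i) F i k.
Proof. exact: (big_morph (fun v : RG => v k)). Qed.

Lemma opH_newton n f v : virtual f -> n%:R *: opH n f v =
  \sum_(l < n) opa_cre l f (opH (n - l.+1) f v).
Proof.
move=> fv; apply: dsumP => m; rewrite dsZE ds_sumE.
have mF : mult (fun n => Defs.eta n f) (fun a x => 1 * ucyc f x).
  by apply: eq_mult (mult_eta fv) => a x; rewrite mul1r.
rewrite [LHS](newton_cre (c := fun=> 1) mF v n m).
by apply: eq_bigr => l _; rewrite scale1r.
Qed.

Lemma opE_newton n f v : virtual f -> n%:R *: opE xi n f v =
  \sum_(l < n) (-1) ^+ l *: opE xi (n - l.+1) f (opa_ann xi l f v).
Proof.
move=> fv; apply: dsumP => m; rewrite dsZE ds_sumE opEE.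
rewrite (newton_ann (c := fun a => (-1) ^+ a) (mult_eps_weighted fv)).
apply: eq_bigr => l _; rewrite dsZE opEE; congr (_ *: _).
by apply: eq_annf => // j; rewrite opa_annE.
Qed.

Lemma opH0 f v : virtual f -> opH 0 f v = v.
Proof. by case/mult_eta => e1 _; apply: dsumP => m; exact: cre_comp_unit. Qed.

Lemma dx_unit (A : fam) m : dx (1%g : Gn 0) A m = A m.
Proof.
apply: classfunP => y; rewrite dxE.
apply/esym/(@fam_iso _ _ A _ _ _ _ (@rinj 0 m m erefl)); first exact: rinj_inj.
- by move=> j; case: (@injP 0 m m erefl j) => [[]//|i]; exists i.
- by move=> i; rewrite wembpr.
- by move=> i; rewrite wembbr.
Qed.

Lemma opE0 f v : virtual f -> opE xi 0 f v = v.
Proof.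
case/mult_eps_weighted => e1 _; apply: dsumP => m; rewrite opEE annfE.
rewrite (big_pred1 1%g) => [|x]; last first.
  by rewrite /= [x in RHS](_ : x = 1%g) ?eqxx //; apply: wreathP => -[].
rewrite e1 invg1 dx_unit (_ : #|_| = 1%N) ?invr1 ?mul1r ?scale1r //.
rewrite -(card1 (1%g : Gn 0)); apply: eq_card => x; rewrite !inE.
by apply/esym/eqP/wreathP => -[].
Qed.

(** The bound is an integer that may become negative, in which case the vector is zero; [opX_nil]
    ends that way. *)
Lemma lt_H (d : int) n f v : (forall k : nat, d <= k%:Z -> v k = 0) ->
  forall k : nat, d + n%:Z <= k%:Z -> opH n f v k = 0.
Proof.
move=> v0 k dk; have [nk|kn] := leqP n k; last exact: cre_comp_gt.
rewrite -(cre_comp0r (Defs.eta n f) k); apply: eq_cre_comp_at.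
by apply: v0; lia.
Qed.

Lemma lt_cre (d : int) n f v : (forall k : nat, d <= k%:Z -> v k = 0) ->
  forall k : nat, d + n.+1%:Z <= k%:Z -> opa_cre n f v k = 0.
Proof.
move=> v0 k dk; have [nk|kn] := leqP n.+1 k; last exact: cre_comp_gt.
rewrite -(cre_comp0r (@sigma C G n f) k); apply: eq_cre_comp_at.
by apply: v0; lia.
Qed.

Lemma annf_eq0 n (phi : Gn n -> C) (A : fam) m : A (n + m)%N = 0 -> annf phi A m = 0.
Proof.
move=> A0; rewrite annfE big1 // => x _; rewrite (_ : dx _ _ _ = 0) ?scaler0 //.
by apply: classfunP => y; rewrite dxE A0 !cf0E.
Qed.

Lemma lt_E (d : int) n f v : (forall k : nat, d <= k%:Z -> v k = 0) ->
  forall k : nat, d - n%:Z <= k%:Z -> opE xi n f v k = 0.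
Proof. by move=> v0 k dk; rewrite opEE annf_eq0 // v0 //; lia. Qed.

Lemma lt_ann (d : int) n f v : (forall k : nat, d <= k%:Z -> v k = 0) ->
  forall k : nat, d - n.+1%:Z <= k%:Z -> opa_ann xi n f v k = 0.
Proof. by move=> v0 k dk; rewrite opa_annE annf_eq0 // v0 //; lia. Qed.

Lemma opa_cre_opp n f v : opa_cre n (- f) v = - opa_cre n f v.
Proof.
rewrite -[RHS]scaleN1r; apply: dsumP => m; rewrite dsZE; apply: cre_compZl => x.
by rewrite !sigmaE; case: ifP => _; rewrite ?mulr0 // /ucyc cfNE mulN1r mulrN.
Qed.

Lemma opa_ann_opp n f v : opa_ann xi n (- f) v = - opa_ann xi n f v.
Proof.
rewrite -[RHS]scaleN1r; apply: dsumP => m; rewrite dsZE !opa_annE !annfE scaler_sumr.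
apply: eq_bigr => x _; rewrite scalerA mulrCA mulN1r mulrN -mulrN; congr ((_ * _) *: _).
by rewrite !sigmaE; case: ifP => _; rewrite ?oppr0 // /ucyc !mkcfE !mulrN.
Qed.

End OperatorRelations.

(** * Representations of a presented Lie algebra *)

Section Presentation.
Variables (C : numClosedFieldType) (X : Type) (V : lmodType C).
Variable rel : lie_term C X -> lie_term C X -> Prop.
Variable phi : X -> V -> V.
Hypothesis phi_linear : forall x, linear (phi x).
Local Notation term := (lie_term C X).

Fixpoint lie_act (t : term) : V -> V :=
  match t with
  | LGen x => phi x
  | LZero => fun=> 0
  | LAdd s t => fun v => lie_act s v + lie_act t v
  | LScale a t => fun v => a *: lie_act t v
  | LBr s t => fun v => lie_act s (lie_act t v) - lie_act t (lie_act s v)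
  end.

Lemma lie_act_linear t : linear (lie_act t).
Proof.
elim: t => [x||s IHs t IHt|b t IHt|s IHs t IHt] a u v /=.
- exact: phi_linear.
- by rewrite scaler0 addr0.
- by rewrite IHs IHt scalerDr addrACA.
- by rewrite IHt scalerDr !scalerA mulrC.
- by rewrite IHt IHs IHs IHt scalerBr opprD addrACA.
Qed.

Let act t : {linear V -> V} :=
  HB.pack_for {linear V -> V} (lie_act t)
    (GRing.isLinear.Build C V V _ (lie_act t) (lie_act_linear t)).

Lemma lie_actD t u v : lie_act t (u + v) = lie_act t u + lie_act t v.
Proof. exact: (linearD (act t)). Qed.
Lemma lie_actN t v : lie_act t (- v) = - lie_act t v.
Proof. exact: (linearN (act t)). Qed.
Lemma lie_act0 t : lie_act t 0 = 0.
Proof. exact: (linear0 (act t)). Qed.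
Lemma lie_actZ t a v : lie_act t (a *: v) = a *: lie_act t v.
Proof. by rewrite -[a *: v]addr0 lie_act_linear lie_act0 addr0. Qed.

Hypothesis phi_rel : forall s t, rel s t -> lie_act s =1 lie_act t.

Lemma lie_act_eq s t : lie_eq rel s t -> lie_act s =1 lie_act t.
Proof.
have linE := (lie_actD, lie_actZ, lie_actN, lie_act0).
elim=> {s t} [s t /phi_rel //|t|s t _ IH|s t u _ IH1 _ IH2|s s' t t' _ IH1 _ IH2
  |a t t' _ IH|s s' t t' _ IH1 _ IH2|s t u|s t|t|t|a b t|t|a s t|a b t|a s t u|a s t u
  |t|s t u] v //=.
- by rewrite IH1.
- by rewrite IH1 IH2.
- by rewrite IH.
- by rewrite !IH1 !IH2.
- by rewrite addrA.
- by rewrite addrC.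
- by rewrite add0r.
- by rewrite scaleN1r addNr.
- by rewrite scalerA.
- by rewrite scale1r.
- by rewrite scalerDr.
- by rewrite scalerDl.
- by rewrite !linE scalerBr opprD addrACA.
- by rewrite !linE scalerBr opprD addrACA.
- by rewrite subrr.
- rewrite !linE !opprB.
  rewrite (AC ((2*2)*(2*2)*(2*2)) ((1*12)*(7*2)*(5*4)*(3*10)*(11*6)*(9*8))).
  by rewrite /= !subrr !addr0.
Qed.

(** Existence: the evaluation [lie_act] respects every generating rule of the congruence.
    Uniqueness: a representation is determined on each term by its values on generators. *)
Lemma presLie_rep_unique :
  exists! Phi : presLie rel -> V -> V,
    lie_rep Phi /\ forall x, Phi (lie_gen rel x) = phi x.
Proof.
pose Phi (x : presLie rel) := lie_act (lie_repr x).
have PhiE t v : Phi (lie_class rel t) v = lie_act t v.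
  exact/lie_act_eq/lie_repr_class.
exists Phi; split=> [|Psi [[_ Psil Psib] Psig]].
  split; last by move=> x; apply/funext => v; rewrite PhiE.
  split=> [x|v a|x y v]; first exact: lie_act_linear.
    elim/lie_classW=> s; elim/lie_classW=> t.
    rewrite -[_ *: _]/(pl_scale _ _) -[_ + lie_class _ _]/(pl_add _ _) !plE.
    by rewrite !PhiE.
  elim/lie_classW: x => s; elim/lie_classW: y => t.
  by rewrite -[lie _ _]/(pl_br _ _) !plE !PhiE.
pose L v : {linear presLie rel -> V} :=
  HB.pack_for {linear presLie rel -> V} (Psi^~ v)
    (GRing.isLinear.Build C (presLie rel) V _ (Psi^~ v) (Psil v)).
have PsiD x y v : Psi (x + y) v = Psi x v + Psi y v by exact: (linearD (L v)).
have Psi0 v : Psi 0 v = 0 by exact: (linear0 (L v)).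
apply/funext; elim/lie_classW=> t; apply/funext => v; rewrite PhiE.
elim: t v => [x||s IHs t IHt|a t IHt|s IHs t IHt] v /=.
- by rewrite -Psig.
- exact/esym/Psi0.
- by rewrite IHs IHt -plE; apply/esym/PsiD.
- rewrite IHt -plE; apply/esym; have := Psil v a (lie_class rel t) 0.
  by rewrite addr0 Psi0 addr0.
- by rewrite !IHs !IHt -plE; apply/esym/Psib.
Qed.

End Presentation.

(** * The McKay matrix *)

Lemma cf_mulE (C : numClosedFieldType) (T : finGroupType) (f g : classFun C T) x :
  cf_mul f g x = f x * g x.
Proof. exact: mkcfE. Qed.

(** * Kronecker products and the symplectic plane *)

Section Kronecker.
Variable F : fieldType.

Lemma mul_delta_mxE p n m q (Y : 'M[F]_(p, n)) (Z : 'M[F]_(m, q)) a b c d :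
  (Y *m delta_mx a b *m Z) c d = Y c a * Z b d.
Proof.
rewrite mxE (bigD1 b) //= big1 ?addr0 => [|j jb]; last first.
  by rewrite mxE big1 ?mul0r // => i _; rewrite !mxE (negPf jb) andbF mulr0.
rewrite mxE (bigD1 a) //= big1 ?addr0 => [|i ia]; last by rewrite !mxE (negPf ia) mulr0.
by rewrite !mxE !eqxx mulr1.
Qed.

(** The Kronecker product, realised as Z |-> A^T Z B on row-vectorised matrices so that its algebra
    reduces to that of linear maps. *)
Definition kron m n (A : 'M[F]_m) (B : 'M[F]_n) : 'M[F]_(m * n) :=
  lin_mx (mulmxr B \o mulmx A^T).

Lemma mxvec_inj_mx m n p (M N : 'M[F]_(m * n, p)) :
  (forall Z, mxvec Z *m M = mxvec Z *m N) -> M = N.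
Proof.
move=> MN; apply/row_matrixP => k; rewrite !rowE -(vec_mxK (delta_mx 0 k)).
exact: MN.
Qed.

Lemma mxvec_kron m n (A : 'M[F]_m) (B : 'M[F]_n) Z :
  mxvec Z *m kron A B = mxvec (A^T *m Z *m B).
Proof. by rewrite mul_vec_lin. Qed.

Lemma kronM m n (A A' : 'M[F]_m) (B B' : 'M[F]_n) :
  kron A B *m kron A' B' = kron (A *m A') (B *m B').
Proof.
apply: mxvec_inj_mx => Z; rewrite mulmxA !mxvec_kron trmx_mul.
by rewrite !mulmxA.
Qed.

Lemma kron1 m n : kron (1%:M : 'M[F]_m) (1%:M : 'M[F]_n) = 1%:M.
Proof. by apply: mxvec_inj_mx => Z; rewrite mxvec_kron trmx1 mul1mx !mulmx1. Qed.

Lemma kronE m n (A : 'M[F]_m) (B : 'M[F]_n) a b c d :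
  kron A B (mxvec_index a b) (mxvec_index c d) = A a c * B b d.
Proof.
transitivity ((mxvec (delta_mx a b) *m kron A B) 0 (mxvec_index c d)).
  by rewrite mxvec_delta -rowE [RHS]mxE.
by rewrite mxvec_kron mxvecE mul_delta_mxE mxE.
Qed.

Lemma kron_tr m n (A : 'M[F]_m) (B : 'M[F]_n) : (kron A B)^T = kron A^T B^T.
Proof.
apply/matrixP; case/mxvec_indexP=> a b; case/mxvec_indexP=> c d.
by rewrite mxE !kronE !mxE.
Qed.

Lemma kronNl m n (A : 'M[F]_m) (B : 'M[F]_n) : kron (- A) B = - kron A B.
Proof.
apply/matrixP; case/mxvec_indexP=> a b; case/mxvec_indexP=> c d.
by rewrite [RHS]mxE !kronE !mxE mulNr.
Qed.

Lemma mxtrace_kron m n (A : 'M[F]_m) (B : 'M[F]_n) : \tr (kron A B) = \tr A * \tr B.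
Proof.
rewrite {1}/mxtrace (reindex _ (curry_mxvec_bij _ _)) /= big_distrlr pair_bigA /=.
by apply: eq_bigr => -[a b] _; exact: kronE.
Qed.

(** As a bilinear form this is the symmetric pairing tr(AB) on square matrices. *)
Definition swap_mx n : 'M[F]_(n * n) := lin_mx (@trmx F n n).

Lemma swap_mxK n : swap_mx n *m swap_mx n = 1%:M.
Proof.
by apply: mxvec_inj_mx => Z; rewrite mulmxA !mul_vec_lin /= trmxK mulmx1.
Qed.

Lemma swap_mx_tr n : (swap_mx n)^T = swap_mx n.
Proof.
have sE a b c d : swap_mx n (mxvec_index a b) (mxvec_index c d) =
    ((a == d) && (b == c))%:R.
  transitivity ((mxvec (delta_mx a b) *m swap_mx n) 0 (mxvec_index c d)).
    by rewrite mxvec_delta -rowE [RHS]mxE.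
  by rewrite mul_vec_lin mxvecE !mxE [c == b]eq_sym [d == a]eq_sym.
apply/matrixP; case/mxvec_indexP=> a b; case/mxvec_indexP=> c d.
by rewrite mxE !sE andbC [d == a]eq_sym [c == b]eq_sym.
Qed.

Lemma kron_swap n (A B : 'M[F]_n) : kron A B *m swap_mx n = swap_mx n *m kron B A.
Proof.
apply: mxvec_inj_mx => Z; rewrite !mulmxA mxvec_kron !mul_vec_lin /=.
by rewrite !trmx_mul trmxK mulmxA.
Qed.

Lemma mxtrace_idem n (P : 'M[F]_n) : P *m P = P -> \tr P = (\rank P)%:R.
Proof.
move=> PP; have bc : row_base P *m col_base P = 1%:M.
  apply: (row_full_inj (col_base_full P)); apply: (row_free_inj (row_base_free P)).
  by rewrite mulmx1 mulmxA mulmx_base -mulmxA mulmx_base PP.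
by rewrite -{1}(mulmx_base P) mxtrace_mulC bc mxtrace1.
Qed.

Lemma ord2P (P : 'I_2 -> Prop) : P 0 -> P 1 -> forall i, P i.
Proof.
move=> P0 P1 [[|[|//]] i2]; first by rewrite (_ : Ordinal _ = 0) //; exact: val_inj.
by rewrite (_ : Ordinal _ = 1) //; exact: val_inj.
Qed.

Lemma sum_ord2 (f : 'I_2 -> F) : \sum_i f i = f 0 + f 1.
Proof.
rewrite !big_ord_recl big_ord0 addr0; congr (f _ + f _); exact: val_inj.
Qed.

Lemma cofactor2 (A : 'M[F]_2) i j :
  cofactor A i j = (-1) ^+ (i + j) * A (1 - i) (1 - j).
Proof.
rewrite /cofactor det_mx11 !mxE; congr (_ * A _ _);
  by [elim/ord2P: i; apply: val_inj | elim/ord2P: j; apply: val_inj].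
Qed.

Lemma mxtrace_adj2 (A : 'M[F]_2) : \tr (\adj A) = \tr A.
Proof.
rewrite /mxtrace !sum_ord2 !mxE !cofactor2 subr0 subrr expr0 mul1r addrC.
by rewrite -signr_odd expr0 mul1r.
Qed.

Lemma det2 (A : 'M[F]_2) : \det A = A 0 0 * A 1 1 - A 0 1 * A 1 0.
Proof.
rewrite (expand_det_row _ 0) sum_ord2 !cofactor2 subr0 subrr expr0 mul1r.
by rewrite expr1 mulN1r mulrN.
Qed.

Definition symp2 : 'M[F]_2 := \matrix_(i, j) if i == j then 0 else (-1) ^+ i.

Lemma symp2_tr : symp2^T = - symp2.
Proof.
by apply/matrixP => i j; rewrite !mxE; elim/ord2P: i; elim/ord2P: j;
  rewrite ?eqxx /= ?oppr0 ?expr0 ?expr1 ?opprK.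
Qed.

Lemma symp2_sq : symp2 *m symp2 = - 1%:M.
Proof.
by apply/matrixP => i j; rewrite !mxE sum_ord2 !mxE; elim/ord2P: i; elim/ord2P: j;
  rewrite ?eqxx /= ?expr0 ?expr1 ?mulr0 ?mul0r ?addr0 ?add0r ?oppr0 ?mul1r ?mulr1.
Qed.

Lemma symp2_det (A : 'M[F]_2) : A *m symp2 *m A^T = \det A *: symp2.
Proof.
by apply/matrixP => i j; rewrite det2 !mxE sum_ord2 !mxE !sum_ord2 !mxE;
  elim/ord2P: i; elim/ord2P: j; rewrite ?eqxx /= ?expr0 ?expr1; ring.
Qed.

End Kronecker.

(** * Invariants, Schur's lemma and orthogonality of characters *)

Section Averages.
Variables (C : numClosedFieldType) (G : finGroupType).
Local Notation rep d := (mx_representation C [set: G] d).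
Local Notation iG := ((#|G|%:R)^-1 : C).

Let G0 := natr_card_neq0 C G.

Lemma rep1 d (V : rep d) : V 1%g = 1%:M. Proof. exact: repr_mx1. Qed.
Lemma repM d (V : rep d) x y : V (x * y)%g = V x *m V y.
Proof. by rewrite repr_mxM ?inE. Qed.
Lemma repMV d (V : rep d) x : V x *m V x^-1%g = 1%:M.
Proof. by rewrite -repM mulgV rep1. Qed.
Lemma repVM d (V : rep d) x : V x^-1%g *m V x = 1%:M.
Proof. by rewrite -repM mulVg rep1. Qed.

Section Projector.
Variables (d : nat) (W : G -> 'M[C]_d).
Hypothesis WM : forall x y, W (x * y)%g = W x *m W y.

Definition avg_mx : 'M[C]_d := iG *: \sum_x W x.

Lemma avg_mx_idem : avg_mx *m avg_mx = avg_mx.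
Proof.
rewrite -[in LHS]scalemxAl mulmx_suml; under eq_bigr => x _.
  rewrite -scalemxAr mulmx_sumr; under eq_bigr => y _ do rewrite -WM.
  rewrite (_ : \sum_y W (x * y)%g = \sum_y W y); last by rewrite [RHS](reindex_inj (mulgI x)).
  rewrite -/avg_mx.
over.
rewrite sumr_const -scaler_nat scalerA cardT -cardE mulVf ?scale1r //.
Qed.

(** Averaging is idempotent, so its trace is its rank: multiplicities are natural numbers. *)
Lemma avg_mx_trace : iG * \sum_x \tr (W x) = (\rank avg_mx)%:R.
Proof. by rewrite -mxtrace_idem ?avg_mx_idem // mxtraceZ raddf_sum. Qed.

(* If the trace were 1, the invariants would be a line carrying a nondegenerate *)
(* alternating form.                                                            *)
Lemma avg_mx_symplectic (J K : 'M[C]_d) : W 1%g = 1%:M ->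
  (forall x, W x *m J *m (W x)^T = J) -> J^T = - J -> J *m K = 1%:M ->
  iG * \sum_x \tr (W x) != 1.
Proof.
move=> W1 WJ JN JK; rewrite avg_mx_trace -[1]/(1%:R) eqr_nat; apply/negP => /eqP P1.
have PJ : avg_mx *m J = J *m avg_mx^T.
  rewrite linearZ /= linear_sum /= -scalemxAl -scalemxAr mulmx_suml mulmx_sumr.
  congr (_ *: _); rewrite [RHS](reindex_inj invg_inj); apply: eq_bigr => x _ /=.
  rewrite -{2}(WJ x) -[RHS]mulmxA -trmx_mul -WM mulVg W1 trmx1 mulmx1 //.
(* An alternating form vanishes on a line. The dimension is a variable because the rank of [avg_mx]
   equals 1 only propositionally. *)
have alt k (b : 'M_(k, d)) : k = 1%N -> b *m J *m b^T = 0.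
  move=> k1; subst k; have bN : (b *m J *m b^T)^T = - (b *m J *m b^T).
    by rewrite !trmx_mul trmxK JN mulNmx mulmxN mulmxA.
  apply/matrixP => i j; rewrite !ord1 [RHS]mxE; apply/eqP.
  move/matrixP/(_ 0 0): bN; rewrite [LHS]mxE [RHS]mxE => /eqP.
  by rewrite -addr_eq0 -mulr2n mulrn_eq0.
pose b := row_base avg_mx; pose c := col_base avg_mx.
have: avg_mx *m J = 0.
  rewrite -avg_mx_idem -mulmxA PJ -(mulmx_base avg_mx) trmx_mul.
  rewrite -/b -/c (_ : c *m b *m (J *m (b^T *m c^T)) = c *m (b *m J *m b^T) *m c^T).
    by rewrite alt ?mulmx0 ?mul0mx.
  by rewrite !mulmxA.
move=> PJ0; have /eqP : avg_mx = 0 by rewrite -[avg_mx]mulmx1 -JK mulmxA PJ0 mul0mx.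
by rewrite -mxrank_eq0 P1.
Qed.
End Projector.

Section Schur.
Variables (n m : nat) (V : rep n) (W : rep m).

Lemma intertwiner_rchar (B : 'M[C]_(n, m)) : mx_irreducible V -> mx_irreducible W ->
  (forall g, V g *m B = B *m W g) -> B != 0 -> rchar V = rchar W.
Proof.
move=> /mx_irrP[_ irrV] /mx_irrP[_ irrW] VB B0.
have /row_freeP[B' BB'] : row_free B.
  rewrite -kermx_eq0; apply/negPn/negP => k0; have/row_fullP[K kK] : row_full (kermx B).
    apply: irrV k0; apply/mxmoduleP => g _; apply/sub_kermxP.
    by rewrite -mulmxA VB mulmxA mulmx_ker mul0mx.
  by case/eqP: B0; rewrite -[B]mul1mx -kK -mulmxA mulmx_ker mulmx0.
have /row_fullP[B'' BB''] : row_full B.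
  rewrite -(eq_row_full (genmxE B)); apply: irrW; last by rewrite -mxrank_eq0 genmxE mxrank_eq0.
  by apply/mxmoduleP => g _; rewrite (eqmxMr _ (genmxE B)) genmxE -VB submxMl.
have E : B'' = B' by rewrite -[B'']mulmx1 -BB' mulmxA BB'' mul1mx.
apply: classfunP => g; rewrite !mkcfE.
by rewrite -[V g]mulmx1 -BB' mulmxA VB -mulmxA mxtrace_mulC -mulmxA -E BB'' mulmx1.
Qed.

Definition avg_hom (X : 'M[C]_(n, m)) : 'M[C]_(n, m) :=
  iG *: \sum_x V x *m X *m W x^-1%g.

Lemma avg_hom_intertwines X g : V g *m avg_hom X = avg_hom X *m W g.
Proof.
rewrite /avg_hom -scalemxAr -scalemxAl mulmx_sumr mulmx_suml; congr (_ *: _).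
rewrite [RHS](reindex_inj (mulgI g)); apply: eq_bigr => x _ /=.
by rewrite invMg !repM !mulmxA -[RHS]mulmxA repVM mulmx1.
Qed.

(** Both sides are the trace of the linear map X |-> [avg_hom X]. *)
Lemma cform_avg_hom :
  cform (rchar V) (rchar W) = \sum_a \sum_b avg_hom (delta_mx a b) a b.
Proof.
rewrite /cform; under [RHS]eq_bigr => a _.
  under eq_bigr => b _.
    rewrite mxE summxE; under eq_bigr => x _ do rewrite mul_delta_mxE.
  over.
  rewrite -mulr_sumr exchange_big /=.
over.
rewrite -mulr_sumr exchange_big /=; congr (_ * _); apply: eq_bigr => x _.
by rewrite !ffunE big_distrlr.
Qed.

Lemma cform_orth : mx_irreducible V -> mx_irreducible W -> rchar V <> rchar W ->
  cform (rchar V) (rchar W) = 0.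
Proof.
move=> irrV irrW VW; rewrite cform_avg_hom big1 // => a _; rewrite big1 // => b _.
have [->|B0] := eqVneq (avg_hom (delta_mx a b)) 0; first by rewrite mxE.
by case: VW; apply: intertwiner_rchar B0 => // g; exact: avg_hom_intertwines.
Qed.
End Schur.

Lemma cform_norm n (V : rep n) : mx_irreducible V -> cform (rchar V) (rchar V) = 1.
Proof.
move=> irrV; have [n0 _] := (mx_irrP V).1 irrV.
have n0' : n%:R != 0 :> C by rewrite pnatr_eq0 -lt0n.
rewrite cform_avg_hom; have sc X : avg_hom V V X = (\tr X / n%:R)%:M.
  have [a /eigenvalueP[v va v0]] := eigenvalue_closed (avg_hom V V X) n0.
  have BE : avg_hom V V X = a%:M.
    apply/eqP; rewrite -subr_eq0; apply/negPn/negP => B0.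
    have : avg_hom V V X - a%:M \in unitmx.
      apply: (mx_Schur irrV) B0; apply/centgmxP => g _.
      by rewrite mulmxBl mulmxBr avg_hom_intertwines scalar_mxC.
    move=> u; case/eqP: v0; rewrite -[v](mulmxK u) mulmxBr va mul_mx_scalar.
    by rewrite subrr mul0mx.
  rewrite BE; congr (_%:M); apply: (mulIf n0'); rewrite divfK //.
  have <- : \tr (avg_hom V V X) = \tr X.
    rewrite mxtraceZ raddf_sum /= (eq_bigr (fun=> \tr X)) => [|x _].
      by rewrite sumr_const -[X in _ * X]mulr_natl cardT -cardE mulrA mulVf ?mul1r.
    by rewrite mxtrace_mulC mulmxA repVM mul1mx.
  by rewrite BE mxtrace_scalar mulr_natr.
under eq_bigr => a _.
  rewrite (bigD1 a) //= big1 ?addr0 => [|b ba]; last by rewrite sc !mxE eq_sym (negPf ba).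
  rewrite sc !mxE eqxx mulr1n (_ : \tr (delta_mx a a) = 1) ?div1r.
over.
  rewrite /mxtrace (bigD1 a) //= big1 ?addr0 => [|b ba]; first by rewrite mxE !eqxx.
  by rewrite !mxE (negPf ba).
by rewrite sumr_const card_ord -[LHS]mulr_natl divff.
Qed.

Local Notation adj M := (map_mx Num.conj M^T).

Lemma adjM m n p (A : 'M[C]_(m, n)) (B : 'M[C]_(n, p)) : adj (A *m B) = adj B *m adj A.
Proof. by rewrite trmx_mul map_mxM. Qed.

Lemma mxtrace_adj n (A : 'M[C]_n) : \tr (adj A) = (\tr A)^*.
Proof. by rewrite rmorph_sum; apply: eq_bigr => i _; rewrite !mxE. Qed.

Lemma mxtrace_mul_adj m n (A : 'M[C]_(m, n)) :
  \tr (A *m adj A) = \sum_i \sum_j `|A i j| ^+ 2.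
Proof.
apply: eq_bigr => i _; rewrite mxE; apply: eq_bigr => j _.
by rewrite !mxE normCK.
Qed.

Lemma mxtrace_mul_adj_ge0 m n (A : 'M[C]_(m, n)) : 0 <= \tr (A *m adj A).
Proof.
by rewrite mxtrace_mul_adj; apply: sumr_ge0 => i _; apply: sumr_ge0 => j _; exact: exprn_ge0.
Qed.

Lemma mxtrace_mul_adj_eq0 m n (A : 'M[C]_(m, n)) : \tr (A *m adj A) = 0 -> A = 0.
Proof.
rewrite mxtrace_mul_adj => /eqP; rewrite psumr_eq0 => [/allP A0|i _]; last first.
  by apply: sumr_ge0 => j _; exact: exprn_ge0.
apply/matrixP => i j; have := A0 i (mem_index_enum i); rewrite psumr_eq0 => [/allP Ai0|k _].
  by have := Ai0 j (mem_index_enum j); rewrite mxE sqrf_eq0 normr_eq0 => /eqP.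
exact: exprn_ge0.
Qed.

(* [\sum_x V x *m adj (V x)] is the matrix of an invariant inner product. *)
Lemma rcharV n (V : rep n) x : rchar V x^-1%g = (rchar V x)^*.
Proof.
pose H := \sum_y V y *m adj (V y).
have HU : H \in unitmx.
  rewrite -row_free_unit -kermx_eq0; apply/negPn/negP => /rowV0Pn[v /sub_kermxP vH].
  case/eqP; have : \sum_y \tr ((v *m V y) *m adj (v *m V y)) = 0.
    rewrite -raddf_sum /=; under eq_bigr do rewrite adjM mulmxA -(mulmxA v).
    by rewrite -mulmx_suml -mulmx_sumr -/H vH mul0mx mxtrace0.
  move/eqP; rewrite psumr_eq0 => [/allP/(_ 1%g (mem_index_enum _))/eqP|y _].
    by move/mxtrace_mul_adj_eq0; rewrite rep1 mulmx1.
  exact: mxtrace_mul_adj_ge0.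
have VH : V x *m H = H *m adj (V x^-1%g).
  rewrite mulmx_sumr mulmx_suml [RHS](reindex_inj (mulgI x)); apply: eq_bigr => y _ /=.
  by rewrite repM adjM -!mulmxA -adjM repVM trmx1 map_mx1 mulmx1.
rewrite !mkcfE -[V x](mulmxK HU) VH mxtrace_mulC mulmxA mulVmx // mul1mx.
by rewrite mxtrace_adj conjCK.
Qed.

End Averages.

(** * The form of xi on irreducible characters *)

Section McKay.
Variables (C : numClosedFieldType) (G : finGroupType).
Local Notation rep d := (mx_representation C [set: G] d).
Local Notation iG := ((#|G|%:R)^-1 : C).
Variable rho : rep 2.
Hypothesis G_gt1 : (1 < #|G|)%N.
Hypothesis rho_faithful : mx_faithful rho.
Hypothesis rhoSU : forall g, rho g \is unitarymx /\ \det (rho g) = 1.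
Local Notation adj M := (map_mx Num.conj M^T).
Let pi := rchar rho.

(** In determinant 1 the inverse is the adjugate, which for size 2 has the same trace. *)
Lemma piV x : pi x^-1%g = pi x.
Proof.
rewrite !mkcfE -[RHS]mxtrace_adj2; congr (\tr _).
rewrite -[LHS]mulmx1 -[1%:M](_ : rho x *m \adj (rho x) = _).
  by rewrite mulmxA repVM mul1mx.
by rewrite mul_mx_adj; case: (rhoSU x) => _ ->.
Qed.

(** By unitarity 2 - pi is half a squared distance to the identity; hence it is nonnegative, and by
    faithfulness zero only at 1. *)
Lemma pi_norm x : 2 * (2 - pi x) = \tr ((rho x - 1%:M) *m adj (rho x - 1%:M)).
Proof.
have [/unitarymxP rU _] := rhoSU x.
rewrite linearB /= map_mxB trmx1 map_mx1 mulmxBl !mulmxBr !mulmx1 mul1mx rU.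
rewrite !linearB /= mxtrace_adj mxtrace1 (_ : \tr (rho x) = pi x); last by rewrite mkcfE.
by rewrite -rcharV piV; ring.
Qed.

Lemma pi_le2 x : 0 <= 2 - pi x.
Proof. by rewrite -(pmulr_rge0 _ (ltr0n C 2)) pi_norm mxtrace_mul_adj_ge0. Qed.

Lemma pi_eq2 x : 2 - pi x = 0 -> x = 1%g.
Proof.
move=> p2; have := pi_norm x; rewrite p2 mulr0 => /esym/mxtrace_mul_adj_eq0/eqP.
rewrite subr_eq0 => /eqP r1; apply: (mx_faithful_inj rho_faithful); rewrite ?inE //.
by rewrite r1 rep1.
Qed.

Section Multiplicity.
Variables (n m : nat) (V : rep n) (W : rep m).

Definition mckay_rep x := kron (rho x) (kron (W x^-1%g)^T (V x)).

Lemma mckay_repM x y : mckay_rep (x * y)%g = mckay_rep x *m mckay_rep y.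
Proof. by rewrite /mckay_rep !kronM invMg !repM trmx_mul. Qed.

Lemma mckay_rep_trace :
  cform (cf_mul pi (rchar V)) (rchar W) = iG * \sum_x \tr (mckay_rep x).
Proof.
congr (_ * _); apply: eq_bigr => x _.
by rewrite !mxtrace_kron mxtrace_tr !mkcfE; ring.
Qed.

Lemma mckay_nat : exists k : nat, cform (cf_mul pi (rchar V)) (rchar W) = k%:R.
Proof.
exists (\rank (avg_mx mckay_rep)).
by rewrite mckay_rep_trace -avg_mx_trace //; exact: mckay_repM.
Qed.
End Multiplicity.

(** Determinant 1 makes [rho] preserve the alternating form [symp2], and End(V) preserves the
    symmetric trace form [swap_mx]; their tensor product is nondegenerate and alternating, so
    [avg_mx_symplectic] applies. *)
Lemma mckay_neq1 n (V : rep n) : cform (cf_mul pi (rchar V)) (rchar V) != 1.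
Proof.
rewrite mckay_rep_trace.
apply: (@avg_mx_symplectic _ _ _ _ _ (kron (symp2 C) (swap_mx C n))
  (kron (- symp2 C) (swap_mx C n))).
- exact: mckay_repM.
- by rewrite /mckay_rep invg1 !rep1 trmx1 !kron1.
- move=> x; rewrite /mckay_rep !kron_tr trmxK !kronM kron_swap.
  rewrite -[swap_mx _ _ *m _ *m _]mulmxA kronM.
  rewrite -trmx_mul !repMV trmx1 kron1 mulmx1 symp2_det.
  by case: (rhoSU x) => _ ->; rewrite scale1r.
- by rewrite kron_tr symp2_tr swap_mx_tr kronNl.
- by rewrite kronM mulmxN symp2_sq opprK swap_mxK kron1.
Qed.

Variables (r : nat) (gamma : 'I_r.+1 -> classFun C G).
Hypothesis gamma_inj : injective gamma.
Hypothesis gamma_irr : forall i, irr_char (gamma i).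
Hypothesis gamma0 : gamma ord0 = cf_one C G.
Variable xi : classFun C G.
Hypothesis xiE : xi = 2%:R *: gamma ord0 - pi.

Lemma mckay_xiE x : xi x = 2 - pi x.
Proof. by rewrite xiE cfDE cfNE cfZE gamma0 mkcfE mulr1. Qed.

Lemma mckay_xiform f g : xiform xi f g = 2 * cform f g - cform (cf_mul pi f) g.
Proof.
rewrite /xiform /cform [2 * _]mulrCA -mulrBr; congr (_ * _).
by rewrite mulr_sumr -sumrB; apply: eq_bigr => x _; rewrite !cf_mulE mckay_xiE; ring.
Qed.

Lemma mckay_xiformC f g : xiform xi f g = xiform xi g f.
Proof.
rewrite /xiform /cform; congr (_ * _); rewrite [RHS](reindex_inj invg_inj) /=.
by apply: eq_bigr => x _; rewrite !cf_mulE !mckay_xiE piV invgK; ring.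
Qed.

Lemma mckay_off i j : i != j -> exists k : nat, xiform xi (gamma i) (gamma j) = - k%:R.
Proof.
have [n [V [irrV VE]]] := gamma_irr i; have [m [W [irrW WE]]] := gamma_irr j.
move=> ij; rewrite mckay_xiform VE WE; have [k ->] := mckay_nat V W; exists k.
rewrite cform_orth ?mulr0 ?sub0r // -VE -WE => /gamma_inj E.
by rewrite E eqxx in ij.
Qed.

Lemma mckay_diag i : xiform xi (gamma i) (gamma i) = 2.
Proof.
have [n [V [irrV VE]]] := gamma_irr i.
have normV : cform (gamma i) (gamma i) = 1 by rewrite VE cform_norm.
have pos x : 0 <= cf_mul xi (gamma i) x * gamma i x^-1%g.
  rewrite cf_mulE mckay_xiE {2}VE rcharV -VE -mulrA -normCK.
  by rewrite mulr_ge0 ?pi_le2 ?exprn_ge0.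
have ge0 : 0 <= xiform xi (gamma i) (gamma i).
  by rewrite mulr_ge0 ?invr_ge0 ?ler0n // sumr_ge0.
(* If the form vanished, gamma_i would be supported at 1. This is false for the trivial character,
   as G has another element, and for any other it contradicts orthogonality to the trivial one. *)
have neq0 : xiform xi (gamma i) (gamma i) != 0.
  apply/eqP => /eqP; rewrite mulf_eq0 invr_eq0 pnatr_eq0 -[#|G| == 0]negbK -lt0n (ltnW G_gt1).
  rewrite /= psumr_eq0 // => /allP zero.
  have supp x : x != 1%g -> gamma i x = 0.
    move=> x1; have := zero x (mem_index_enum x); rewrite /= cf_mulE mckay_xiE {2}VE rcharV -VE.
    rewrite -mulrA -normCK mulf_eq0 sqrf_eq0 normr_eq0 => /orP[/eqP/pi_eq2 E|/eqP //].
    by rewrite E eqxx in x1.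
  have sum1 f : cform (gamma i) f = iG * (gamma i 1%g * f 1%g).
    rewrite /cform (bigD1 1%g) //= big1 ?addr0 ?invg1 // => x /supp ->.
    by rewrite mul0r.
  have g1 : gamma i 1%g != 0.
    by apply: contra_eq_neq normV => E; rewrite sum1 E !mul0r mulr0 eq_sym oner_neq0.
  have [i0|i0] := eqVneq i ord0.
    have [x x1] : exists x : G, x != 1%g.
      have /card_gt1P[x [y [_ _ xy]]] := G_gt1.
      by have [x1|x1] := eqVneq x 1%g; [exists y; rewrite -x1 eq_sym | exists x].
    by have := supp x x1; rewrite i0 gamma0 mkcfE => /eqP; rewrite oner_eq0.
  have [m [W [irrW WE]]] := gamma_irr ord0.
  have : cform (gamma i) (gamma ord0) = 0.
    by rewrite VE WE cform_orth // -VE -WE => /gamma_inj E; rewrite E eqxx in i0.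
  move/eqP; rewrite sum1 gamma0 mkcfE mulr1 mulf_eq0 (negPf g1) orbF invr_eq0.
  by rewrite pnatr_eq0 -[_ == _]negbK -lt0n (ltnW G_gt1).
(* With multiplicity k of gamma_i in pi * gamma_i, the value 2 - k is nonnegative and nonzero, and k
   is not 1; so k = 0. *)
move: ge0 neq0; rewrite mckay_xiform normV mulr1 VE; have := mckay_neq1 V.
have [k ->] := mckay_nat V V; rewrite subr_ge0 subr_eq0 (eqr_nat _ k 1) !(eqr_nat _ 2 k) (ler_nat _ k 2).
by case: k => [|[|[|k]]] //; rewrite subr0.
Qed.

Lemma mckay_cartan : exists A : 'I_r.+1 -> 'I_r.+1 -> int,
  [/\ forall i j, xiform xi (gamma i) (gamma j) = (A i j)%:~R,
      forall i j, A i j = A j i, forall i, A i i = 2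
    & forall i j, i != j -> A i j <= 0].
Proof.
have ex i j : exists a : int, xiform xi (gamma i) (gamma j) = a%:~R.
  have [<-|/mckay_off[k ->]] := eqVneq i j; first by exists 2; rewrite mckay_diag.
  by exists (- k%:Z); rewrite rmorphN.
exists (fun i j => sval (cid (ex i j))); split=> [i j|i j|i|i j ij]; case: cid => a aE //=.
- by case: cid => b /= bE; apply: (@intr_inj C); rewrite -aE -bE mckay_xiformC.
- by apply: (@intr_inj C); rewrite -aE mckay_diag.
- have [k kE] := mckay_off ij; have -> : a = - k%:Z by apply: (@intr_inj C); rewrite -aE kE rmorphN.
  by rewrite oppr_le0.
Qed.

Definition triv_rep d : rep d :=
  MxRepresentation (conj (erefl 1%:M) (fun x y _ _ => esym (mulmx1 1%:M))).

Lemma rchar_triv d x : rchar (triv_rep d) x = d%:R.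
Proof. by rewrite mkcfE mxtrace1. Qed.

Lemma mckay_virtual i : virtual (gamma i) /\ virtual (- gamma i).
Proof.
have [n [V [_ ->]]] := gamma_irr i; have z : rchar (triv_rep 0) = 0.
  by apply: classfunP => x; rewrite rchar_triv cf0E.
by split; [exists n, V, 0, (triv_rep 0) | exists 0, (triv_rep 0), n, V];
  rewrite z ?subr0 ?sub0r.
Qed.

Lemma mckay_xi_virtual : virtual xi.
Proof.
exists 2, (triv_rep 2), 2, rho; rewrite xiE; congr (_ - _); apply: classfunP => x.
by rewrite rchar_triv cfZE gamma0 mkcfE mulr1.
Qed.

End McKay.

(** * Vertex operators on the Fock space *)

From mathcomp Require Import classical_sets cardinality fsbigop.

Lemma tointE (C : numClosedFieldType) (m : int) : toint (m%:~R : C) = m.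
Proof.
rewrite /toint; case: xgetP => [n _ /intr_inj //|/(_ m)].
by move=> /(_ erefl).
Qed.

Section FockOperators.
Variables (C : numClosedFieldType) (G : finGroupType) (xi : classFun C G).
Variables (r : nat) (gamma : 'I_r.+1 -> classFun C G).
Variable eps : lattice r -> lattice r -> C.
Variable A : 'I_r.+1 -> 'I_r.+1 -> int.
Hypothesis xi_virtual : virtual xi.
Hypothesis gamma_virtual : forall i, virtual (gamma i) /\ virtual (- gamma i).
Hypothesis AE : forall i j, xiform xi (gamma i) (gamma j) = (A i j)%:~R.
Hypothesis AC : forall i j, A i j = A j i.
Hypothesis A2 : forall i, A i i = 2.
Hypothesis A_le0 : forall i j, i != j -> A i j <= 0.
Hypothesis eps_cocycle : is_cocycle xi gamma eps.
Local Notation RG := (RGamma C G).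
Local Notation Fk := (Fock C G r).
Local Notation lat := (lattice r).

Lemma xiform_sum (a b : lat) : xiform xi (lchar gamma a) (lchar gamma b) =
  (\sum_i \sum_j a 0 i * b 0 j * A i j)%:~R.
Proof.
rewrite rmorph_sum /=; under [RHS]eq_bigr do rewrite rmorph_sum /=.
rewrite /xiform /cform.
under [in LHS]eq_bigr => x _ do rewrite cf_mulE !cf_sumE [xi x * _]mulr_sumr mulr_suml.
rewrite exchange_big mulr_sumr; apply: eq_bigr => i _ /=.
under [in LHS]eq_bigr => x _ do rewrite mulr_sumr.
rewrite exchange_big mulr_sumr; apply: eq_bigr => j _ /=.
rewrite !rmorphM /= -AE /xiform /cform [RHS]mulrCA; congr (_ * _).
by rewrite mulr_sumr; apply: eq_bigr => x _; rewrite !cfZE cf_mulE; ring.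
Qed.

Lemma lformE (a b : lat) : lform xi gamma a b = \sum_i \sum_j a 0 i * b 0 j * A i j.
Proof. by rewrite /lform xiform_sum tointE. Qed.

Lemma xiformE (a b : lat) : xiform xi (lchar gamma a) (lchar gamma b) = (lform xi gamma a b)%:~R.
Proof. by rewrite lformE xiform_sum. Qed.

Local Notation "<( a , b )>" := (lform xi gamma a b) (format "<( a ,  b )>").

Lemma lformC a b : <( a, b )> = <( b, a )>.
Proof.
rewrite !lformE exchange_big; apply: eq_bigr => i _; apply: eq_bigr => j _.
by rewrite AC; ring.
Qed.

Lemma lformDr a b c : <( a, b + c )> = <( a, b )> + <( a, c )>.
Proof.
rewrite !lformE -big_split; apply: eq_bigr => i _; rewrite -big_split /=.
by apply: eq_bigr => j _; rewrite mxE; ring.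
Qed.

Lemma lformNr a b : <( a, - b )> = - <( a, b )>.
Proof.
rewrite !lformE -sumrN; apply: eq_bigr => i _; rewrite -sumrN /=.
by apply: eq_bigr => j _; rewrite mxE; ring.
Qed.

Lemma lformNl a b : <( - a, b )> = - <( a, b )>.
Proof. by rewrite lformC lformNr lformC. Qed.

Lemma lform_basis i j : <( lbasis i, lbasis j )> = A i j.
Proof.
rewrite lformE (bigD1 i) //= [X in _ + X]big1 ?addr0 => [|k ki]; last first.
  by rewrite big1 // => l _; rewrite mxE eqxx (negPf ki) !mul0r.
rewrite (bigD1 j) //= big1 ?addr0 => [|k kj]; last first.
  by rewrite !mxE !eqxx (negPf kj) mulr0 mul0r.
by rewrite !mxE !eqxx !mul1r.
Qed.

Lemma cartanE i j : cartan xi gamma i j = A i j.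
Proof. by rewrite mxE AE tointE. Qed.

(* [(s, i)] stands for the root alpha_i if [s = false] and -alpha_i if [s].     *)
Definition sroot (x : bool * 'I_r.+1) : lat := if x.1 then - lbasis x.2 else lbasis x.2.
Definition rootchar x := lchar gamma (sroot x).
Definition rform x y := <( sroot x, sroot y )>.

Lemma lchar_basis i : lchar gamma (lbasis i) = gamma i.
Proof.
rewrite /lchar (bigD1 i) //= big1 ?addr0 => [|j ji]; last first.
  by rewrite mxE eqxx (negPf ji) scale0r.
by rewrite mxE !eqxx scale1r.
Qed.

Lemma lcharN a : lchar gamma (- a) = - lchar gamma a.
Proof. by rewrite /lchar -sumrN; apply: eq_bigr => i _; rewrite mxE rmorphN scaleNr. Qed.

Lemma rootchar_virtual x : virtual (rootchar x).
Proof.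
by case: x => [[] i]; rewrite /rootchar /sroot /= ?lcharN lchar_basis; case: (gamma_virtual i).
Qed.

Lemma rformxx x : rform x x = 2.
Proof.
by case: x => [[] i]; rewrite /rform /sroot /= ?lformNr ?lformNl ?opprK lform_basis A2.
Qed.

Lemma rformC x y : rform x y = rform y x. Proof. exact: lformC. Qed.

Definition dlt (D : nat) (v : RG) := forall k, (D <= k)%N -> v k = 0.

Lemma dlt_ex (v : RG) : {D | dlt D v}.
Proof.
apply: cid; have /finite_seqP [s vs] := dsum_fin v.
exists (\sum_(k <- s) k).+1 => k sk; apply/eqP; apply/negPn/negP => vk.
have : [set` s]%classic k by rewrite -vs.
by move=> /= ks; move: sk; rewrite (big_rem k) //= ltnNge leq_addr.
Qed.

Definition dbound v := sval (dlt_ex v).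
Lemma dltP v : dlt (dbound v) v. Proof. by rewrite /dbound; case: (dlt_ex v). Qed.
Lemma dlt_le D D' v : (D <= D')%N -> dlt D v -> dlt D' v.
Proof. by move=> DD vD k Dk; apply: vD; exact: leq_trans Dk. Qed.
Lemma dlt0 v : dlt 0 v -> v = 0. Proof. by move=> v0; apply: dsumP => k; exact: v0. Qed.
Lemma dlt_zero D : dlt D 0. Proof. by []. Qed.
Lemma dltD D v w : dlt D v -> dlt D w -> dlt D (v + w).
Proof. by move=> vD wD k Dk; rewrite dsDE vD // wD // addr0. Qed.
Lemma dltZ D a v : dlt D v -> dlt D (a *: v).
Proof. by move=> vD k Dk; rewrite dsZE vD // scaler0. Qed.

Definition vH x n : {linear RG -> RG} := opH n (rootchar x).
Definition ve x n : {linear RG -> RG} := (-1) ^+ n \*: opE xi n (rootchar x).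
Definition vm x n : {linear RG -> RG} := opa_cre n (rootchar x).
Definition vp x n : {linear RG -> RG} := opa_ann xi n (rootchar x).

Lemma vH0 x v : vH x 0 v = v. Proof. exact/opH0/rootchar_virtual. Qed.
Lemma ve0 x v : ve x 0 v = v.
Proof. by rewrite /ve /= expr0 scale1r opE0 //; exact: rootchar_virtual. Qed.
Lemma vHC x y p q v : vH x p (vH y q v) = vH y q (vH x p v). Proof. exact: opHC. Qed.
Lemma veC x y p q v : ve x p (ve y q v) = ve y q (ve x p v).
Proof. by rewrite /ve /= !linearZ /= !scalerA mulrC opEC. Qed.
Lemma vmH x y l p v : vm x l (vH y p v) = vH y p (vm x l v). Proof. exact: opa_cre_H. Qed.
Lemma vpe x y l p v : vp x l (ve y p v) = ve y p (vp x l v).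
Proof. by rewrite /ve /= linearZ /= opa_ann_E. Qed.
Lemma newton_vH x n v : n%:R *: vH x n v = \sum_(l < n) vm x l (vH x (n - l.+1)%N v).
Proof. exact/opH_newton/rootchar_virtual. Qed.
Lemma newton_ve x n v : n%:R *: ve x n v = - \sum_(l < n) ve x (n - l.+1)%N (vp x l v).
Proof.
rewrite /ve /= scalerA mulrC -scalerA opE_newton //; last exact: rootchar_virtual.
rewrite scaler_sumr -sumrN; apply: eq_bigr => l _; have ln := ltn_ord l.
rewrite scalerA -exprD -scaleNr; congr (_ *: _).
have -> : (n + l = (n - l.+1) + (l.*2).+1)%N by lia.
by rewrite exprD exprS -signr_odd -[(-1) ^+ l.*2]signr_odd odd_double mulr1 mulrN1.
Qed.

Lemma rform_xiform x y : xiform xi (rootchar x) (rootchar y) = (rform x y)%:~R.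
Proof. exact: xiformE. Qed.

Lemma vpH x y l p v : vp x l (vH y p v) =
  vH y p (vp x l v) + (if (l < p)%N then (rform x y)%:~R *: vH y (p - l.+1)%N v else 0).
Proof. by rewrite -rform_xiform; apply: (opa_ann_H xi_virtual); exact: rootchar_virtual. Qed.

Lemma vpm x y l m v : vp x l (vm y m v) =
  vm y m (vp x l v) + (if l == m then (m.+1%:R * (rform x y)%:~R) *: v else 0).
Proof. by rewrite -rform_xiform; exact: opa_ann_cre. Qed.

Lemma dlt_vH D x p v : dlt D v -> dlt (D + p) (vH x p v).
Proof. by move=> vD k Dk; apply: (lt_H (d := D)) => [j|]; [rewrite lez_nat; exact: vD|lia]. Qed.
Lemma dlt_ve D x q v : dlt D v -> dlt (D - q) (ve x q v).
Proof.
move=> vD k Dk; have -> : ve x q v k = (-1) ^+ q *: opE xi q (rootchar x) v k by [].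
by rewrite (lt_E xi (d := D)) ?scaler0 //; lia.
Qed.
Lemma dlt_vp D x q v : dlt D v -> dlt D (vp x q v).
Proof. by move=> vD k Dk; apply: (lt_ann xi_virtual (d := D)) => [j|]; [rewrite lez_nat; exact: vD|lia]. Qed.
Lemma dlt_vm D x q v : dlt D v -> dlt (D + q.+1) (vm x q v).
Proof. by move=> vD k Dk; apply: (lt_cre (d := D)) => [j|]; [rewrite lez_nat; exact: vD|lia]. Qed.

Definition vW := W vH ve dbound.

Lemma vW_linear x N : linear (vW x N).
Proof. exact: (W_linear vH (dlt := dlt) dltP dlt_le dlt0 dltD dltZ dlt_ve). Qed.
HB.instance Definition _ x N := GRing.isLinear.Build C RG RG _ (vW x N) (vW_linear x N).

Lemma vp_W x y l N v :
  vp x l (vW y N v) = vW y N (vp x l v) + (rform x y)%:~R *: vW y (N - l.+1%:Z) v.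
Proof. exact: (ap_W vpe vpH dltP dlt0 dlt_ve dlt_vp). Qed.

Lemma vm_W x y l N v :
  vm x l (vW y N v) = vW y N (vm x l v) + (rform x y)%:~R *: vW y (N + l.+1%:Z) v.
Proof. exact: (am_W ve0 vmH newton_ve vpm rformC dltP dlt_le dlt0 dlt_ve dlt_vm). Qed.

Lemma vWW_ge0 x y (l : nat) N M v : rform x y = l ->
  vW x (N - l%:Z) (vW y M v) = (-1) ^+ l *: vW y (M - l%:Z) (vW x N v).
Proof.
exact: (WW_ge0 ve0 vHC veC newton_ve vpH rformC dltP dlt_le dlt0 dlt_zero dltD dlt_vH dlt_ve).
Qed.

Definition neg (x : bool * 'I_r.+1) := (~~ x.1, x.2).

Lemma sroot_neg x : sroot (neg x) = - sroot x.
Proof. by case: x => [[] i]; rewrite /sroot /= ?opprK. Qed.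

Lemma vWW_opp x N M v :
  vW x (N + 2) (vW (neg x) M v) - vW (neg x) (M + 2) (vW x N v) =
  amode vm vp x (- N - M - 2) v + (if N + M + 2 == 0 then (- N - 1)%:~R *: v else 0).
Proof.
apply: (WW_opp vH0 ve0 vHC veC vmH vpe newton_vH newton_ve vpH rformC dltP dlt_le dlt0
  dlt_zero dltD dlt_vH dlt_ve) => [|l w|l w].
- by rewrite /rform sroot_neg lformNr -/(rform x x) rformxx.
- by rewrite /vm /rootchar sroot_neg lcharN opa_cre_opp.
- by rewrite /vp /rootchar sroot_neg lcharN opa_ann_opp.
Qed.

Lemma lt_W (d : int) x N (v : RG) : (forall k : nat, d <= k%:Z -> v k = 0) ->
  forall k : nat, d + N <= k%:Z -> vW x N v k = 0.
Proof.
move=> v0 k dk; rewrite /vW /W /Wd ds_sumE big1 // => q _.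
case E : (N + q%:Z) => [p|p] //.
apply: (lt_H (d := d - q%:Z)) => [j dj|]; last by lia.
have -> : ve x q v j = (-1) ^+ q *: opE xi q (rootchar x) v j by [].
by rewrite (lt_E xi (d := d)) ?scaler0.
Qed.

(** Roots have norm 2, so the exponent condition reads p = N + q with N = -n - 1 - <x, be>: the mode
    is a coefficient of the abstract vertex operator. *)
Lemma X_sumE (n : int) x be (v : RG) :
  X_sum xi gamma n%:~R (sroot x) be v = vW x (- n - 1 - <( sroot x, be )>) v.
Proof.
set b := <( sroot x, be )>; set N := - n - 1 - b.
have Dv := @dltP v; set D := dbound v in Dv.
rewrite /vW /W -/D /Wd /X_sum.
pose s := [seq (`|(N + q%:Z)%R|%N, q) | q <- iota 0 D & 0 <= N + q%:Z].
have us : uniq s.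
  rewrite map_inj_in_uniq; first by rewrite filter_uniq // iota_uniq.
  by move=> p q _ _ [].
rewrite -(@fsbig_widen _ _ _ _ [set` s]%classic).
- rewrite -fsbig_seq // big_map big_filter big_mkcond /= -{1}[D]subn0 big_mkord.
  apply: eq_bigr => q _; case: ifP => Nq.
    rewrite -linearZ; case: (N + q%:Z) Nq => //.
  by rewrite Hz_neg //; lia.
- move=> pq /= /mapP[q]; rewrite mem_filter => /andP[Nq _] -> /=.
  rewrite -/b -/(rform x x) rformxx (_ : 2%:~R / 2 = 1 :> rat) //.
  have -> : `|(N + q%:Z)%R|%N%:R = (N + q%:Z)%:~R :> rat by rewrite natr_absz ger0_norm.
  by rewrite /N !rmorphD !rmorphN /= -pmulrn; ring.
- move=> [p q] [/= pq nps]; rewrite -/b -/(rform x x) rformxx (_ : 2%:~R / 2 = 1 :> rat) // in pq.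
  have {}pq : p%:Z = N + q%:Z.
    apply/eqP; rewrite -(eqr_int rat) /N !rmorphD !rmorphN /=; apply/eqP.
    by rewrite -!pmulrn; move: pq; rewrite -[b%:~R]opprK => /eqP; rewrite subr_eq => /eqP/(canRL (subrK _)) ->; ring.
  have [qD|Dq] := ltnP q D.
    case: nps; apply/mapP; exists q; last by rewrite -pq.
    by rewrite mem_filter mem_iota /= qD andbT -pq.
  rewrite -linearZ -[X in opH _ _ X]/(ve x q v) (e_gt dlt0 dlt_ve x Dv Dq).
  by rewrite linear0.
Qed.

Lemma opXE (n : int) x (v : Fk) be : opX xi gamma eps n%:~R (sroot x) v be =
  eps (sroot x) (be - sroot x) *:
    vW x (- n - 1 - <( sroot x, be - sroot x )>) (v (be - sroot x)).
Proof. by rewrite -X_sumE. Qed.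

Lemma opX_linear (n : int) x : linear (opX xi gamma eps n%:~R (sroot x)).
Proof.
move=> a u v; apply: dsumP => be; rewrite dsDE dsZE !opXE dsDE dsZE linearP.
by rewrite scalerDr !scalerA mulrC.
Qed.

HB.instance Definition _ (n : int) x :=
  GRing.isLinear.Build C Fk Fk _ (opX xi gamma eps n%:~R (sroot x)) (opX_linear n x).

Lemma opa_linear n ga : linear (opa xi gamma n ga).
Proof.
by move=> a u v; case: n => [[|n]|n]; apply: dsumP => be; rewrite /= ?linearP.
Qed.

HB.instance Definition _ n ga :=
  GRing.isLinear.Build C Fk Fk _ (opa xi gamma n ga) (opa_linear n ga).

Lemma opaE (n : int) i (v : Fk) be : opa xi gamma n (lbasis i) v be =
  amode vm vp (false, i) n (v be) +
  (if n == 0 then (<( lbasis i, be )>)%:~R *: v be else 0).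
Proof.
case: n => [[|n]|n]; rewrite /= ?add0r ?addr0 //.
by rewrite xiformE.
Qed.

Lemma amode_W i n x N v :
  amode vm vp i n (vW x N v) = vW x N (amode vm vp i n v) +
    (if n == 0 then 0 else (rform i x)%:~R *: vW x (N - n) v).
Proof.
case: n => [[|n]|n] /=; first by rewrite linear0 addr0.
  by rewrite vp_W.
by rewrite vm_W NegzE opprK.
Qed.

(** For nonzero [n] the commutator arises on [RGamma] from [amode_W]; for n = 0 it arises from the
    shift of the lattice point by the root. *)
Lemma opa_opX (n m : int) i x (v : Fk) :
  opa xi gamma n (lbasis i) (opX xi gamma eps m%:~R (sroot x) v) =
  opX xi gamma eps m%:~R (sroot x) (opa xi gamma n (lbasis i) v) +
  (rform (false, i) x)%:~R *: opX xi gamma eps (n + m)%:~R (sroot x) v.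
Proof.
apply: dsumP => be; rewrite dsDE dsZE !opXE !opaE opXE; set ga := be - sroot x.
set c := eps _ _; set b := <( sroot x, ga )>; set k := rform _ _.
have -> : <( lbasis i, be )> = <( lbasis i, ga )> + k.
  by rewrite /k /rform -lformDr /ga subrK.
rewrite linearZ /= amode_W -/k [X in _ = c *: X + _]linearD /= !scalerDr -!addrA; congr (_ + _).
rewrite (_ : - m + (- 1 + (- b - n)) = - (n + m) + (- 1 - b)); last by lia.
case: eqP => [->|_]; last by rewrite linear0 scaler0 add0r addr0 scalerA mulrC -scalerA.
rewrite scaler0 !add0r linearZ /= rmorphD /= scalerDl !scalerA.
by rewrite linearZ /= scalerDr !scalerA ![_ * c]mulrC.
Qed.

Lemma amodeC i j n m v : amode vm vp i n (amode vm vp j m v) =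
  amode vm vp j m (amode vm vp i n v) +
  (if n == - m then (n * rform i j)%:~R *: v else 0).
Proof.
have mC p q w : vm i p (vm j q w) = vm j q (vm i p w) by exact: opa_creC.
have pC p q w : vp i p (vp j q w) = vp j q (vp i p w) by exact: opa_annC.
case: n => [[|n]|n]; case: m => [[|m]|m] //=;
  rewrite ?linear0 ?mul0r ?scale0r ?if_same ?addr0 // ?mC ?pC ?addr0 //.
  rewrite vpm; congr (_ + _); rewrite NegzE opprK eqz_nat eqSS.
  by case: eqP => // ->; rewrite rmorphM.
rewrite vpm -addrA; case: (eqVneq m n) => [<-|mn].
  by rewrite NegzE eqxx -scalerDl mulNr rmorphN rformC rmorphM subrr scale0r addr0.
by rewrite NegzE eqr_opp eqz_nat eqSS eq_sym (negPf mn) !addr0.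
Qed.

Lemma opa_opa (n m : int) i j (v : Fk) :
  opa xi gamma n (lbasis i) (opa xi gamma m (lbasis j) v) =
  opa xi gamma m (lbasis j) (opa xi gamma n (lbasis i) v) +
  (if n == - m then (n * A i j)%:~R else 0) *: v.
Proof.
apply: dsumP => be; rewrite dsDE dsZE !opaE !linearD /= amodeC.
have -> : rform (false, i) (false, j) = A i j by exact: lform_basis.
have -> : amode vm vp (false, i) n (if m == 0 then (<( lbasis j, be )>)%:~R *: v be else 0) =
  (if m == 0 then (<( lbasis j, be )>)%:~R *: amode vm vp (false, i) n (v be) else 0).
  by case: ifP; rewrite ?linearZ ?linear0.
have -> : amode vm vp (false, j) m (if n == 0 then (<( lbasis i, be )>)%:~R *: v be else 0) =
  (if n == 0 then (<( lbasis i, be )>)%:~R *: amode vm vp (false, j) m (v be) else 0).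
  by case: ifP; rewrite ?linearZ ?linear0.
have -> : (if n == - m then (n * A i j)%:~R else 0) *: v be =
  (if n == - m then (n * A i j)%:~R *: v be else 0) by case: ifP; rewrite ?scale0r.
have [->|_] := eqVneq n 0; have [->|_] := eqVneq m 0;
  rewrite ?oppr0 ?eqxx ?mul0r ?scale0r ?if_same ?addr0 ?scalerDr ?scalerA //=.
- by rewrite !scaler0 !add0r mulrC.
- by rewrite linear0 scaler0 addr0.
- by rewrite scaler0 add0r addr0 [in RHS]addrC add0r.
Qed.

(** The product of the two norms is 4, so only the parity of the pairing is left in the sign of the
    cocycle. *)
Lemma eps_swap (l : nat) x y c : rform x y = l%:Z ->
  eps (sroot x) (sroot y + c) * eps (sroot y) c =
  (-1) ^+ l * (eps (sroot y) (sroot x + c) * eps (sroot x) c).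
Proof.
case: eps_cocycle => eps0 _ epsA epsV xy; rewrite -!epsA [sroot y + sroot x]addrC mulrA.
congr (_ * _); have /(congr1 ( *%R^~ (eps (sroot y) (sroot x)))) := epsV (sroot x) (sroot y).
rewrite divfK // => ->; rewrite -/(rform x y) xy.
rewrite -!/(rform _ _) !rformxx -[_ + _]/((l + 4)%N : int) -exprnP.
by rewrite exprD -[(-1) ^+ 4]signr_odd mulr1.
Qed.

(** The sign of [eps_swap] cancels that of [WW_ge0]. This covers equal roots (pairing 2) and the
    pair alpha_i, -alpha_j with i different from j (pairing -a_ij >= 0). *)
Lemma opXC (l : nat) (n m : int) x y (v : Fk) : rform x y = l%:Z ->
  opX xi gamma eps n%:~R (sroot x) (opX xi gamma eps m%:~R (sroot y) v) =
  opX xi gamma eps m%:~R (sroot y) (opX xi gamma eps n%:~R (sroot x) v).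
Proof.
move=> xy; apply: dsumP => be; rewrite !opXE; set c := be - sroot x - sroot y.
have -> : be - sroot y - sroot x = c by rewrite addrAC.
have -> : be - sroot x = sroot y + c by rewrite /c [RHS]addrC subrK.
have -> : be - sroot y = sroot x + c by rewrite /c addrAC [RHS]addrC subrK.
rewrite !linearZ /= !scalerA (lformDr _ (sroot y)) (lformDr _ (sroot x)) -!/(rform _ _) (rformC y x) xy [eps (sroot y) c * _]mulrC (eps_swap c xy).
set N := - n - 1 - <( sroot x, c )>; set M := - m - 1 - <( sroot y, c )>.
have -> : - n - 1 - (l%:Z + <( sroot x, c )>) = N - l%:Z by rewrite /N; lia.
have -> : - m - 1 - (l%:Z + <( sroot y, c )>) = M - l%:Z by rewrite /M; lia.
rewrite vWW_ge0 // scalerA; congr (_ *: _).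
by rewrite mulrAC -exprD -signr_odd oddD addbb mul1r mulrC.
Qed.

Lemma eps_neg i : eps (- lbasis i) (lbasis i) = eps (lbasis i) (- lbasis i).
Proof.
case: eps_cocycle => eps0 _ epsA epsV; have := epsV (lbasis i) (- lbasis i).
rewrite !lformNr !lformNl !opprK lform_basis A2 => /(canRL (divfK (eps0 _ _))) ->.
have -> : (-1) ^ (-2 + 2 * 2) = 1 :> C by rewrite -exprnP expr2 mulrNN mulr1.
by rewrite mul1r.
Qed.

(** Both orders carry the same cocycle factor, by the cocycle identity and [eps_neg]. The constant b
    + n from [vWW_opp] is the eigenvalue b of a_0 plus the central term n. *)
Lemma opX_opp (n m : int) i (v : Fk) :
  opX xi gamma eps n%:~R (lbasis i) (opX xi gamma eps m%:~R (- lbasis i) v) -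
  opX xi gamma eps m%:~R (- lbasis i) (opX xi gamma eps n%:~R (lbasis i) v) =
  eps (lbasis i) (- lbasis i) *:
    (opa xi gamma (n + m) (lbasis i) v + (if n == - m then n%:~R else 0) *: v).
Proof.
case: (eps_cocycle) => eps0 eps1 epsA epsV.
pose x := (false, i); rewrite -[lbasis i]/(sroot x).
have mX (k : int) w : opX xi gamma eps k%:~R (- sroot x) w =
    opX xi gamma eps k%:~R (sroot (neg x)) w by rewrite sroot_neg.
apply: dsumP => be; rewrite !mX -[X in _ + X]scaleN1r !(dsDE, dsZE) scaleN1r !opXE sroot_neg opaE opprK.
rewrite subrK addrK !linearZ /= !scalerA.
have -> : eps (- sroot x) be * eps (sroot x) (be - sroot x) = eps (sroot x) (- sroot x).
  rewrite mulrC.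
  by rewrite [be - _]addrC -epsA subrr; case: (eps1 be) => _ ->; rewrite mulr1.
have -> : eps (- sroot x) (be + sroot x) * eps (sroot x) be = eps (sroot x) (- sroot x).
  rewrite [be + _]addrC -epsA addNr; case: (eps1 be) => _ ->.
  by rewrite mulr1 eps_neg.
rewrite -scalerDr; congr (_ *: _).
rewrite !lformDr !lformNl !lformNr -!/(rform _ _) rformxx.
set b := <( _, be )>; pose N := - n - 1 - b; pose M := - m - 1 + b.
have -> : - n - 1 - (b - 2) = N + 2 by rewrite /N; lia.
have -> : - m - 1 - - b = M by rewrite /M; lia.
have -> : - m - 1 - (- b - 2) = M + 2 by rewrite /M; lia.
rewrite -[- n - 1 - b]/N vWW_opp.
have -> : - N - M - 2 = n + m by rewrite /N /M; lia.
rewrite -[RHS]addrA; congr (_ + _).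
have -> : (N + M + 2 == 0) = (n + m == 0) by rewrite /N /M; lia.
rewrite -addr_eq0.
have -> : - N - 1 = b + n by rewrite /N; lia.
by case: ifP; rewrite ?scale0r ?addr0 // rmorphD scalerDl.
Qed.


Lemma opX_nil x (v : Fk) : exists N, iter N (opX xi gamma eps 0%:~R (sroot x)) v = 0.
Proof.
have /finite_seqP [s vs] := dsum_fin v.
have sv be : v be != 0 -> be \in s.
  by move=> vbe; have : [set` s]%classic be by rewrite -vs.
pose B := (\sum_(be <- s) `|<( sroot x, be )>|)%N; pose D := (\sum_(be <- s) dbound (v be))%N.
(* Each application adds 2 to the pairing with the root and adds -1 - <x, be> to the degree, so the
   degree bound falls quadratically in [t]; at t = B + D it is no longer positive. *)
have inv t : forall be, let w := iter t (opX xi gamma eps 0%:~R (sroot x)) v be in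
    (w != 0 -> 2 * t%:Z - B%:Z <= <( sroot x, be )>) /\
    (forall k : nat, D%:Z + t%:Z * B%:Z - t%:Z * t%:Z <= k%:Z -> w k = 0).
  elim: t => [|t IH] be w'; rewrite {}/w' ?iterS ?opXE.
    split=> [/sv bs|k Dk].
      have : (`|<( sroot x, be )>| <= B)%N by rewrite /B (big_rem be) //= leq_addr.
      by move: (<( _, _ )>) => b; lia.
    have [vbe|/sv bs] := eqVneq (v be) 0; first by rewrite vbe.
    have : (dbound (v be) <= D)%N by rewrite /D (big_rem be) //= leq_addr.
    by move=> bD; apply: (@dltP (v be)); lia.
  set w := iter t _ v (be - sroot x); have [wb wk] := IH (be - sroot x).
  rewrite -/w in wb wk; have [w0|w0] := eqVneq w 0.
    by rewrite w0 linear0 scaler0 eqxx; split.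
  have {wb} := wb w0; rewrite lformDr lformNr -/(rform x x) rformxx => wb.
  split=> [_|k Dk]; first by lia.
  rewrite dsZE [X in _ *: X](_ : _ = 0) ?scaler0 //.
  by apply: (lt_W (d := D%:Z + t%:Z * B%:Z - t%:Z * t%:Z)) => [k'|]; [exact: wk|lia].
exists (B + D)%N; apply: dsumP => be; apply: dsumP => k.
by have [_ ->] := inv (B + D)%N be => //; nia.
Qed.

Lemma rformE s t i j : rform (s, i) (t, j) = (-1) ^+ (s (+) t) * A i j.
Proof.
by case: s t => [] []; rewrite /rform /sroot /= ?lformNl ?lformNr lform_basis ?opprK
  ?expr0 ?expr1 ?mul1r ?mulN1r.
Qed.

Lemma opX_serre s i j (m : int) (w : Fk) : i != j ->
  adpow (opX xi gamma eps 0%:~R (sroot (s, i))) (opX xi gamma eps m%:~R (sroot (s, j)))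
    `|1 - A i j| w = 0.
Proof.
move=> ij; have A0 := A_le0 ij; pose l := `|A i j|%N.
have lE : A i j = - l%:Z by rewrite /l; lia.
have -> : `|1 - A i j|%N = l.+1 by rewrite /l; lia.
case: eps_cocycle => eps0 _ _ _; pose c := eps (lbasis i) (- lbasis i).
have c0 : c != 0 by exact: eps0.
have sE : ((-1) ^+ s * c) * ((-1) ^+ s)%:~R = c.
  by rewrite rmorphXn /= rmorphN1 mulrAC -exprD addnn -signr_odd odd_double mul1r.
pose h : {linear Fk -> Fk} := ((-1) ^+ s * c) \*: opa xi gamma 0 (lbasis i).
have hE u : h u = ((-1) ^+ s * c) *: opa xi gamma 0 (lbasis i) u by [].
(* The sl_2 is spanned by X_0 of the two opposite roots, with [h] a multiple of a_0 and scaling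
   factor the cocycle value [c]; X_m of the second root is a lowest weight vector because, by
   [opXC], it commutes with [f]. *)
apply: (serre (f := opX xi gamma eps 0%:~R (sroot (neg (s, i)))) (h := h) c0) => [u|u|u|u|u|u].
- have := opX_opp 0 0 i u; rewrite oppr0 eqxx scale0r !addr0 -/c.
  rewrite sroot_neg hE /sroot; case: (s) => /= uE; last by rewrite expr0 mul1r.
  by rewrite sroot_neg /sroot /= opprK expr1 mulN1r scaleNr -uE opprB.
- rewrite !hE opa_opX scalerDr; congr (_ + _); first by rewrite linearZ.
  by rewrite add0r rformE A2 scalerA rmorphM mulrA addFb sE mulrC.
- rewrite !hE opa_opX scalerDr -scaleNr; congr (_ + _); first by rewrite linearZ.
  by rewrite add0r rformE lE scalerA rmorphM mulrA addFb sE rmorphN /= mulrN mulrC.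
- by apply: (@opXC l); rewrite rformE addNb addbb lE mulN1r opprK.
- exact: opX_nil.
- exact: opX_nil.
Qed.

Definition vertex_op (g : tor_gen r) : Fk -> Fk :=
  match g with
  | TorC => id
  | TorH i n => opa xi gamma n (lbasis i)
  | TorX s i n => opX xi gamma eps n%:~R (sroot (s, i))
  end.

Lemma vertex_op_linear g : linear (vertex_op g).
Proof.
case: g => [|i n|s i n] a u v //=; first exact: opa_linear.
exact: opX_linear.
Qed.

Lemma vertex_op_rel s t : tor_rel (cartan xi gamma) eps s t ->
  lie_act vertex_op s =1 lie_act vertex_op t.
Proof.
case=> {s t} [t|i j n m|s i j n m|i n m|i j n m ij|s i n m|s i j m ij] v /=.
- by rewrite subrr.
- by rewrite opa_opa cartanE addrAC subrr add0r.
- rewrite opa_opX addrAC subrr add0r.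
  by rewrite rformE cartanE rmorphM rmorphXn /= rmorphN1.
- by rewrite opX_opp.
- apply/eqP; rewrite subr_eq0; apply/eqP.
  by apply: (@opXC `|A i j|%N); rewrite rformE mulN1r; have := A_le0 ij; lia.
- apply/eqP; rewrite subr_eq0; apply/eqP.
  by apply: (@opXC 2); exact: rformxx.
(* The iterated bracket of terms acts as the iterated commutator [adpow]. *)
- rewrite -[RHS](opX_serre s m v ij).
  by rewrite cartanE; elim: `|_|%N v => //= n IH v; rewrite !IH.
Qed.

End FockOperators.

Theorem theorem7p2 (R : realType) (Gamma : finGroupType)
    (rho : mx_representation R[i] [set: Gamma] 2)
    (r : nat) (gamma : 'I_r.+1 -> classFun R[i] Gamma)
    (eps : lattice r -> lattice r -> R[i]) :
  let xi := 2%:R *: gamma ord0 - rchar rho in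
  (1 < #|Gamma|)%N ->
  mx_faithful rho ->
  (forall g, rho g \is unitarymx /\ \det (rho g) = 1) ->
  injective gamma ->
  (forall f, irr_char f <-> exists i, f = gamma i) ->
  gamma ord0 = cf_one R[i] Gamma ->
  is_cocycle xi gamma eps ->
  exists! Phi : toroidal (cartan xi gamma) eps ->
                Fock R[i] Gamma r -> Fock R[i] Gamma r,
    [/\ lie_rep Phi,
        forall i n, Phi (tor_x (cartan xi gamma) eps false i n)
                    = opX xi gamma eps n%:~R (lbasis i),
        forall i n, Phi (tor_x (cartan xi gamma) eps true i n)
                    = opX xi gamma eps n%:~R (- lbasis i),
        forall i n, Phi (tor_h (cartan xi gamma) eps i n)
                    = opa xi gamma n (lbasis i)
      & Phi (tor_c (cartan xi gamma) eps) = id].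
Proof.
move=> xi G_gt1 ff SU inj irr g0 coc.
have girr i : irr_char (gamma i) by apply/irr; exists i.
have [A [AE AC A2 A_le0]] := mckay_cartan G_gt1 ff SU inj girr g0 (erefl xi).
have xi_virtual := mckay_xi_virtual g0 (erefl xi).
have gamma_virtual := mckay_virtual girr.
have [Phi [[rep gen] uniq]] := presLie_rep_unique (vertex_op_linear eps AE AC A2)
  (vertex_op_rel xi_virtual gamma_virtual AE AC A2 A_le0 coc).
exists Phi; split=> [|Psi [Psi_rep X X' H c]].
  by split=> // [i n|i n|i n|]; apply: gen.
by apply: uniq; split=> // -[|i n|[] i n]; [exact: c | exact: H | exact: X' | exact: X].
Qed.
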